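(* Let $n\ge 2$ and let $U\subseteq\mathbb{R}^n=\mathbb{R}\times\mathbb{R}^{n-1}$ be an open subset such that the projection $p\colon U\to\mathbb{R}^{n-1}$, $(t,u)\mapsto u$, has connected fibers and its image $p(U)$ is star-shaped with respect to $0\in\mathbb{R}^{n-1}$. Then, for every $k\ge 0$, $$H^k_{book}(U)\cong\mathbb{R}^{b_k},\qquad b_k=\binom{n-1}{k}\binom{n+k-2}{k},$$ with basis $$\left\{[\partial_t\wedge(u_{I'}\partial_{J'})],\ [u_I\partial_J]\;:\;(I',J')\text{ and }(I,J)\text{ admissible},\ |I'|=|J'|=k-1,\ |I|=|J|=k\right\}.$$
   Context: $\mathbb{R}^n=\mathbb{R}\times\mathbb{R}^{n-1}$ has coordinates $(t,u_1,\dots,u_{n-1})$. $E=\sum_{i=1}^{n-1}u_i\partial_{u_i}$, and the book Poisson structure is $\Lambda_{book}=\partial_t\wedge E$. $H^\bullet_{book}(U)$ is the cohomology of $(\mathfrak{X}^\bullet(U),d_{book})$, where $\mathfrak{X}^\bullet(U)$ are the smooth multivector fields on $U$ and $d_{book}=[\Lambda_{book},\cdot]$ (Schouten bracket). Multi-indices: $I=(i_1\le\dots\le i_k)$ and $J=(j_1<\dots<j_k)$ have entries in $\{1,\dots,n-1\}$; the length $k$ is written $|I|$, $|J|$. $u_I=u_{i_1}\cdots u_{i_k}$ and $\partial_J=\partial_{u_{j_1}}\wedge\dots\wedge\partial_{u_{j_k}}$, with $u_\emptyset=1$, $\partial_\emptyset=1$; there are no multi-indices of negative length. For $J$ strictly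 increasing, $J^c$ is the strictly increasing multi-index whose set of entries is the complement of that of $J$ in $\{1,\dots,n-1\}$. The pair $(I,J)$ ($I$ weakly increasing, $J$ strictly increasing) is admissible if $\max(I)\le\max(J^c)$, with the convention $\max(\emptyset)=-\infty$. *)

(* Defs.v *)
From HB Require Import structures.
From mathcomp Require Import all_boot all_order all_algebra.
From mathcomp Require Import generic_quotient ring_quotient.
From mathcomp Require Import boolp classical_sets functions reals.
From mathcomp Require Import topology normedtype derive.

Set Implicit Arguments.
Unset Strict Implicit.
Unset Printing Implicit Defensive.

Import Order.TTheory GRing.Theory Num.Theory.
Import numFieldNormedType.Exports.

Local Open Scope classical_set_scope.
Local Open Scope quotient_scope.
Local Open Scope ring_scope.

Lemma derive_lin {R : numFieldType} {V W : normedModType R} (f g : V -> W)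
    (a : R) x v : derivable f x v -> derivable g x v ->
  derivable (a *: f + g) x v /\
  'D_v (a *: f + g) x = a *: 'D_v f x + 'D_v g x.
Proof.
move=> df dg; have daf : derivable (a *: f) x v by exact: derivableZ.
by split; [exact: derivableD|rewrite (deriveD daf dg) (deriveZ _ df)].
Qed.

Section SmoothFunctions.
Context {R : realType} {N : nat}.
Implicit Types (U : set 'rV[R]_N) (f : 'rV[R]_N -> R^o).

Definition partial (i : 'I_N) f : 'rV[R]_N -> R^o :=
  fun x => 'D_(delta_mx 0 i) f x.

Definition iter_partial (s : seq 'I_N) f : 'rV[R]_N -> R^o :=
  foldr partial f s.

Definition smooth U f := forall (s : seq 'I_N) x, U x ->
  {for x, continuous (iter_partial s f)} /\
  forall i, derivable (iter_partial s f) x (delta_mx 0 i).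

Lemma smooth_derivable U f i x : smooth U f -> U x ->
  derivable f x (delta_mx 0 i).
Proof. by move=> /(_ [::] x) sf /sf[]. Qed.

Lemma partial_lin U f g a i x : smooth U f -> smooth U g -> U x ->
  partial i (a *: f + g) x = a * partial i f x + partial i g x.
Proof.
move=> sf sg Ux; rewrite /partial.
have df := smooth_derivable (i := i) sf Ux.
have dg := smooth_derivable (i := i) sg Ux.
exact: (derive_lin a df dg).2.
Qed.

Lemma smooth0 U : smooth U 0.
Proof.
move=> s x Ux; have -> : iter_partial s (0 : 'rV[R]_N -> R^o) = cst 0.
  elim: s => [//|i s] /= ->; apply/funext => y.
  by rewrite /partial derive_cst.
by split=> [|i]; [exact: cst_continuous|exact: derivable_cst].
Qed.

Lemma smooth_lin U f g a : open U -> smooth U f -> smooth U g ->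
  smooth U (a *: f + g).
Proof.
move=> oU sf sg.
have eqU s x : U x -> iter_partial s (a *: f + g) x =
    (a *: iter_partial s f + iter_partial s g) x.
  elim: s x => [//|i s IHs] x Ux /=.
  rewrite /partial (@near_eq_derive _ _ _ _
    (a *: iter_partial s f + iter_partial s g)); last first.
    by near=> y; apply: IHs; near: y; exact: open_nbhs_nbhs.
  have [_ /(_ i) df] := sf s x Ux; have [_ /(_ i) dg] := sg s x Ux.
  exact: (derive_lin a df dg).2.
move=> s x Ux.
have nearU : \forall y \near x, (a *: iter_partial s f + iter_partial s g) y =
    iter_partial s (a *: f + g) y.
  by near=> y; apply/esym/eqU; near: y; exact: open_nbhs_nbhs.
have [cf df] := sf s x Ux; have [cg dg] := sg s x Ux; split=> [|i].
  rewrite /prop_for/continuous_at (eqU _ _ Ux).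
  apply: cvg_trans (near_eq_cvg nearU) _.
  exact: (cvgD (cvgZl_tmp (k := a) cf) cg).
apply: near_eq_derivable nearU _.
exact: (derive_lin a (df i) (dg i)).1.
Unshelve. all: by end_near. Qed.

End SmoothFunctions.

(* A multivector field P on R^N is given by its coefficients: P S is the
   coefficient function of the wedge of the d/dx_i, i in S, taken in increasing
   order, so that P = \sum_S P S d_S.  Over an open set U only the values of the
   functions P S on U are relevant: every condition below is imposed on U. *)
Definition mvfield (R : realType) (N : nat) : Type :=
  {set 'I_N} -> 'rV[R]_N -> R^o.

HB.instance Definition _ (R : realType) (N : nat) :=
  GRing.Lmodule.on (mvfield R N).

Section MultivectorFields.
Context {R : realType} {N : nat}.
Implicit Types (P Q : mvfield R N) (S A : {set 'I_N}) (U : set 'rV[R]_N).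

(* d_A /\ d_B = ext_sign A B d_(A :|: B) for disjoint A and B. *)
Definition ext_sign (A B : {set 'I_N}) : R :=
  (-1) ^+ #|[set ij : 'I_N * 'I_N |
              [&& ij.1 \in A, ij.2 \in B & (ij.2 < ij.1)%N]]|.

Definition wedge P Q : mvfield R N := fun S x =>
  \sum_(A : {set 'I_N} | A \subset S)
    ext_sign A (S :\: A) * (P A x * Q (S :\: A) x).

Definition mv1 : mvfield R N := fun S _ => (S == finset.set0)%:R.

Definition mvd (i : 'I_N) : mvfield R N := fun S _ => (S == [set i]%SET)%:R.

Definition mvscale (f : 'rV[R]_N -> R^o) P : mvfield R N :=
  fun S x => f x * P S x.

Definition mvpartial (i : 'I_N) P : mvfield R N := fun S => partial i (P S).

(* Left and right derivatives with respect to the odd generator d_i of the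
   exterior algebra: d_i /\ d_S |-> d_S, resp. d_S /\ d_i |-> d_S. *)
Definition mvdl (i : 'I_N) P : mvfield R N := fun S x =>
  if i \in S then 0 else ext_sign [set i]%SET S * P (i |: S)%SET x.

Definition mvdr (i : 'I_N) P : mvfield R N := fun S x =>
  if i \in S then 0 else ext_sign S [set i]%SET * P (i |: S)%SET x.

(* The Schouten bracket extending the commutator of vector fields and
   [X, f] = X f.  On homogeneous P and Q of degrees p and q the second term
   equals
   (-1)^((p-1)(q-1)) \sum_i wedge (mvdr i Q) (mvpartial i P). *)
Definition schouten P Q : mvfield R N :=
  \sum_(i < N) (wedge (mvdr i P) (mvpartial i Q)
                - wedge (mvpartial i P) (mvdl i Q)).

Definition smooth_mvfield U (k : nat) P :=
  (forall S, smooth U (P S)) /\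
  (forall S x, #|S| != k -> U x -> P S x = 0).

Definition eq_on U P Q := forall S x, U x -> P S x = Q S x.

Definition cocycle U (L : mvfield R N) (k : nat) P :=
  smooth_mvfield U k P /\ eq_on U (schouten L P) 0.

Definition coboundary U (L : mvfield R N) (k : nat) P :=
  if k is l.+1
  then exists2 Q, smooth_mvfield U l Q & eq_on U P (schouten L Q)
  else eq_on U P 0.

Lemma mvsumE (I : finType) (F : I -> mvfield R N) S x :
  (\sum_i F i) S x = \sum_i F i S x.
Proof. by elim/big_ind2 : _ => // ? ? ? ? <- <-. Qed.

Lemma wedge_linr P Q Q' Q'' a S x :
  (forall A, Q'' A x = a * Q A x + Q' A x) ->
  wedge P Q'' S x = a * wedge P Q S x + wedge P Q' S x.
Proof.
move=> eQ; rewrite /wedge mulr_sumr -big_split /=; apply: eq_bigr => A _.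
by rewrite eQ !mulrDr (mulrCA (P A x)) (mulrCA _ a).
Qed.

Lemma schouten_linr U L P Q a S x :
  (forall A, smooth U (P A)) -> (forall A, smooth U (Q A)) -> U x ->
  schouten L (a *: P + Q) S x = a * schouten L P S x + schouten L Q S x.
Proof.
move=> sP sQ Ux; rewrite /schouten !mvsumE mulr_sumr -big_split /=.
apply: eq_bigr => i _.
have fE (X Y : mvfield R N) : (X - Y) S x = X S x - Y S x by [].
rewrite !fE (@wedge_linr (mvdr i L) (mvpartial i P) (mvpartial i Q) _ a);
  last first.
  by move=> A; rewrite /mvpartial (@partial_lin _ _ U).
rewrite (@wedge_linr (mvpartial i L) (mvdl i P) (mvdl i Q) _ a); last first.
  move=> A; rewrite /mvdl; case: ifP => _; first by rewrite mulr0 addr0.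
  have -> : (a *: P + Q) (i |: A)%SET x =
    a * P (i |: A)%SET x + Q (i |: A)%SET x by [].
  by rewrite mulrDr mulrCA.
by rewrite mulrBr opprD addrACA.
Qed.

Lemma smooth_mvfield0 U k : smooth_mvfield U k 0.
Proof. by split=> [S|//]; exact: smooth0. Qed.

Lemma smooth_mvfield_lin U k a P Q : open U ->
  smooth_mvfield U k P -> smooth_mvfield U k Q ->
  smooth_mvfield U k (a *: P + Q).
Proof.
move=> oU [sP dP] [sQ dQ]; split=> [S|S x Sk Ux].
  by apply: smooth_lin.
have -> : (a *: P + Q) S x = a * P S x + Q S x by [].
by rewrite dP ?dQ // mulr0 addr0.
Qed.

Lemma schouten0r U L : eq_on U (schouten L 0) 0.
Proof.
move=> S x Ux; have := @schouten_linr U L 0 0 (-1) S x.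
rewrite scaler0 addr0 mulN1r addNr; apply=> // A; apply: smooth0.
Qed.

Lemma cocycle_closed U L k : open U ->
  submod_closed [pred P : mvfield R N | `[< cocycle U L k P >]].
Proof.
move=> oU; split=> [|a P Q].
  by apply/asboolP; split; [exact: smooth_mvfield0|exact: schouten0r].
move=> /asboolP[sP cP] /asboolP[sQ cQ]; apply/asboolP.
split=> [|S x Ux]; first exact: smooth_mvfield_lin.
rewrite (@schouten_linr U) ?cP ?cQ //; [|exact: sP.1|exact: sQ.1].
by rewrite mulr0 addr0.
Qed.

Lemma coboundary_closed U L k : open U ->
  submod_closed [pred P : mvfield R N | `[< coboundary U L k P >]].
Proof.
move=> oU; case: k => [|k]; split=> [|a P Q].
- exact/asboolP.
- move=> /asboolP /= P0 /asboolP /= Q0; apply/asboolP => S x Ux.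
  have -> : (a *: P + Q) S x = a * P S x + Q S x by [].
  by rewrite P0 // Q0 // mulr0 addr0.
- apply/asboolP; exists 0; first exact: smooth_mvfield0.
  by move=> S x Ux; rewrite (@schouten0r U).
- move=> /asboolP[P' sP' PE] /asboolP[Q' sQ' QE]; apply/asboolP.
  exists (a *: P' + Q'); first exact: smooth_mvfield_lin.
  move=> S x Ux; rewrite (@schouten_linr U) //; [|exact: sP'.1|exact: sQ'.1].
  by rewrite -PE // -QE.
Qed.

End MultivectorFields.

(* H^k(U, [L, _]), as cocycles modulo coboundaries.  Two fields which agree on U
   differ by a coboundary, so no separate identification is needed. *)
Section Cohomology.
Context {R : realType} {N : nat}.
Variables (U : set 'rV[R]_N) (oU : open U) (L : mvfield R N) (k : nat).

Definition cocycle_pred of open U : {pred mvfield R N} :=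
  [pred P | `[< cocycle U L k P >]].

HB.instance Definition _ :=
  GRing.isSubmodClosed.Build R (mvfield R N) (cocycle_pred oU)
    (cocycle_closed L k oU).

Record cocycles := Cocycle {
  cocycle_val :> mvfield R N;
  cocycleP : cocycle_val \in cocycle_pred oU }.

HB.instance Definition _ := [isSub for cocycle_val].
HB.instance Definition _ := [Choice of cocycles by <:].
HB.instance Definition _ := [SubChoice_isSubLmodule of cocycles by <:].

Definition coboundaries : {pred cocycles} :=
  [pred P | `[< coboundary U L k (val P) >]].

Lemma coboundaries_closed : submod_closed coboundaries.
Proof.
have [b0 bD] := @coboundary_closed R N U L k oU.
split=> [|a P Q bP bQ]; first exact: b0.
have valE : val (a *: P + Q) = a *: val P + val Q by rewrite linearP.
have := bD a _ _ bP bQ.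
by rewrite unfold_in -valE.
Qed.

HB.instance Definition _ :=
  GRing.isSubmodClosed.Build R cocycles coboundaries coboundaries_closed.

Definition cohomology : Type := Quotient.quot coboundaries.

HB.instance Definition _ := GRing.Zmodule.on cohomology.

Definition coh_class_of (P : cocycles) : cohomology :=
  \pi_(Quotient.quot coboundaries) P.

Lemma coh_class_of_eq (P Q : cocycles) :
  (coh_class_of P == coh_class_of Q) = (P - Q \in coboundaries).
Proof. by rewrite /coh_class_of -Quotient.idealrBE. Qed.

Lemma coh_class_of_repr (c : cohomology) :
  coh_class_of (repr (c : Quotient.quot coboundaries)) = c.
Proof. exact: (@reprK _ (Quotient.quot coboundaries)). Qed.

Lemma coh_class_ofD (P Q : cocycles) :
  coh_class_of (P + Q) = coh_class_of P + coh_class_of Q.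
Proof. exact: (raddfD \pi_(Quotient.quot coboundaries)). Qed.

Definition coh_scale (a : R) (c : cohomology) : cohomology :=
  coh_class_of (a *: repr (c : Quotient.quot coboundaries)).

Lemma coh_scale_class a (P : cocycles) :
  coh_scale a (coh_class_of P) = coh_class_of (a *: P).
Proof.
apply/eqP; rewrite coh_class_of_eq -scalerBr rpredZ //.
by rewrite -coh_class_of_eq coh_class_of_repr.
Qed.

Lemma coh_scaleA a b c : coh_scale a (coh_scale b c) = coh_scale (a * b) c.
Proof. by rewrite -[c]coh_class_of_repr !coh_scale_class scalerA. Qed.

Lemma coh_scale1 : left_id 1 coh_scale.
Proof. by move=> c; rewrite -[c]coh_class_of_repr coh_scale_class scale1r. Qed.

Lemma coh_scaleDr : right_distributive coh_scale +%R.
Proof.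
move=> a c d; rewrite -[c]coh_class_of_repr -[d]coh_class_of_repr.
by rewrite -coh_class_ofD !coh_scale_class scalerDr coh_class_ofD.
Qed.

Lemma coh_scaleDl c : {morph coh_scale^~ c : a b / a + b}.
Proof.
move=> a b; rewrite -[c]coh_class_of_repr !coh_scale_class scalerDl.
exact: coh_class_ofD.
Qed.

HB.instance Definition _ := GRing.Zmodule_isLmodule.Build R cohomology
  coh_scaleA coh_scale1 coh_scaleDr coh_scaleDl.

(* [P]; the value is meaningful only if P is a cocycle. *)
Definition coh_class (P : mvfield R N) : cohomology :=
  coh_class_of (insubd 0 P).

End Cohomology.

Definition is_basis {R : realType} {V : lmodType R} {I : finType} (e : I -> V) :=
  (forall a : I -> R, \sum_i a i *: e i = 0 -> forall i, a i = 0) /\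
  (forall v, exists a : I -> R, v = \sum_i a i *: e i).

Definition star_shaped_at {R : realType} {N : nat} (x : 'rV[R]_N)
    (A : set 'rV[R]_N) :=
  A x /\ forall y (s : R), A y -> 0 <= s <= 1 -> A ((1 - s) *: x + s *: y).

(* R^n = R x R^m with m = n - 1: the coordinate t has index ord0, and the
   coordinate u_i has index lift ord0 i. *)
Section Book.
Context {R : realType} {m : nat}.
Local Notation space := 'rV[R]_m.+1.

Definition ucoord (i : 'I_m) : space -> R^o := fun x => x 0 (lift ord0 i).

Definition uproj (x : space) : 'rV[R]_m := \row_i ucoord i x.

Definition dt : mvfield R m.+1 := mvd ord0.

Definition du (i : 'I_m) : mvfield R m.+1 := mvd (lift ord0 i).

Definition euler : mvfield R m.+1 := \sum_(i < m) mvscale (ucoord i) (du i).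

Definition book : mvfield R m.+1 := wedge dt euler.

Definition umonomial (I : seq 'I_m) : space -> R^o :=
  fun x => \prod_(i <- I) ucoord i x.

Definition dwedge (J : seq 'I_m) : mvfield R m.+1 :=
  foldr (fun j P => wedge (du j) P) mv1 J.

End Book.

(* Multi-indices of length k with entries in {1, ..., m} are k-tuples over 'I_m,
   the entry i standing for i.+1. *)
Definition compl_idx m (J : seq 'I_m) : seq 'I_m :=
  [seq i <- enum 'I_m | i \notin J].

(* All entries being at least 1, the value 0 on the empty multi-index plays the
   role of -oo. *)
Definition max_idx m (I : seq 'I_m) : nat := (\max_(i <- I) i.+1)%N.

Definition multi_idx_pair m (I J : seq 'I_m) :=
  sorted (fun i j : 'I_m => (i <= j)%N) I &&
  sorted (fun i j : 'I_m => (i < j)%N) J.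

Definition admissible m (I J : seq 'I_m) :=
  multi_idx_pair I J && (max_idx I <= max_idx (compl_idx J))%N.

Definition adm_pair m k : Type :=
  {IJ : k.-tuple 'I_m * k.-tuple 'I_m | admissible IJ.1 IJ.2}.

HB.instance Definition _ m k := Finite.on (adm_pair m k).

(* Pairs of length k - 1; the guard makes the type empty for k = 0. *)
Definition adm_pair_pred m k : Type :=
  {IJ : k.-1.-tuple 'I_m * k.-1.-tuple 'I_m |
    (0 < k)%N && admissible IJ.1 IJ.2}.

HB.instance Definition _ m k := Finite.on (adm_pair_pred m k).

Definition book_generator {R : realType} m k
    (b : adm_pair_pred m k + adm_pair m k) : mvfield R m.+1 :=
  match b with
  | inl IJ => wedge dt (mvscale (umonomial (val IJ).1) (dwedge (val IJ).2))
  | inr IJ => mvscale (umonomial (val IJ).1) (dwedge (val IJ).2)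
  end.

(* Main.v *)
(** Write P = A + d_t /\ B with A, B free of d_t. Then
      d_book P = - E /\ A_t + d_t /\ (L A + E /\ B_t),
    where the index t denotes the t-derivative and L multiplies the part of A
    whose coefficients are homogeneous of degree d by d - |A|. Multiplication by
    E is exact, except in top degree, where the coefficient must also vanish on
    u = 0: locally one divides by a coordinate or uses a radial homotopy, and the
    solutions are glued by bump functions. As the fibres of p are intervals,
    t-primitives exist and functions with zero t-derivative descend to p(U);
    hence every cocycle can be corrected to one with A and B independent of t.
    On the star-shaped p(U), E f - k f = g is solvable exactly when the
    homogeneous part of degree k of the Taylor expansion of g at 0 vanishes, so
    that only polynomial multivector fields of degree k modulo E /\ (...) remain.
    There, if (I, J) is not admissible and i = max I, then J contains all indices
    from i on, and u_{I - i} d_{J - i} is the only admissible monomial whose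
    product with E involves u_I d_J. Hence E /\ (...) can be prescribed freely on
    the non-admissible monomials, and since E /\ E = 0 nothing nonzero in its
    image is a combination of admissible ones. *)

From HB Require Import structures.
Require Import Defs.
From mathcomp Require Import all_boot all_order all_algebra.
From mathcomp Require Import boolp classical_sets functions reals.
From mathcomp Require Import topology normedtype derive.
From mathcomp Require Import ereal measure lebesgue_measure lebesgue_integral.
From mathcomp Require Import ftc sequences realfun exp.
From mathcomp Require Import ring lra.

Set Implicit Arguments.
Unset Strict Implicit.
Unset Printing Implicit Defensive.

Import Order.TTheory GRing.Theory Num.Theory.
Import numFieldNormedType.Exports.

Local Open Scope classical_set_scope.
Local Open Scope ring_scope.

(** * Smooth functions *)

(** The exception in top degree is the main obstacle. On [u = 0] the operator [L] is multiplication
    by [-m] in degree [m = n - 1]. If [A] has degree [m], the [t]-derivative of [L A + E /\ B_t = 0]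
    gives [A_t = 0] on [u = 0], as exactness requires. If [B] has degree [m], that is [k = n], the
    equation says nothing about [B] on [u = 0]; one adds the coboundary [d_t /\ L (B / m)], after
    which [B] vanishes there. Coboundaries contain [E] only through [E /\ A_t] and [E /\ B_t]. A
    form found by exactness must therefore be integrated in [t], and a term [E /\ q] with [q]
    independent of [t] is matched by [t q]. Linear independence needs only Taylor coefficients at a
    single point of [U] over [u = 0]: those of order [k] of [E f - k f] vanish, however [f] depends
    on [t]. The value of [b_k] is the number of all pairs [(I, J)] of length [k]: adding the largest
    entry of the complement of [J] to both turns the admissible pairs of length [k - 1] into exactly
    the non-admissible ones of length [k]. *)

Section SmoothCalculus.
Context {R : realType} {N : nat}.
Implicit Types (U V : set 'rV[R]_N) (f g : 'rV[R]_N -> R^o).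

(** Weaker than the usual class of this name: the partial derivatives need only exist. [smooth]
    demands this of every iterated partial derivative. *)
Definition C1 U f := forall x, U x ->
  {for x, continuous f} /\ forall i, derivable f x (delta_mx 0 i).

Lemma eq_iter_partial U f g s : open U -> (forall x, U x -> f x = g x) ->
  forall x, U x -> iter_partial s f x = iter_partial s g x.
Proof.
move=> oU fg; elim: s => [//|i s IHs] x Ux /=.
rewrite /partial; apply: near_eq_derive; near=> y; apply: IHs.
by near: y; exact: open_nbhs_nbhs.
Unshelve. all: by end_near. Qed.

Lemma eq_C1 U f g : open U -> (forall x, U x -> f x = g x) -> C1 U f -> C1 U g.
Proof.
move=> oU fg Cf x Ux; have [cf df] := Cf x Ux.
have nfg : \forall y \near x, f y = g y.
  by near=> y; apply: fg; near: y; exact: open_nbhs_nbhs.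
split=> [|i]; last exact: near_eq_derivable nfg (df i).
rewrite /prop_for/continuous_at -(fg _ Ux); apply: cvg_trans cf.
exact: (near_eq_cvg nfg).
Unshelve. all: by end_near. Qed.

Lemma eq_smooth U f g : open U -> (forall x, U x -> f x = g x) ->
  smooth U f -> smooth U g.
Proof.
move=> oU fg sf s; apply: (@eq_C1 _ (iter_partial s f)) => //; last exact: sf.
by move=> x Ux; apply: (eq_iter_partial s oU fg).
Qed.

(** Coinduction: [smooth] is the largest class of [C1] functions stable under partial derivatives. A
    derivative need only agree on [U] with a member of [C], since formulas for derivatives hold
    there only. *)
Lemma smooth_coind U (C : ('rV[R]_N -> R^o) -> Prop) : open U ->
  (forall f, C f -> C1 U f) ->
  (forall f i, C f -> exists2 g, C g & forall x, U x -> partial i f x = g x) ->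
  forall f, C f -> smooth U f.
Proof.
move=> oU CC1 Cp f Cf s.
have [g Cg fg] : exists2 g, C g & forall x, U x -> iter_partial s f x = g x.
  elim: s => [|i s [g Cg fg]]; first by exists f.
  have [h Ch gh] := Cp g i Cg; exists h => // x Ux; rewrite -gh //=.
  exact: (eq_iter_partial [:: i] oU fg).
apply: (@eq_C1 _ g) => //; last exact: CC1.
by move=> x Ux; rewrite fg.
Qed.

Lemma smooth_C1 U f : smooth U f -> C1 U f.
Proof. by move=> sf; apply: (sf [::]). Qed.

Lemma smooth_partial U i f : smooth U f -> smooth U (partial i f).
Proof.
by move=> sf s; have := sf (rcons s i); rewrite /iter_partial foldr_rcons.
Qed.

Lemma smoothS U V f : V `<=` U -> smooth U f -> smooth V f.
Proof. by move=> VU sf s x /VU; apply: sf. Qed.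

Lemma smooth_local U f : (forall x, U x -> exists2 V, V x & smooth V f) ->
  smooth U f.
Proof. by move=> H s x /H[V Vx /(_ s)]; apply. Qed.

Lemma smooth_cst U a : open U -> smooth U (cst a).
Proof.
move=> oU; apply: (@smooth_coind _ (fun f => exists a, f = cst a)) => //.
- move=> _ [b ->] x Ux; split; first exact: cst_continuous.
  by move=> i; exact: derivable_cst.
- move=> _ i [b ->]; exists (cst 0); first by exists 0.
  by move=> x Ux; rewrite /partial derive_cst.
- by exists a.
Qed.

Lemma C1_derivable U f i x : C1 U f -> U x -> derivable f x (delta_mx 0 i).
Proof. by move=> Cf /Cf[]. Qed.

Lemma C1_cst U a : C1 U (cst a).
Proof.
by move=> y _; split=> [|j]; [exact: cst_continuous|exact: derivable_cst].
Qed.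

Lemma C1D U f g : C1 U f -> C1 U g -> C1 U (f + g).
Proof.
move=> Cf Cg x Ux; have [cf df] := Cf x Ux; have [cg dg] := Cg x Ux.
by split=> [|i]; [exact: (cvgD cf cg)|exact: derivableD].
Qed.

Lemma C1M U f g : C1 U f -> C1 U g -> C1 U (f * g).
Proof.
move=> Cf Cg x Ux; have [cf df] := Cf x Ux; have [cg dg] := Cg x Ux.
by split=> [|i]; [exact: (cvgM cf cg)|exact: derivableM].
Qed.

Lemma C1V U f : C1 U f -> (forall x, U x -> f x != 0) ->
  C1 U (fun x => (f x)^-1).
Proof.
move=> Cf f0 x Ux; have [cf df] := Cf x Ux; have fx0 := f0 x Ux.
by split=> [|i]; [exact: (cvgV fx0 cf)|exact: derivableV].
Qed.

Lemma partialD U f g i x : C1 U f -> C1 U g -> U x ->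
  partial i (f + g) x = partial i f x + partial i g x.
Proof.
by move=> Cf Cg Ux; rewrite /partial deriveD//; exact: C1_derivable Ux.
Qed.

Lemma partialM U f g i x : C1 U f -> C1 U g -> U x ->
  partial i (f * g) x = f x * partial i g x + g x * partial i f x.
Proof.
by move=> Cf Cg Ux; rewrite /partial deriveM//; exact: C1_derivable Ux.
Qed.

Lemma partialV U f i x : C1 U f -> f x != 0 -> U x ->
  partial i (fun x => (f x)^-1) x = - (f x)^-2 * partial i f x.
Proof.
by move=> Cf f0 Ux; rewrite /partial deriveV//; exact: C1_derivable Ux.
Qed.

(* The algebra, closed under inversion, generated by a family B: it consists of
   smooth functions as soon as it contains the partial derivatives of B. *)
Inductive smooth_gen U (B : ('rV[R]_N -> R^o) -> Prop) :
    ('rV[R]_N -> R^o) -> Prop :=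
| GenBase f of B f : smooth_gen U B f
| GenCst a : smooth_gen U B (cst a)
| GenD f g of smooth_gen U B f & smooth_gen U B g : smooth_gen U B (f + g)
| GenM f g of smooth_gen U B f & smooth_gen U B g : smooth_gen U B (f * g)
| GenV f of smooth_gen U B f & (forall x, U x -> f x != 0) :
    smooth_gen U B (fun x => (f x)^-1).

Lemma smooth_genP U (B : ('rV[R]_N -> R^o) -> Prop) : open U ->
  (forall f, B f -> C1 U f) ->
  (forall f i, B f ->
    exists2 g, smooth_gen U B g & forall x, U x -> partial i f x = g x) ->
  forall f, smooth_gen U B f -> smooth U f.
Proof.
move=> oU BC1 Bp.
have GC1 f : smooth_gen U B f -> C1 U f.
  elim=> [{}f /BC1//|a|g h _ Cg _ Ch|g h _ Cg _ Ch|g _ Cg g0].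
  - exact/smooth_C1/smooth_cst.
  - exact: C1D.
  - exact: C1M.
  - exact: C1V.
apply: smooth_coind => // f i.
elim=> [{}f /Bp//|a|g h Gg [g' Gg' gE] Gh [h' Gh' hE]|
  g h Gg [g' Gg' gE] Gh [h' Gh' hE]|g Gg [g' Gg' gE] g0].
- exists (cst 0) => [|x Ux]; first exact: GenCst.
  by rewrite /partial derive_cst.
- exists (g' + h') => [|x Ux]; first exact: GenD.
  by rewrite (partialD (U := U)) ?gE ?hE//; exact: GC1.
- exists (g * h' + h * g') => [|x Ux]; first by apply: GenD; exact: GenM.
  by rewrite (partialM (U := U)) ?gE ?hE//; exact: GC1.
- pose v := (fun x => (g x)^-1) : 'rV[R]_N -> R^o.
  have Gv : smooth_gen U B v by exact: GenV.
  exists (cst (-1) * (v * v) * g') => [|x Ux].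
    by do 2![apply: GenM => //]; [exact: GenCst|exact: GenM].
  rewrite (partialV (U := U)) ?gE ?g0//; last exact: GC1.
  by rewrite /v !fctE expr2 invfM mulN1r.
Qed.

(** Taking all smooth functions as generators turns [smooth_genP] into the closure of smoothness
    under the algebra operations and inverses. *)
Let smooth_gen_smooth U f : open U -> smooth_gen U (smooth U) f -> smooth U f.
Proof.
move=> oU; apply: smooth_genP => // g; first exact: smooth_C1.
by move=> i sg; exists (partial i g) => //; exact/GenBase/smooth_partial.
Qed.

Lemma smoothM U f g : open U -> smooth U f -> smooth U g ->
  smooth U (fun x => f x * g x).
Proof.
move=> oU sf sg; apply: (smooth_gen_smooth oU).
exact: (@GenM _ _ f g (GenBase _ sf) (GenBase _ sg)).
Qed.

Lemma smoothD U f g : open U -> smooth U f -> smooth U g ->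
  smooth U (fun x => f x + g x).
Proof.
move=> oU sf sg; apply: (smooth_gen_smooth oU).
exact: (@GenD _ _ f g (GenBase _ sf) (GenBase _ sg)).
Qed.

Lemma smoothV U f : open U -> smooth U f -> (forall x, U x -> f x != 0) ->
  smooth U (fun x => (f x)^-1).
Proof.
move=> oU sf f0; apply: (smooth_gen_smooth oU).
exact: (@GenV _ _ f (GenBase _ sf) f0).
Qed.

Lemma smoothZ U f a : open U -> smooth U f -> smooth U (fun x => a * f x).
Proof. by move=> oU sf; exact: (smoothM oU (smooth_cst a oU) sf). Qed.

Lemma smoothB U f g : open U -> smooth U f -> smooth U g ->
  smooth U (fun x => f x - g x).
Proof.
move=> oU sf sg; have := smoothD oU sf (smoothZ (-1) oU sg).
by congr smooth; apply/funext => x; rewrite mulN1r.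
Qed.

Lemma smooth_sum U (I : Type) (r : seq I) (P : pred I)
    (F : I -> 'rV[R]_N -> R^o) : open U ->
  (forall i, P i -> smooth U (F i)) ->
  smooth U (fun x => \sum_(i <- r | P i) F i x).
Proof.
move=> oU sF; elim: r => [|i r IHr].
  by under eq_fun do rewrite big_nil; exact: smooth_cst.
under eq_fun do rewrite big_cons.
case Pi: (P i) => //; exact: (smoothD oU (sF i Pi) IHr).
Qed.

Lemma smooth_prod U (I : Type) (r : seq I) (P : pred I)
    (F : I -> 'rV[R]_N -> R^o) : open U ->
  (forall i, P i -> smooth U (F i)) ->
  smooth U (fun x => \prod_(i <- r | P i) F i x).
Proof.
move=> oU sF; elim: r => [|i r IHr].
  by under eq_fun do rewrite big_nil; exact: smooth_cst.
under eq_fun do rewrite big_cons.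
case Pi: (P i) => //; exact: (smoothM oU (sF i Pi) IHr).
Qed.

Lemma partial_sum U (I : Type) (r : seq I) (P : pred I)
    (F : I -> 'rV[R]_N -> R^o) i x : open U ->
  (forall j, P j -> smooth U (F j)) -> U x ->
  partial i (fun x => \sum_(j <- r | P j) F j x) x =
  \sum_(j <- r | P j) partial i (F j) x.
Proof.
move=> oU sF Ux; elim: r => [|j r IHr].
  under eq_fun do rewrite big_nil.
  by rewrite big_nil /partial derive_cst.
under eq_fun do rewrite big_cons.
rewrite big_cons; case Pj: (P j) => //.
transitivity (partial i (F j) x +
  partial i (fun x => \sum_(j <- r | P j) F j x) x); last by rewrite IHr.
apply: (partialD (U := U)) => //; first exact/smooth_C1/sF.
by apply/smooth_C1/smooth_sum.
Qed.

Lemma partial_cst i a x : partial i (cst a : 'rV[R]_N -> R^o) x = 0.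
Proof. by rewrite /partial derive_cst. Qed.

Lemma partialZ U f a i x : C1 U f -> U x ->
  partial i (fun x => a * f x) x = a * partial i f x.
Proof.
move=> Cf Ux; rewrite (partialM (f := cst a) (U := U)) //=.
  by rewrite partial_cst mulr0 addr0.
exact: C1_cst.
Qed.

Lemma C1Z U f a : C1 U f -> C1 U (fun x => a * f x).
Proof. by move=> Cf; exact: (C1M (C1_cst a) Cf). Qed.

End SmoothCalculus.

(** * Directional derivatives from continuous partial derivatives *)

Section Directional.
Context {R : realType} {N : nat}.
Implicit Types (U V : set 'rV[R]_N) (f g : 'rV[R]_N -> R^o) (x y v : 'rV[R]_N).

Lemma nbhs_boxP x (A : set 'rV[R]_N) :
  nbhs x A <->
  exists2 e : R, 0 < e & forall y, (forall j, `|x 0 j - y 0 j| < e) -> A y.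
Proof.
split=> [/nbhs_ballP[e /= e0 H]|[e e0 H]].
  exists e => // y xy; apply: H; rewrite /ball/=; split => // i j.
  by rewrite ord1; exact: xy.
by apply/nbhs_ballP; exists e => //= y [_ xy]; apply: H => j; exact: xy.
Qed.

Lemma le_coord_norm x j : `|x 0 j| <= `|x|.
Proof.
by rewrite [leRHS]/Num.norm /= mx_normrE; apply/bigmax_geP; right => /=; exists (0, j).
Qed.

Lemma is_derive_line f x v (h0 : R) : derivable f (h0 *: v + x) v ->
  is_derive h0 1 (fun h : R => f (h *: v + x)) ('D_v f (h0 *: v + x)).
Proof.
move=> df.
have E : (fun h => h^-1 *: (f (h *: v + (h0 *: v + x)) - f (h0 *: v + x))) =
  (fun h => h^-1 *: (((fun h : R => f (h *: v + x)) \o shift h0) (h *: 1)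
     - f (h0 *: v + x))).
  by apply/funext => h /=; rewrite [_%:A]mulr1 scalerDl addrA.
split; first by move: df; rewrite /derivable/= E.
by rewrite /derive [in RHS]/= E.
Qed.

Lemma derivable_line f x v (h0 : R) :
  derivable (fun h : R => f (h *: v + x)) h0 1 -> derivable f (h0 *: v + x) v.
Proof.
have E : (fun h => h^-1 *: (f (h *: v + (h0 *: v + x)) - f (h0 *: v + x))) =
  (fun h => h^-1 *: (((fun h : R => f (h *: v + x)) \o shift h0) (h *: 1)
     - f (h0 *: v + x))).
  by apply/funext => h /=; rewrite [_%:A]mulr1 scalerDl addrA.
by rewrite /derivable/= E.
Qed.

Lemma mean_value_dir f y v (b : R) :
  (forall s : R, `|s| <= `|b| -> derivable f (s *: v + y) v) ->
  exists2 c, `|c| <= `|b| &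
    f (b *: v + y) - f y = b * 'D_v f (c *: v + y).
Proof.
move=> df; pose phi (s : R) := f (s *: v + y).
have dphi (s : R) : `|s| <= `|b| -> is_derive s 1 phi ('D_v f (s *: v + y)).
  by move=> sb; exact/is_derive_line/df.
have cphi (s : R) : `|s| <= `|b| -> {for s, continuous phi}.
  move=> /dphi[dps _]; exact/differentiable_continuous/derivable1_diffP.
have phi0 : f y = phi 0 by rewrite /phi scale0r add0r.
have [b0|b0|->] := ltgtP b 0; last first.
- exists 0 => //; rewrite phi0 /phi subrr mul0r//.
- have inab (s : R) : s \in `[0, b] -> `|s| <= `|b|.
    by rewrite in_itv/= => /andP[s0 sb]; rewrite !ger0_norm// ltW.
  have [c cb E] : exists2 c, c \in `[0, b] &
      phi b - phi 0 = 'D_v f (c *: v + y) * (b - 0).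
    apply: MVT_segment; first exact: ltW.
      by move=> s sb; apply/dphi/inab; apply: subset_itv_oo_cc sb.
    apply: derivable_within_continuous => s sb.
    by have [] := dphi s (inab s sb).
  exists c; first exact: inab.
  by rewrite phi0 -/(phi b) E subr0 mulrC.
- have inab (s : R) : s \in `[b, 0] -> `|s| <= `|b|.
    by rewrite in_itv/= => /andP[s0 sb]; rewrite !ler0_norm ?lerN2// ltW.
  have [c cb E] : exists2 c, c \in `[b, 0] &
      phi 0 - phi b = 'D_v f (c *: v + y) * (0 - b).
    apply: MVT_segment; first exact: ltW.
      by move=> s sb; apply/dphi/inab; apply: subset_itv_oo_cc sb.
    apply: derivable_within_continuous => s sb.
    by have [] := dphi s (inab s sb).
  exists c; first exact: inab.
  by rewrite phi0 -/(phi b) -opprB E sub0r mulrN opprK mulrC.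
Qed.

(** By the mean value theorem, a further displacement [h a] in direction [j] changes [f] by [h a]
    times a partial derivative at a point that tends to [x]. Adding one coordinate at a time,
    [is_derive_sum] gets by without total differentiability. *)
Lemma is_derive_step f x v (a : R) j d :
  is_derive x v f d ->
  (\forall y \near x, derivable f y (delta_mx 0 j)) ->
  {for x, continuous (partial j f)} ->
  is_derive x (v + a *: delta_mx 0 j) f (d + a * partial j f x).
Proof.
move=> [dv dvE] dj cj; set e := delta_mx 0 j.
suff H : h^-1 *: (f (h *: (v + a *: e) + x) - f x) @[h --> 0^'] -->
    d + a * partial j f x.
  by split; [apply/cvg_ex; eexists; exact: H|apply: cvg_lim H].
have Hv : h^-1 *: (f (h *: v + x) - f x) @[h --> 0^'] --> d.
  by rewrite -dvE; exact: dv.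
have He : h^-1 *: (f (h *: (v + a *: e) + x) - f (h *: v + x)) @[h --> 0^'] -->
    a * partial j f x.
  apply/cvgrPdist_le => eps eps0.
  pose eps' := eps / (`|a| + 1).
  have a1 : 0 < `|a| + 1 by rewrite ltr_wpDl.
  have eps'0 : 0 < eps' by exact: divr_gt0.
  have /cvgrPdist_lt/(_ _ eps'0) cj' := cj.
  have [r r0 Hr] := (nbhs_boxP _ _).1 (filterI dj cj').
  pose M := `|v| + `|a| + 1.
  have M0 : 0 < M by rewrite ltr_wpDl ?addr_ge0.
  have hM : \forall h \near 0^', `|h : R| < r / M.
    apply: dnbhs0_lt; exact: divr_gt0.
  near=> h.
  have h0 : h != 0 by near: h; exact: nbhs_dnbhs_neq.
  have hM' : `|h| < r / M by near: h.
  have box (s : R) : `|s| <= `|h * a| -> forall k,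
      `|x 0 k - (s *: e + (h *: v + x)) 0 k| < r.
    move=> sh k; rewrite !mxE/= addrA opprD addrCA subrr addr0 normrN.
    apply: (@le_lt_trans _ _ (`|h| * (`|v| + `|a|))); last first.
      apply: (@le_lt_trans _ _ (`|h| * M)); last by rewrite -ltr_pdivlMr.
      by rewrite ler_wpM2l// lerDl.
    rewrite mulrDr addrC (le_trans (ler_normD _ _))// lerD//.
      by rewrite normrM ler_wpM2l// le_coord_norm.
    rewrite -normrM; apply: le_trans sh; rewrite normrM ler_piMr//.
    by case: (_ == _); rewrite ?normr1 ?normr0.
  have [c ca E] : exists2 c, `|c| <= `|h * a| &
      f ((h * a) *: e + (h *: v + x)) - f (h *: v + x) =
      (h * a) * 'D_e f (c *: e + (h *: v + x)).
    by apply: mean_value_dir => s /box/Hr[].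
  have -> : h *: (v + a *: e) + x = (h * a) *: e + (h *: v + x).
    by rewrite scalerDr scalerA addrCA addrA.
  rewrite E [_ *: _]mulrA mulrA mulVf// mul1r -mulrBr normrM.
  have /Hr[_ /ltW Hlt] := box c ca.
  rewrite (le_trans (ler_wpM2l _ Hlt))// /eps' mulrCA ler_piMr ?(ltW eps0)//.
  by rewrite ler_pdivrMr// mul1r lerDl.
have -> : (fun h => h^-1 *: (f (h *: (v + a *: e) + x) - f x)) =
    (fun h => h^-1 *: (f (h *: v + x) - f x)) +
    (fun h => h^-1 *: (f (h *: (v + a *: e) + x) - f (h *: v + x))).
  by apply/funext => h; rewrite fctE -scalerDr [X in _ = _ *: X]addrC addrA subrK.
exact: cvgD.
Unshelve. all: by end_near. Qed.

Lemma is_derive_sum f x v :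
  (forall j, \forall y \near x, derivable f y (delta_mx 0 j)) ->
  (forall j, {for x, continuous (partial j f)}) ->
  is_derive x v f (\sum_j v 0 j * partial j f x).
Proof.
move=> df cf; rewrite {1}[v]row_sum_delta.
elim/big_rec2: _ => [|j d w _ IH]; first exact: is_derive0.
rewrite [X in is_derive _ X _ _]addrC [X in is_derive _ _ _ X]addrC.
exact: is_derive_step.
Qed.

End Directional.

(** * Diagonal affine substitutions *)

Section Scaling.
Context {R : realType} {N : nat}.
Implicit Types (U V : set 'rV[R]_N) (f g : 'rV[R]_N -> R^o) (x y : 'rV[R]_N).

(** A diagonal linear part keeps the chain rule to one term. Entries of [b] may vanish, so that
    coordinates can also be frozen. *)
Definition aff (a b x : 'rV[R]_N) : 'rV[R]_N := \row_j (a 0 j + b 0 j * x 0 j).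

Lemma aff_line a b (h : R) i x :
  aff a b (h *: delta_mx 0 i + x) = (h * b 0 i) *: delta_mx 0 i + aff a b x.
Proof.
apply/rowP => j; rewrite !mxE/= mulrDr addrCA; congr (_ + _).
by case: eqVneq => [->|]; rewrite ?mulr1 ?mulr0// mulrC.
Qed.

Lemma is_derive_comp1 (phi : R -> R^o) (g : R -> R) (t a b : R) :
  is_derive t 1 g a -> is_derive (g t) 1 phi b ->
  is_derive t 1 (phi \o g) (b * a).
Proof.
move=> [dg <-] [dphi <-]; split.
  apply/derivable1_diffP; apply: differentiable_comp; exact/derivable1_diffP.
by rewrite -!derive1E derive1_comp.
Qed.

Lemma is_derive_aff f a b i x : derivable f (aff a b x) (delta_mx 0 i) ->
  is_derive x (delta_mx 0 i) (f \o aff a b) (b 0 i * partial i f (aff a b x)).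
Proof.
move=> df; set e := delta_mx 0 i.
have d0 := @is_derive_line _ _ f (aff a b x) e 0.
rewrite scale0r add0r in d0; have {}d0 := d0 df.
have db : is_derive (0 : R) 1 (fun h : R => b 0 i * h) (b 0 i).
  have := @is_deriveZ R R^o R^o id (b 0 i) 0 1 1 (is_derive_id _ _).
  by rewrite [_ *: 1]mulr1.
have d1 : is_derive (0 : R) 1 (fun h : R => f (aff a b (h *: e + x)))
    (b 0 i * partial i f (aff a b x)).
  rewrite (_ : (fun h : R => f (aff a b (h *: e + x))) =
     (fun h => f (h *: e + aff a b x)) \o (fun h : R => b 0 i * h)); last first.
    by apply/funext => h; rewrite aff_line/= mulrC.
  rewrite mulrC; apply: is_derive_comp1 db _; rewrite mulr0; exact: d0.
have dfx : derivable (f \o aff a b) (0 *: e + x) e.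
  by apply: derivable_line; case: d1.
have [_ d1E] := d1; have [_ d2E] := is_derive_line dfx.
rewrite scale0r add0r in dfx d2E; split=> //.
by rewrite -d2E -d1E.
Qed.

Lemma cvg_aff a b x : aff a b y @[y --> x] --> aff a b x.
Proof.
move=> A /nbhs_boxP[e e0 H]; apply/nbhs_boxP.
exists (e / (`|b| + 1)); first by rewrite divr_gt0// ltr_wpDl.
move=> y xy; apply: H => j; rewrite !mxE opprD addrACA subrr add0r -mulrBr normrM.
have b1 : 0 < `|b| + 1 by rewrite ltr_wpDl.
apply: (@le_lt_trans _ _ ((`|b| + 1) * `|x 0 j - y 0 j|)).
  by rewrite ler_wpM2r// (le_trans (le_coord_norm _ _))// lerDl.
by rewrite mulrC -ltr_pdivlMr.
Qed.

Lemma C1_aff U V f a b : C1 U f -> (forall x, V x -> U (aff a b x)) ->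
  C1 V (f \o aff a b).
Proof.
move=> Cf VU x Vx; have [ch dh] := Cf _ (VU x Vx); split=> [|i].
  by apply: cvg_comp; [exact: cvg_aff|exact: ch].
by have [] := is_derive_aff (dh i).
Qed.

Lemma partial_aff U f a b i x : C1 U f -> U (aff a b x) ->
  partial i (f \o aff a b) x = b 0 i * partial i f (aff a b x).
Proof.
move=> Cf Ux; have [ch dh] := Cf _ Ux.
by have [_] := is_derive_aff (dh i).
Qed.

Lemma smooth_aff U V f a b : open V -> smooth U f ->
  (forall x, V x -> U (aff a b x)) -> smooth V (f \o aff a b).
Proof.
move=> oV sf VU.
(* The scalar [k] collects the factors [b 0 i] that successive derivatives produce. *)
pose C g := exists2 h, smooth U h & exists k : R, g = (fun x => k * h (aff a b x)).
have C1h h : smooth U h -> C1 V (h \o aff a b).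
  by move=> /smooth_C1 Ch; exact: C1_aff VU.
apply: (@smooth_coind _ _ _ C) => //.
- by move=> _ [h sh [k ->]]; exact: (C1Z (f := h \o aff a b)) (C1h _ sh).
- move=> _ i [h sh [k ->]].
  exists (fun x => (k * b 0 i) * partial i h (aff a b x)).
    by exists (partial i h); [exact: smooth_partial|exists (k * b 0 i)].
  move=> x Vx; rewrite (partialZ _ _ (C1h _ sh) Vx).
  by rewrite (partial_aff (U := U)) ?mulrA//; [exact: smooth_C1|exact: VU].
- by exists f => //; exists 1; apply/funext => x; rewrite mul1r.
Qed.

Lemma partial_coord i j x :
  partial j (fun x => x 0 i : R^o) x = (i == j)%:R.
Proof.
rewrite /partial/derive; apply/cvg_lim => //=.
apply: (@cvg_trans _ (nbhs (cst ((i == j)%:R : R^o) @ (0 : R)^'))).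
  apply: near_eq_cvg; near=> h; rewrite /= !mxE/= addrK.
  rewrite [_ *: _]mulrA mulVf ?mul1r//.
  by near: h; exact: nbhs_dnbhs_neq.
exact: cvg_cst.
Unshelve. all: by end_near. Qed.

Lemma C1_coord U i : C1 U (fun x => x 0 i).
Proof.
move=> x _; split; first exact: coord_continuous.
by move=> j; exact/diff_derivable/differentiable_coord.
Qed.

Lemma smooth_coord U i : open U -> smooth U (fun x => x 0 i).
Proof.
move=> oU.
apply: (@smooth_genP _ _ _ (fun g => g = (fun x => x 0 i)) oU).
- by move=> _ ->; exact: C1_coord.
- move=> _ j ->; exists (cst (i == j)%:R); first exact: GenCst.
  by move=> x _; rewrite partial_coord.
- exact: GenBase.
Qed.

End Scaling.

(** * Radial integrals *)

Section RadialIntegral.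
Context {R : realType} {N : nat}.
Variables (T : pred 'I_N) (c : 'rV[R]_N).
Implicit Types (U V W : set 'rV[R]_N) (f g : 'rV[R]_N -> R^o) (x y : 'rV[R]_N).
Local Notation mu := (@lebesgue_measure R).

(** The homothety of centre [c] and ratio [r] in the coordinates selected by [T]: with [pred1 i] it
    moves along one axis, with [udir] it contracts [u] and leaves [t] alone. *)
Definition scal (r : R) x : 'rV[R]_N :=
  \row_j (if T j then c 0 j + r * (x 0 j - c 0 j) else x 0 j).

Lemma scal_aff r : scal r =
  aff (\row_j (if T j then (1 - r) * c 0 j else 0)) (\row_j (r ^+ T j)).
Proof.
apply/funext => x; apply/rowP => j; rewrite !mxE; case: (T j).
  by rewrite expr1; ring.
by rewrite expr0 add0r mul1r.
Qed.

Lemma scal1 x : scal 1 x = x.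
Proof.
by apply/rowP => j; rewrite !mxE mul1r addrCA subrr addr0 if_same.
Qed.

Lemma scal_near (r0 : R) x0 (A : set 'rV[R]_N) : nbhs (scal r0 x0) A ->
  \forall r \near r0 & x \near x0, A (scal r x).
Proof.
move=> /nbhs_boxP[e e0 H].
have : \forall p \near (r0, x0), forall j, `|scal r0 x0 0 j - scal p.1 p.2 0 j| < e.
  apply: (@filter_forall _ _ (fun j (p : R * 'rV[R]_N) =>
    `|scal r0 x0 0 j - scal p.1 p.2 0 j| < e) (nbhs (r0, x0)) _) => j.
  suff /cvgrPdist_lt/(_ _ e0) :
    (fun p : R * 'rV[R]_N => scal p.1 p.2 0 j) @ (r0, x0) --> scal r0 x0 0 j by [].
  have c2 : (fun p : R * 'rV[R]_N => p.2 0 j) @ (r0, x0) --> x0 0 j.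
    apply: (@cvg_comp _ _ _ snd (fun x : 'rV[R]_N => x 0 j) _ (nbhs x0)).
      exact: cvg_snd.
    exact: coord_continuous.
  under eq_fun do rewrite mxE; rewrite mxE; case: (T j).
    apply: cvgD; first exact: cvg_cst.
    apply: cvgM; first exact: cvg_fst.
    apply: cvgB; last exact: cvg_cst.
    exact: c2.
  exact: c2.
by apply: filterS => -[r x] /= /H.
Qed.

(** The tube lemma: [0, 1] is compact, so a condition that holds around each [(r, x0)] holds for all
    [r] at once near [x0]. *)
Lemma unit_near x0 (P : 'rV[R]_N -> R -> Prop) :
  (forall r : R, 0 <= r <= 1 -> \forall r' \near r & x \near x0, P x r') ->
  \forall x \near x0, forall r : R, 0 <= r <= 1 -> P x r.
Proof.
move=> H; have := (compact_near_coveringP _).1 (@segment_compact R 0 1).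
move=> /(_ _ (nbhs x0) P _) cover.
have {}cover : \forall x \near x0, `[0, 1]%classic `<=` P x.
  by apply: cover => r/=; rewrite in_itv/=; exact: H.
by apply: filterS cover => x sub r r01; apply: sub; rewrite /= in_itv.
Qed.

Lemma scal_near_unit x0 (A : set 'rV[R]_N) :
  (forall r : R, 0 <= r <= 1 -> nbhs (scal r x0) A) ->
  \forall x \near x0, forall r : R, 0 <= r <= 1 -> A (scal r x).
Proof.
move=> H; apply: (unit_near (P := fun x r => A (scal r x))) => r /H.
exact: scal_near.
Qed.

(* [radint p] inverts D + p + 1, where D = \sum_(j | T j) (x_j - c_j) d_j. *)
Definition radint (p : nat) f : 'rV[R]_N -> R^o :=
  fun x => \int[mu]_(r in `[0, 1]) (r ^+ p * f (scal r x)).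

Definition unit_on (P : 'rV[R]_N -> Prop) x :=
  forall r : R, 0 <= r <= 1 -> P (scal r x).

Lemma continuous_scal f x (r : R) : {for scal r x, continuous f} ->
  {for r, continuous (fun r => f (scal r x))}.
Proof.
move=> cf; apply: (cvg_comp (fun r => scal r x) f _ cf) => A /scal_near.
move=> [[A1 A2] [/= nA1 nA2] sub]; apply: filterS nA1 => r' A1r'.
by apply: (sub (r', x)); split => //=; exact: nbhs_singleton.
Qed.

Lemma integrable_scal p f x : unit_on (fun y => {for y, continuous f}) x ->
  mu.-integrable `[0, 1] (EFin \o (fun r : R => r ^+ p * f (scal r x))).
Proof.
move=> cf; apply: continuous_compact_integrable; first exact: segment_compact.
apply: continuous_in_subspaceT => r /[!inE]/=; rewrite in_itv/= => /cf cfr.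
have ce : {for r, continuous (fun r : R => r ^+ p)}.
  exact/differentiable_continuous/derivable1_diffP/exprn_derivable.
exact: (cvgM ce (continuous_scal cfr)).
Qed.

Lemma unit_pow (r : R) p : 0 <= r <= 1 -> `|r ^+ p| <= 1.
Proof.
by move=> /andP[r0 r1]; rewrite ger0_norm ?exprn_ge0// exprn_ile1.
Qed.

Lemma unit_on_near (P : 'rV[R]_N -> Prop) x :
  unit_on (fun y => \forall z \near y, P z) x -> \forall y \near x, unit_on P y.
Proof. by move=> H; apply: scal_near_unit. Qed.

Lemma unit_onS (P Q : 'rV[R]_N -> Prop) x : (forall y, P y -> Q y) ->
  unit_on P x -> unit_on Q x.
Proof. by move=> PQ Px r /Px/PQ. Qed.

Lemma unit_measure : constructive_ereal.fine (mu `[0, 1]) = 1.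
Proof.
have := @lebesgue_measure_itv R `[0, 1].
by rewrite /= lte_fin ltr01 oppr0 adde0 => ->.
Qed.

(** The integrands are uniformly close on [0, 1] by [unit_near], and [r ^+ p] is at most 1. *)
Lemma continuous_radint p f x :
  unit_on (fun y => \forall z \near y, {for z, continuous f}) x ->
  {for x, continuous (radint p f)}.
Proof.
move=> ncf; have cf : unit_on (fun y => {for y, continuous f}) x.
  by apply: unit_onS ncf => y; exact: nbhs_singleton.
apply: (cvgrPdist_le (F := nbhs x) (radint p f) (radint p f x)).2 => e e0.
have e20 : 0 < e / 2 by rewrite divr_gt0.
have near1 : \forall y \near x, forall r : R, 0 <= r <= 1 ->
    `|f (scal r x) - f (scal r y)| <= e.
  apply: (unit_near (P := fun y r => `|f (scal r x) - f (scal r y)| <= e)) => r r01.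
  have /cvgrPdist_lt/(_ _ e20) nr := cf r r01.
  have [[A1 A2] [/= nA1 nA2] sub] := scal_near nr.
  exists (A1, A2) => //= -[r' y] [/= A1r' A2y].
  have /ltW h1 := sub (r', y) (conj A1r' A2y).
  have /ltW h2 := sub (r', x) (conj A1r' (nbhs_singleton nA2)).
  rewrite (_ : _ - _ = (f (scal r x) - f (scal r' y))
    - (f (scal r x) - f (scal r' x))); last by ring.
  by rewrite (le_trans (ler_normB _ _))// [leRHS]splitr lerD.
near=> y.
have ey : forall r : R, 0 <= r <= 1 -> `|f (scal r x) - f (scal r y)| <= e.
  by near: y.
have cfy : unit_on (fun y => {for y, continuous f}) y.
  by near: y; exact: unit_on_near.
have Ix := integrable_scal p cf; have Iy := integrable_scal p cfy.
have mI : measurable (`[0, 1]%classic : set R) by [].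
rewrite /radint -RintegralB//.
have IB : mu.-integrable `[0, 1] (EFin \o
  (fun r : R => r ^+ p * f (scal r x) - r ^+ p * f (scal r y))).
  rewrite (_ : _ \o _ = (fun r => (r ^+ p * f (scal r x))%:E - (r ^+ p * f (scal r y))%:E)%E)//.
  exact: integrableB.
apply: (le_trans (le_normr_Rintegral _ _)) => //.
apply: (@le_trans _ _ (\int[mu]_(r in `[0, 1]) e)).
  apply: le_Rintegral => //.
  - exact: integrable_norm.
  - by apply: continuous_compact_integrable => [|z]; [exact: segment_compact|exact: cst_continuous].
  - move=> r/=; rewrite in_itv/= => r01; rewrite -mulrBr normrM.
    by rewrite (le_trans _ (ey r r01))// ler_piMl// unit_pow.
by rewrite Rintegral_cst// unit_measure mulr1.
Unshelve. all: by end_near. Qed.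

(** Differentiation under the integral sign. [scal r] multiplies direction [i] by [r] exactly when
    [T i] holds, so the chain rule raises the exponent by [T i]. *)
Lemma is_derive_radint p f i x :
  unit_on (fun y => \forall z \near y, {for z, continuous f}) x ->
  unit_on (fun y => \forall z \near y, derivable f z (delta_mx 0 i)) x ->
  unit_on (fun y => \forall z \near y, {for z, continuous (partial i f)}) x ->
  is_derive x (delta_mx 0 i) (radint p f) (radint (p + T i) (partial i f) x).
Proof.
move=> ncf ndf ncdf; set e := delta_mx 0 i.
pose F (h r : R) := r ^+ p * f (scal r (h *: e + x)).
have scal_line (r h : R) : scal r (h *: e + x) = (h * r ^+ T i) *: e + scal r x.
  by rewrite scal_aff aff_line mxE.
have dF (h r : R) : derivable f (scal r (h *: e + x)) e ->
    is_derive h 1 (F ^~ r) (r ^+ (p + T i) * partial i f (scal r (h *: e + x))).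
  rewrite scal_line => df.
  have D0 := is_derive_line df.
  have db : is_derive h 1 (fun h : R => h * r ^+ T i) (r ^+ T i).
    have := @is_deriveZ R R^o R^o id (r ^+ T i) h 1 1 (is_derive_id _ _).
    rewrite [_ *: 1]mulr1; congr is_derive.
    by apply/funext => z; rewrite /= [RHS]mulrC.
  have D3 := is_derive_comp1 db D0.
  have := @is_deriveZ R R^o R^o _ (r ^+ p) _ _ _ D3.
  rewrite [_ *: _](_ : _ = r ^+ (p + T i) * partial i f ((h * r ^+ T i) *: e + scal r x)).
    by congr is_derive; apply/funext => z; rewrite /F scal_line.
  by rewrite exprD -mulrA; congr (_ * _); rewrite mulrC.
(* The dominating constant: the maximum of the derivative on the compact segment through [x], plus 1
   so that it also bounds the segments of nearby points. *)
have [M HM] : exists M : R, \forall y \near x,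
    unit_on (fun z => `|partial i f z| <= M) y.
  pose g (r : R) := `|partial i f (scal r x)|.
  have cg : {within `[0, 1], continuous g}.
    apply: continuous_in_subspaceT => r /[!inE]/=; rewrite in_itv/= => r01.
    have cr : {for r, continuous (fun r => partial i f (scal r x))}.
      by apply: continuous_scal; exact: nbhs_singleton (ncdf r r01).
    exact: cvg_norm cr.
  have [c0 _ Hc] := EVT_max ler01 cg.
  exists (g c0 + 1).
  apply: (unit_near (P := fun y r => `|partial i f (scal r y)| <= g c0 + 1)) => r r01.
  have /cvgrPdist_lt/(_ _ ltr01) nr := nbhs_singleton (ncdf r r01).
  have := scal_near nr; apply: filterS => -[r' y]/= /ltW h1.
  have h2 : g r <= g c0 by apply: Hc; rewrite in_itv.
  rewrite -[X in `|X|](subrK (partial i f (scal r x))) addrC.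
  by rewrite (le_trans (ler_normD _ _))// lerD// distrC.
have : \forall y \near x, [/\ unit_on (fun z => `|partial i f z| <= M) y,
    unit_on (fun z => derivable f z e) y & unit_on (fun z => {for z, continuous f}) y].
  have n1 := unit_on_near ndf; have n2 := unit_on_near ncf.
  by near=> y; split; near: y.
move=> /nbhs_boxP[d d0 Hd].
have {}Hd (h : R) : h \in `]- d, d[ ->
    [/\ unit_on (fun z => `|partial i f z| <= M) (h *: e + x),
    unit_on (fun z => derivable f z e) (h *: e + x) &
    unit_on (fun z => {for z, continuous f}) (h *: e + x)].
  rewrite in_itv/= => hd; apply: Hd => j; rewrite !mxE/= opprD addrCA subrr addr0 normrN.
  rewrite normrM (le_lt_trans (y := `|h|))//; last by rewrite ltr_norml.
  by rewrite ler_piMr//; case: (_ == _); rewrite ?normr1 ?normr0.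
have mI : measurable (`[0, 1]%classic : set R) by [].
have I0 : (`]- d, d[%classic : set R) 0 by rewrite /= in_itv/= oppr_lt0 d0.
have intF h : (`]- d, d[%classic : set R) h -> mu.-integrable `[0, 1] (EFin \o F h).
  by move=> /Hd[_ _]; exact: integrable_scal.
have derF h r : (`]- d, d[%classic : set R) h -> (`[0, 1]%classic : set R) r ->
    derivable (F ^~ r) h 1.
  move=> /Hd[_ dd _]; rewrite /= in_itv/= => /dd/dF[]; done.
have G0 (r : R) : 0 <= `|M| by [].
have GI : mu.-integrable `[0, 1] (EFin \o (fun r : R => `|M|)).
  apply: continuous_compact_integrable => [|z]; [exact: segment_compact|exact: cst_continuous].
have Gub h r : (`]- d, d[%classic : set R) h -> (`[0, 1]%classic : set R) r ->
    `|partial1of2 F h r| <= `|M|.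
  move=> /Hd[bd dd _]; rewrite /= in_itv/= => r01.
  rewrite partial1of2E; have [_ ->] := dF _ _ (dd _ r01).
  by rewrite normrM (le_trans _ (ler_norm M))// (le_trans _ (bd _ r01))// ler_piMl// unit_pow.
have D1 := @derivable_under_integral R _ (measurableTypeR R) mu F _ mI 0 (- d) d
  I0 intF derF _ G0 GI Gub.
have D2 := @differentiation_under_integral R _ (measurableTypeR R) mu F _ mI 0 (- d) d
  I0 intF derF _ G0 GI Gub.
have dR : derivable (radint p f) (0 *: e + x) e.
  exact: (@derivable_line _ _ (radint p f) x e 0 D1).
have [_ E] := is_derive_line dR.
rewrite scale0r add0r in dR E; split=> //; rewrite -E -derive1E [LHS]D2 /radint.
apply: eq_Rintegral => r; rewrite inE/= in_itv/= => r01.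
rewrite partial1of2E; have [_ dd _] := Hd _ I0.
have [_ ->] := dF _ _ (dd _ r01).
by rewrite scale0r add0r.
Unshelve. all: by end_near. Qed.

Definition scal_into U W := forall x, U x -> unit_on W x.

Lemma unit_on_C1 W f x : open W -> C1 W f -> unit_on W x ->
  unit_on (fun y => \forall z \near y, {for z, continuous f}) x /\
  forall i, unit_on (fun y => \forall z \near y, derivable f z (delta_mx 0 i)) x.
Proof.
move=> oW Cf Wx; split=> [|i] r /Wx Wr.
  near=> z; have Wz : W z by near: z; exact: open_nbhs_nbhs.
  by have [] := Cf z Wz.
near=> z; have Wz : W z by near: z; exact: open_nbhs_nbhs.
by have [] := Cf z Wz.
Unshelve. all: by end_near. Qed.

Lemma C1_radint U W p f : open W -> smooth W f -> scal_into U W ->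
  C1 U (radint p f).
Proof.
move=> oW sf UW x /UW Wx.
have [cf df] := unit_on_C1 oW (smooth_C1 sf) Wx.
split=> [|i]; first exact: continuous_radint.
have [cdf _] := unit_on_C1 oW (smooth_C1 (smooth_partial i sf)) Wx.
by have [] := is_derive_radint p cf (df i) cdf.
Qed.

Lemma partial_radint U W p f i x : open W -> smooth W f -> scal_into U W ->
  U x -> partial i (radint p f) x = radint (p + T i) (partial i f) x.
Proof.
move=> oW sf UW /UW Wx.
have [cf df] := unit_on_C1 oW (smooth_C1 sf) Wx.
have [cdf _] := unit_on_C1 oW (smooth_C1 (smooth_partial i sf)) Wx.
by have [_] := is_derive_radint p cf (df i) cdf.
Qed.

(** Radial integrals of smooth functions form a class stable under partial derivatives only if the
    exponent may vary; this is why [p] is a parameter. *)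
Lemma smooth_radint U W p f : open U -> open W -> smooth W f ->
  scal_into U W -> smooth U (radint p f).
Proof.
move=> oU oW sf UW.
apply: (@smooth_coind _ _ _ (fun g => exists q h, smooth W h /\ g = radint q h)) => //.
- by move=> _ [q [h [sh ->]]]; exact: C1_radint UW.
- move=> _ i [q [h [sh ->]]]; exists (radint (q + T i) (partial i h)).
    by exists (q + T i)%N, (partial i h); split; [exact: smooth_partial|].
  by move=> x Ux; apply: (partial_radint (W := W)) UW Ux.
- by exists p, f.
Qed.

Lemma eq_radint p f g x : (forall r : R, 0 <= r <= 1 -> f (scal r x) = g (scal r x)) ->
  radint p f x = radint p g x.
Proof.
move=> fg; apply: eq_Rintegral => r; rewrite inE/= in_itv/= => /fg ->.
by [].
Qed.

Lemma is_derive_scal f x (r : R) :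
  (forall j, \forall y \near scal r x, derivable f y (delta_mx 0 j)) ->
  (forall j, {for scal r x, continuous (partial j f)}) ->
  is_derive r 1 (fun r => f (scal r x))
    (\sum_(j | T j) (x 0 j - c 0 j) * partial j f (scal r x)).
Proof.
move=> df cf; pose v := \row_j (if T j then x 0 j - c 0 j else 0).
have E s : scal s x = s *: v + scal 0 x.
  apply/rowP => j; rewrite !mxE; case: (T j); rewrite ?mulr0 ?add0r//.
  by rewrite mul0r addr0 addrC.
have [dd DE] := is_derive_sum v df cf.
rewrite (_ : (fun s => f (scal s x)) = (fun s => f (s *: v + scal 0 x))); last first.
  by apply/funext => s; rewrite E.
rewrite E in dd; apply: (is_derive_eq (is_derive_line dd)).
rewrite -(E r) DE [RHS]big_mkcond/=; apply: eq_bigr => j _; rewrite mxE.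
by case: (T j); rewrite ?mul0r.
Qed.

Lemma cvg_sum_at (I : Type) (s : seq I) (P : pred I) (F : I -> R -> R^o)
    (r : R) : (forall i, P i -> F i z @[z --> r] --> F i r) ->
  \sum_(i <- s | P i) F i z @[z --> r] --> \sum_(i <- s | P i) F i r.
Proof.
move=> cF; elim: s => [|i s IHs].
  rewrite big_nil; under eq_fun do rewrite big_nil.
  exact: cvg_cst.
rewrite big_cons; under eq_fun do rewrite big_cons.
by case Pi: (P i) => //; exact: (cvgD (cF i Pi) IHs).
Qed.

(** Integrability is proved along with the formula, since each addition of integrals requires it. *)
Lemma radint_sum (I : Type) (s : seq I) (P : pred I) p
    (F : I -> 'rV[R]_N -> R^o) (a : I -> R) x :
  (forall i, P i -> unit_on (fun y => {for y, continuous (F i)}) x) ->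
  mu.-integrable `[0, 1]
    (EFin \o (fun r : R => \sum_(i <- s | P i) a i * (r ^+ p * F i (scal r x)))) /\
  \int[mu]_(r in `[0, 1]) (\sum_(i <- s | P i) a i * (r ^+ p * F i (scal r x))) =
  \sum_(i <- s | P i) a i * radint p (F i) x.
Proof.
have mI : measurable (`[0, 1]%classic : set (measurableTypeR R)) by [].
move=> cF; elim: s => [|i s [IHi IHe]].
  under [X in EFin \o X]eq_fun do rewrite big_nil; split.
    by apply: continuous_compact_integrable => [|z]; [exact: segment_compact|exact: cst_continuous].
  under eq_Rintegral do rewrite big_nil.
  by rewrite Rintegral_cst// mul0r big_nil.
under [X in EFin \o X]eq_fun do rewrite big_cons.
under eq_Rintegral do rewrite big_cons.
rewrite big_cons; case Pi: (P i); last by split.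
have Ii := integrable_scal p (cF i Pi).
have IZ : mu.-integrable `[0, 1]
    (EFin \o (fun r : R => a i * (r ^+ p * F i (scal r x)))).
  have := integrableZl mI (a i) Ii.
  by congr (_.-integrable _ _); apply/funext => r; rewrite /= EFinM.
split.
  have := integrableD mI IZ IHi.
  by congr (_.-integrable _ _); apply/funext => r; rewrite /= EFinD.
by rewrite RintegralD// IHe RintegralZl.
Qed.

(** The fundamental theorem of calculus for [r ^+ q * f (scal r x)] on [0, 1]. The boundary term at
    [r = 0] survives only for [q = 0], where [0 ^+ 0 = 1]; that case is Hadamard's lemma. *)
Lemma radint_ftc_pow U W q f x : open W -> smooth W f -> scal_into U W -> U x ->
  q%:R * radint q.-1 f x +
  \sum_(j | T j) (x 0 j - c 0 j) * radint q (partial j f) x =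
  f x - 0 ^+ q * f (scal 0 x).
Proof.
move=> oW sf UW Ux; have Wx := UW x Ux.
pose F (r : R) := r ^+ q * f (scal r x).
(* A sum over a singleton list, so that [radint_sum] applies to this term as well. *)
pose F1 (r : R) := \sum_(j <- [:: tt]) q%:R * (r ^+ q.-1 * f (scal r x)).
pose F2 (r : R) := \sum_(j | T j) (x 0 j - c 0 j) * (r ^+ q * partial j f (scal r x)).
have Cd j : C1 W (partial j f) by exact/smooth_C1/smooth_partial.
have dF (r : R) : 0 <= r <= 1 -> is_derive r 1 F (F1 r + F2 r).
  move=> r01; have Wr := Wx r r01.
  have [_ df] := unit_on_C1 oW (smooth_C1 sf) Wx.
  have ds := @is_derive_scal f x r (fun j => df j r r01) (fun j => (Cd j _ Wr).1).
  have de : is_derive r 1 (fun r : R => r ^+ q) (q%:R * r ^+ q.-1).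
    split; first exact: exprn_derivable.
    case: (q) => [|q']; last by rewrite exp_derive [_ *: 1]mulr1.
    under eq_fun do rewrite expr0.
    by rewrite derive_cst mul0r.
  have := @is_deriveM R R^o (fun r : R => r ^+ q) (fun r => f (scal r x)) r 1 _ _ de ds.
  move=> /is_derive_eq; apply; rewrite addrC /F1 big_seq1; congr (_ + _).
    by rewrite [_ *: _]mulrC mulrA.
  by rewrite [_ *: _]mulr_sumr; apply: eq_bigr => j _; rewrite mulrCA.
have in01 (r : R) : r \in `]0, 1[ -> 0 <= r <= 1.
  by rewrite in_itv/= => /andP[/ltW -> /ltW ->].
have cF r : 0 <= r <= 1 -> {for r, continuous F}.
  by move=> /dF[d _]; exact/differentiable_continuous/derivable1_diffP.
have u0 : (0 : R) <= (0 : R) <= (1 : R) by apply/andP.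
have u1 : (0 : R) <= (1 : R) <= (1 : R) by apply/andP.
have cscal k g : C1 W g -> forall r : R, 0 <= r <= 1 ->
    {for r, continuous (fun r : R => r ^+ k * g (scal r x))}.
  move=> Cg r r01; have ce : {for r, continuous (fun r : R => r ^+ k)}.
    exact/differentiable_continuous/derivable1_diffP/exprn_derivable.
  by apply: (cvgM ce (continuous_scal _)); exact: (Cg _ (Wx r r01)).1.
have cF12 : {within `[0, 1], continuous (fun r => F1 r + F2 r)}.
  apply: continuous_in_subspaceT => r /[!inE]/=; rewrite in_itv/= => r01.
  apply: cvgD.
    rewrite /F1; under eq_fun do rewrite big_seq1; rewrite big_seq1.
    apply: cvgM; first exact: cvg_cst.
    exact: (cscal q.-1 f (smooth_C1 sf) r r01).
  apply: cvg_sum_at => j _; apply: cvgM; first exact: cvg_cst.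
  exact: (cscal q (partial j f) (Cd j) r r01).
have LR : derivable_oo_LRcontinuous F 0 1.
  split; first by move=> r /in01/dF[].
    exact/cvg_at_right_filter/cF.
  exact/cvg_at_left_filter/cF.
have dE : {in `]0, 1[, F^`()%classic =1 (fun r => F1 r + F2 r)}.
  by move=> r /in01/dF[_]; rewrite derive1E.
have := continuous_FTC2 ltr01 cF12 LR dE.
rewrite /F expr1n mul1r scal1 => /(congr1 constructive_ereal.fine)/= <-.
have mI : measurable (`[0, 1]%classic : set (measurableTypeR R)) by [].
have [I1 E1] := @radint_sum unit [:: tt] xpredT q.-1 (fun=> f) (fun=> q%:R) x
  (fun _ _ r r01 => (smooth_C1 sf (Wx r r01)).1).
have [I2 E2] := @radint_sum 'I_N (index_enum _) T q (partial ^~ f) (fun j => x 0 j - c 0 j) x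
  (fun j _ r r01 => (Cd j _ (Wx r r01)).1).
by have := RintegralD mI I1 I2; rewrite E1 E2 big_seq1 => <-.
Qed.

Lemma radint_ftc U W p f x : open W -> smooth W f -> scal_into U W -> U x ->
  p.+1%:R * radint p f x +
  \sum_(j | T j) (x 0 j - c 0 j) * radint p.+1 (partial j f) x = f x.
Proof.
move=> oW sf UW Ux; rewrite (radint_ftc_pow p.+1 oW sf UW Ux).
by rewrite expr0n mul0r subr0.
Qed.

Lemma radint_ftc0 U W f x : open W -> smooth W f -> scal_into U W -> U x ->
  \sum_(j | T j) (x 0 j - c 0 j) * radint 0 (partial j f) x =
  f x - f (scal 0 x).
Proof.
move=> oW sf UW Ux; have := radint_ftc_pow 0 oW sf UW Ux.
by rewrite mul0r add0r expr0 mul1r.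
Qed.

End RadialIntegral.

(** * Symmetry of second derivatives *)

Section Schwarz.
Context {R : realType} {N : nat}.
Implicit Types (U V W : set 'rV[R]_N) (f g : 'rV[R]_N -> R^o) (x y c : 'rV[R]_N).

(** In general a cylinder, unbounded in the coordinates outside [T]. *)
Definition box (T : pred 'I_N) c (e : R) : set 'rV[R]_N :=
  [set y | forall j, T j -> `|c 0 j - y 0 j| < e].

Lemma open_box T c e : open (box T c e).
Proof.
rewrite openE => x xc.
suff : nbhs x (fun y : 'rV[R]_N => forall j, T j -> `|c 0 j - y 0 j| < e) by [].
apply: (@filter_forall _ _ (fun j (y : 'rV[R]_N) => T j -> `|c 0 j - y 0 j| < e) (nbhs x) _) => j.
have [Tj|_] := boolP (T j); last by near=> y.
apply/nbhs_boxP; exists (e - `|c 0 j - x 0 j|); first by rewrite subr_gt0 xc.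
move=> y xy _; have := xy j; rewrite ltrBrDl => /(le_lt_trans _); apply.
by rewrite (le_trans _ (ler_normD _ _))// addrA subrK.
Unshelve. all: by end_near. Qed.

Lemma box_center T c (e : R) : 0 < e -> box T c e c.
Proof. by move=> e0 j _; rewrite subrr normr0. Qed.

Lemma open_box_in U x : open U -> U x -> exists2 e : R, 0 < e & box xpredT x e `<=` U.
Proof.
move=> oU Ux; have /nbhs_boxP[e e0 H] : nbhs x U by exact: open_nbhs_nbhs.
by exists e => // y xy; apply: H => j; exact: xy.
Qed.

Lemma scal_box T S c e : scal_into S c (box T c e) (box T c e).
Proof.
move=> y yc r /andP[r0 r1] j Tj; rewrite mxE; case: ifP => _; last exact: yc.
rewrite opprD addrA subrr add0r normrN normrM (le_lt_trans _ (yc j Tj))//.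
by rewrite distrC (ger0_norm r0) ler_piMl.
Qed.

(** The dilations fix [x], so the derivative terms of [radint_ftc] carry the factor 0. *)
Lemma radint_fixed (T : pred 'I_N) c U p f x : open U -> smooth U f -> U x ->
  (forall j, T j -> x 0 j = c 0 j) -> p.+1%:R * radint T c p f x = f x.
Proof.
move=> oU sf Ux xc.
have xx (r : R) : scal T c r x = x.
  apply/rowP => j; rewrite mxE; case: ifP => // Tj.
  by rewrite xc// subrr mulr0 addr0.
rewrite -[RHS](@radint_ftc _ _ T c [set x] U p f x) => //.
  rewrite big1 ?addr0// => j Tj; by rewrite xc// subrr mul0r.
by move=> _ -> r _; rewrite xx.
Qed.

(* Hadamard's lemma in direction i, f = f(c) + (x_i - c_i) F with smooth F, is
   differentiated along j and compared with Hadamard's lemma for partial j f: the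
   two remainders agree, and at x_i = c_i they are the two mixed derivatives. *)
Lemma schwarz U f i j x : open U -> smooth U f -> U x ->
  partial i (partial j f) x = partial j (partial i f) x.
Proof.
move=> oU sf Ux; have [->//|ij] := eqVneq i j.
have [e e0 OU] := open_box_in oU Ux; set O := box _ _ _ in OU.
have oO : open O by exact: open_box.
have {}sf : smooth O f by exact: smoothS sf.
have sfi := smooth_partial i sf; have sfj := smooth_partial j sf.
have sfij := smooth_partial i sfj; have sfji := smooth_partial j sfi.
have Ox : O x by exact: box_center.
pose T := pred1 i; have OO : scal_into T x O O by exact: scal_box.
pose D y := radint T x 1 (partial j (partial i f)) y -
  radint T x 1 (partial i (partial j f)) y.
have sK p g : smooth O g -> smooth O (radint T x p g).
  by move=> sg; exact: smooth_radint OO.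
have ftc g y : smooth O g -> O y ->
    g y = radint T x 0 g y + (y 0 i - x 0 i) * radint T x 1 (partial i g) y.
  by move=> sg Oy; rewrite -[LHS](radint_ftc 0 oO sg OO Oy) mul1r big_pred1_eq.
have zD y : O y -> (y 0 i - x 0 i) * D y = 0.
  move=> Oy; rewrite mulrBr; apply/eqP; rewrite subr_eq0; apply/eqP.
  apply: (addrI (radint T x 0 (partial j f) y)).
  apply: etrans (ftc _ _ sfj Oy); apply/esym.
  pose h1 : 'rV[R]_N -> R^o := radint T x 0 f.
  pose h2 : 'rV[R]_N -> R^o := fun y => y 0 i - x 0 i.
  pose h3 : 'rV[R]_N -> R^o := radint T x 1 (partial i f).
  have C1h1 : C1 O h1 by exact/smooth_C1/sK.
  have C1h2 : C1 O h2 by exact: C1D (@C1_coord _ _ O i) (C1_cst (- x 0 i)).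
  have C1h3 : C1 O h3 by exact/smooth_C1/sK.
  have E : partial j f y = partial j (h1 + h2 * h3) y.
    by apply: (eq_iter_partial [:: j] oO) => // z Oz; exact: ftc.
  rewrite E (partialD j C1h1 (C1M C1h2 C1h3) Oy) (partialM j C1h2 C1h3 Oy) /h1 /h3.
  rewrite (@partial_radint _ _ T x O O 0 f j y oO sf OO Oy).
  rewrite (@partial_radint _ _ T x O O 1 _ j y oO sfi OO Oy).
  have -> : partial j h2 y = 0.
    rewrite (partialD j (@C1_coord _ _ O i) (C1_cst (- x 0 i)) Oy).
    by rewrite partial_coord partial_cst (negPf ij) addr0.
  by rewrite mulr0 addr0 /= [j == i]eq_sym (negPf ij) !addn0.
have Dx0 : radint T x 1 (partial i (partial j f)) x =
    radint T x 1 (partial j (partial i f)) x.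
  apply/esym/eqP; rewrite -subr_eq0; apply/eqP; rewrite -/(D x).
  pose h2 : 'rV[R]_N -> R^o := fun y => y 0 i - x 0 i.
  have C1h2 : C1 O h2 by exact: C1D (@C1_coord _ _ O i) (C1_cst (- x 0 i)).
  have CD : C1 O D.
    by apply/smooth_C1; exact: (smoothB oO (sK 1%N _ sfji) (sK 1%N _ sfij)).
  (* Differentiating [(y_i - x_i) D = 0] along [i] at [x] gives [D x = 0] without dividing by a
     factor that vanishes there. *)
  have : partial i (h2 * D) x = 0.
    rewrite -[RHS](partial_cst i 0 x).
    by apply: (eq_iter_partial [:: i] oO) => // z Oz; exact: zD.
  rewrite (partialM i C1h2 CD Ox) {1}/h2 subrr mul0r add0r.
  rewrite (partialD i (@C1_coord _ _ O i) (C1_cst (- x 0 i)) Ox).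
  by rewrite partial_coord partial_cst eqxx addr0 mulr1.
have fixe k : T k -> x 0 k = x 0 k by [].
rewrite -[LHS](radint_fixed 1 oO sfij Ox fixe).
rewrite -[RHS](radint_fixed 1 oO sfji Ox fixe).
exact: (congr1 (fun z => 2%:R * z) Dx0).
Qed.

End Schwarz.

(** * Bump functions and gluing *)

Section Bump.
Context {R : realType}.

(* The powers of 1/x make the family closed under differentiation. *)
Definition flat n (x : R) : R := if 0 < x then x^-1 ^+ n * expR (- x^-1) else 0.

(** From [exp y >= y ^ (n + 2) / (n + 2)!] with [y = 1 / x]. The two extra powers leave [x ^ 2], so
    that the difference quotients at 0 tend to 0. *)
Lemma flat_le n (x : R) : `|flat n x| <= n.+2`!%:R * x ^+ 2.
Proof.
rewrite /flat; case: ifPn => x0; last first.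
  by rewrite normr0 mulr_ge0// sqr_ge0.
have y0 : 0 <= x^-1 by rewrite invr_ge0 ltW.
rewrite ger0_norm; last by rewrite mulr_ge0 ?exprn_ge0 ?expR_ge0.
have := expR_ge1Dxn n.+1 y0.
move=> /(le_trans (ler_wpDl ler01 (lexx _))) H.
have fn0 : 0 < n.+2`!%:R :> R by rewrite ltr0n fact_gt0.
rewrite expRN ler_pdivrMr ?expR_gt0//.
rewrite (le_trans _ (ler_wpM2l _ H))//; last first.
  by rewrite mulr_ge0 ?sqr_ge0// ltW.
rewrite -(addn2 n) exprD; move: (x^-1 ^+ n) fn0; rewrite addn2 => a fn0.
have -> // : n.+2`!%:R * x ^+ 2 * (a * x^-1 ^+ 2 / n.+2`!%:R) = a.
by field; rewrite !gt_eqF.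
Qed.

Lemma is_derive_flat n (x : R) :
  is_derive x 1 (flat n) (flat n.+2 x - n%:R * flat n.+1 x).
Proof.
have [x0|x0|->] := ltgtP x 0.
- have e k : flat k x = 0 by rewrite /flat ltNge (ltW x0).
  rewrite !e mulr0 subr0.
  apply: (@near_eq_is_derive R R^o R^o (cst 0)).
  near=> y; rewrite /flat ltNge (_ : y <= 0)//; apply: ltW; near: y.
  exact: lt_nbhsl.
- have d1 : is_derive x 1 (fun x : R => x^-1) (- x ^- 2).
    have x0' := lt0r_neq0 x0; split.
      exact/derivable1_diffP/differentiable_Rinv.
    rewrite -derive1E derive1E'; last exact: differentiable_Rinv.
    by rewrite diff_Rinv//= [LHS]mulr1.
  pose y := x^-1.
  have d2 : is_derive y 1 (fun y : R => y ^+ n * expR (- y))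
     (n%:R * y ^+ n.-1 * expR (- y) - y ^+ n * expR (- y)).
    have dN : is_derive y 1 (fun y : R => - y) (-1).
      exact: (is_deriveNid (y : R^o) 1).
    have de := is_derive_comp1 dN (is_derive_expR (- y)).
    have dX : is_derive y 1 (fun y : R => y ^+ n) (n%:R * y ^+ n.-1).
      have := @is_deriveX R R^o id n y 1 1 (is_derive_id _ _).
      by rewrite [_ *: 1]mulr1; congr is_derive; apply/funext => z; rewrite exprfctE.
    apply: (is_derive_eq (@is_deriveM R R^o _ _ y 1 _ _ dX de)).
    by rewrite /= mulrN1 scalerN addrC [_ *: _]mulrC.
  have d3 := is_derive_comp1 d1 d2.
  apply: (@near_eq_is_derive _ _ _ ((fun y : R => y ^+ n * expR (- y)) \o (fun x => x^-1))).
    near=> z; rewrite /flat (_ : 0 < z)//; near: z; exact: lt_nbhsr.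
  apply: (is_derive_eq d3); rewrite /flat x0 -/y.
  have -> : x ^- 2 = y ^+ 2 by rewrite exprVn.
  case: n {d2 d3} => [|n /=]; rewrite ?mul0r ?expr0 ?expr1 ?exprS; ring.
- have e k : flat k 0 = 0 by rewrite /flat ltxx.
  rewrite !e mulr0 subr0.
  suff H : h^-1 *: (flat n (h *: 1 + 0) - flat n 0) @[h --> (0 : R)^'] --> (0 : R).
    by split; [apply/cvg_ex; exists 0; exact: H|apply: cvg_lim H].
  apply: (cvgrPdist_le (F := (0 : R)^') _ (0 : R)).2 => eps eps0.
  have fn0 : 0 < n.+2`!%:R :> R by rewrite ltr0n fact_gt0.
  near=> h; have h0 : h != 0 by near: h; exact: nbhs_dnbhs_neq.
  rewrite e subr0 addr0 [_%:A]mulr1 sub0r normrN normrZ normfV.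
  rewrite ler_pdivrMl ?normr_gt0// (le_trans (flat_le n h))//.
  rewrite -(ger0_norm (sqr_ge0 h)) expr2 normrM mulrCA ler_wpM2l//.
  rewrite mulrC -ler_pdivlMr//; near: h; apply: dnbhs0_le.
  exact: divr_gt0.
Unshelve. all: by end_near. Qed.

End Bump.

Section SmoothBump.
Context {R : realType} {N : nat}.
Implicit Types (U V W : set 'rV[R]_N) (f g : 'rV[R]_N -> R^o) (x y c v : 'rV[R]_N).

Lemma is_derive_comp_dir (phi : R -> R^o) f x v b : derivable f x v ->
  is_derive (f x) 1 phi b -> is_derive x v (phi \o f) (b * 'D_v f x).
Proof.
move=> df dphi.
have d0 := @is_derive_line _ _ f x v 0.
rewrite scale0r add0r in d0; have {}d0 := d0 df.
have E : f (0 *: v + x) = f x by rewrite scale0r add0r.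
rewrite -E in dphi; have d1 := is_derive_comp1 d0 dphi.
have dl : derivable (phi \o f) (0 *: v + x) v by apply: derivable_line; case: d1.
have [_ d2] := is_derive_line dl; have [_ d3] := d1.
by rewrite scale0r add0r in dl d2; split=> //; rewrite -d2 -d3.
Qed.

Lemma smooth_flat U n f : open U -> smooth U f -> smooth U (flat n \o f).
Proof.
move=> oU sf.
(* Differentiating [flat k \o f] brings in [flat] of index [k + 1] and [k + 2] and a partial
   derivative of [f], so both kinds of generators are needed. *)
pose B g := smooth U g \/ exists2 k, g = (flat k \o f) & true.
apply: (@smooth_genP _ _ _ B oU); last by apply: GenBase; right; exists n.
- move=> _ [/smooth_C1//|[k -> _]] x Ux; have [cf df] := smooth_C1 sf Ux.
  split=> [|i].
    have [dk _] := is_derive_flat k (f x).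
    have ck : {for f x, continuous (flat k)}.
      exact/differentiable_continuous/derivable1_diffP.
    exact: (cvg_comp f (flat k) cf ck).
  by have [] := is_derive_comp_dir (df i) (is_derive_flat k (f x)).
- move=> g i [sg|[k -> _]].
    by exists (partial i g) => //; apply: GenBase; left; exact: smooth_partial.
  exists ((flat k.+2 \o f + cst (- k%:R) * (flat k.+1 \o f)) * partial i f).
    apply: GenM; last by apply: GenBase; left; exact: smooth_partial.
    apply: GenD; first by apply: GenBase; right; exists k.+2.
    by apply: GenM; [exact: GenCst|apply: GenBase; right; exists k.+1].
  move=> x Ux; have [_ df] := smooth_C1 sf Ux.
  have [_ e] := is_derive_comp_dir (df i) (is_derive_flat k (f x)).
  by rewrite [LHS]e !fctE mulNr.
Qed.

Lemma flat_gt0 (x : R) : (0 < flat 0 x) = (0 < x).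
Proof.
rewrite /flat; case: ifP => x0; last by rewrite ltxx.
by rewrite mul1r expR_gt0.
Qed.

Lemma flat_ge0 (x : R) : 0 <= flat 0 x.
Proof. by rewrite /flat; case: ifP => x0 //; rewrite mul1r expR_ge0. Qed.

Lemma flat_eq0 (x : R) : x <= 0 -> flat 0 x = 0.
Proof. by rewrite /flat leNgt => /negbTE ->. Qed.

Definition step (y : R) : R := flat 0 y / (flat 0 y + flat 0 (1 - y)).

(** [y] and [1 - y] cannot both be nonpositive. *)
Lemma step_den (y : R) : 0 < flat 0 y + flat 0 (1 - y).
Proof.
have [y0|y0] := ltP 0 y; first by rewrite ltr_pwDl ?flat_ge0// flat_gt0.
by rewrite ltr_wpDl ?flat_ge0// flat_gt0 subr_gt0 (le_lt_trans y0).
Qed.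

Lemma step0 (y : R) : y <= 0 -> step y = 0.
Proof. by move=> y0; rewrite /step flat_eq0// mul0r. Qed.

Lemma step1 (y : R) : 1 <= y -> step y = 1.
Proof.
move=> y1; rewrite /step (@flat_eq0 (1 - y)) ?subr_le0// addr0 divff// gt_eqF//.
by rewrite flat_gt0 (lt_le_trans _ y1).
Qed.

Lemma smooth_step U f : open U -> smooth U f -> smooth U (step \o f).
Proof.
move=> oU sf; have s0 := smooth_flat 0 oU sf.
have s1 := smooth_flat 0 oU (smoothB oU (smooth_cst 1 oU) sf).
have sD := smoothD oU s0 s1.
have sV := smoothV oU sD (fun x _ => lt0r_neq0 (step_den (f x))).
exact: (smoothM oU s0 sV).
Qed.

(** With [z] the rescaled coordinate, [2 - 4 z ^ 2] is at least 1 for [|z| <= 1/2] and negative for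
    [|z| >= 3/4], as [3/4 > 1 / sqrt 2]: hence the radii in [bump_in] and [bump_out]. The square
    avoids the corner of the absolute value. *)
Definition bump (T : pred 'I_N) c (e : R) x : R^o :=
  \prod_(j | T j) step (2 - 4 * ((x 0 j - c 0 j) / e) ^+ 2).

Lemma smooth_bump T c e : smooth setT (bump T c e).
Proof.
have oT : open (setT : set 'rV[R]_N) by exact: openT.
apply: (smooth_prod _ oT) => j _.
apply: (smooth_step oT); apply: (smoothB oT (smooth_cst 2 oT)).
apply: (smoothZ 4 oT).
have sl : smooth setT (fun x : 'rV[R]_N => (x 0 j - c 0 j) / e).
  exact: (smoothM oT (smoothB oT (smooth_coord j oT) (smooth_cst _ oT))
    (smooth_cst e^-1 oT)).
exact: (smoothM oT sl sl).
Qed.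

Lemma bump_in T c e x : 0 < e -> box T c (e / 2) x -> bump T c e x = 1.
Proof.
move=> e0 xc; rewrite /bump big1// => j Tj; apply: step1.
have h : `|(x 0 j - c 0 j) / e| <= 1 / 2.
  rewrite normrM normfV (gtr0_norm e0) ler_pdivrMr// distrC.
  by rewrite (le_trans (ltW (xc j Tj)))// mulrC mul1r.
have : ((x 0 j - c 0 j) / e) ^+ 2 <= (1 / 2) ^+ 2.
  by rewrite -[leLHS]real_normK ?num_real// ler_sqr// nnegrE.
by lra.
Qed.

Lemma bump_out T c e x : 0 < e -> ~ box T c (3 / 4 * e) x -> bump T c e x = 0.
Proof.
move=> e0 xc; have [j Tj hj] : exists2 j, T j & 3 / 4 * e <= `|c 0 j - x 0 j|.
  apply: contrapT => H; apply: xc => j Tj; rewrite ltNge; apply/negP => hj.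
  by apply: H; exists j.
rewrite /bump (bigD1 j)//= step0 ?mul0r//.
have h : 3 / 4 <= `|(x 0 j - c 0 j) / e|.
  by rewrite normrM normfV (gtr0_norm e0) ler_pdivlMr// distrC.
have : (3 / 4) ^+ 2 <= ((x 0 j - c 0 j) / e) ^+ 2.
  by rewrite -[leRHS]real_normK ?num_real// ler_sqr// nnegrE// divr_ge0.
by lra.
Qed.

Lemma partial_bump T c e i x : ~~ T i -> partial i (bump T c e) x = 0.
Proof.
move=> Ti; have dl : derivable (bump T c e) (0 *: delta_mx 0 i + x) (delta_mx 0 i).
  have [_] := smooth_C1 (@smooth_bump T c e) (I : setT (0 *: delta_mx 0 i + x)).
  exact.
have [_] := is_derive_line dl; rewrite scale0r add0r /partial => <-.
have -> : (fun h : R => bump T c e (h *: delta_mx 0 i + x)) = cst (bump T c e x).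
  apply/funext => h; apply: eq_bigr => j Tj; rewrite !mxE/=.
  by case: eqVneq => [E|_]; [rewrite -E Tj in Ti|rewrite mulr0 add0r].
by rewrite derive_cst.
Qed.

End SmoothBump.

(** * Gluing local solutions *)

Section Gluing.
Context {R : realType} {N : nat} {K : Type}.
Variables (T : pred 'I_N) (U : set 'rV[R]_N).
Local Notation family := (K -> 'rV[R]_N -> R^o).
(** [Sol x Y] is meant as: [Y] is a solution near [x]. The hypotheses make it a property of the germ
    that is stable under interpolation by bump functions and locally solvable. [T] restricts the
    bumps to coordinates in which the equation at hand is not differentiated. *)
Variable Sol : 'rV[R]_N -> family -> Prop.

Definition mix (psi : 'rV[R]_N -> R^o) (Y Z : family) : family :=
  fun k x => psi x * Y k x + (1 - psi x) * Z k x.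

Hypothesis Sol_eq : forall x Y Z, (\forall y \near x, forall k, Y k y = Z k y) ->
  Sol x Y -> Sol x Z.
Hypothesis Sol_mix : forall x c e Y Z, U x -> Sol x Y -> Sol x Z ->
  Sol x (mix (bump T c e) Y Z).
Hypothesis Sol_local : forall x, U x -> exists2 e : R, 0 < e &
  exists Y, forall y, U y -> box T x e y -> Sol y Y.

(** [pickle] enumerates the rational boxes. A number that encodes no box gets radius 0 and is never
    [good]. *)
Let center (i : nat) : 'rV[R]_N :=
  if unpickle i is Some q then map_mx ratr (q : 'rV[rat]_N * rat).1 else 0.
Let radius (i : nat) : R :=
  if unpickle i is Some q then ratr (q : 'rV[rat]_N * rat).2 else 0.

Let good i Y := 0 < radius i /\
  forall y, U y -> box T (center i) (radius i) y -> Sol y Y.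

(** If [q < e0 / 2] and the centre is within [q / 2] of [x], the box of radius [q] stays within
    [3 q / 2 < e0] of [x]. *)
Let good_near x : U x -> exists i Y, good i Y /\
  box T (center i) (radius i / 2) x.
Proof.
move=> /Sol_local[e0 e00 [Y HY]].
have [q] := @rat_in_itvoo R 0 (e0 / 2) (divr_gt0 e00 (ltr0Sn _ _)).
rewrite in_itv/= => /andP[q0 qe].
have /choice[cq Hcq] : forall j : 'I_N, exists r : rat,
    `|ratr r - x 0 j| < ratr q / 2.
  move=> j; have [r] := @rat_in_itvoo R (x 0 j - ratr q / 2) (x 0 j + ratr q / 2)
    (ltac:(lra)).
  by rewrite in_itv/= => rj; exists r; rewrite ltr_distl.
pose i := pickle ((\row_j cq j, q) : 'rV[rat]_N * rat).
have ci j : center i 0 j = ratr (cq j) by rewrite /center /i pickleK !mxE.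
have ri : radius i = ratr q by rewrite /radius /i pickleK.
exists i, Y; split; last by move=> j Tj; rewrite ci ri; exact: Hcq.
split=> [|y Uy]; rewrite ri// => yc; apply: HY => // j Tj.
have := yc j Tj; have := Hcq j; rewrite ci => h1 h2.
rewrite -(subrK (ratr (cq j)) (x 0 j)) -addrA.
rewrite (le_lt_trans (ler_normD _ _))// distrC (lt_trans (ltrD h1 h2))//; lra.
Qed.

(* Countably many boxes with rational centres and radii carry local solutions;
   starting from the first one, each is blended in by its bump function. Near a
   given point only finitely many matter: past the first index whose bump is 1,
   all later ones are multiplied by 0. *)
Lemma glue : exists Y, forall x, U x -> Sol x Y.
Proof.
have /choice[Y HY] : forall i, exists Y, (exists Z, good i Z) -> good i Y.
  move=> i; have [[Z gZ]|nZ] := pselect (exists Z, good i Z).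
    by exists Z.
  by exists (fun _ _ => 0).
pose psi i : 'rV[R]_N -> R^o := fun x =>
  if `[< good i (Y i) >] then bump T (center i) (radius i) x else 0.
(* The head of the list is outermost: where its bump equals 1, the rest of the list is invisible. *)
pose nest s Z := foldr (fun i => mix (psi i) (Y i)) Z s.
have Sol_step x i Z : U x -> Sol x Z -> Sol x (mix (psi i) (Y i) Z).
  move=> Ux SZ; have skip : (\forall y \near x, psi i y = 0) ->
      Sol x (mix (psi i) (Y i) Z).
    move=> n0; apply: Sol_eq SZ; apply: filterS n0 => y y0 k.
    by rewrite /mix y0 mul0r add0r subr0 mul1r.
  have [gi|/asboolPn ngi] := pselect (good i (Y i)); last first.
    by apply: skip; near=> y; rewrite /psi (negbTE ngi).
  have psiE : psi i = bump T (center i) (radius i).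
    by apply/funext => y; rewrite /psi asboolT.
  have [r0 gY] := gi.
  have [xin|xout] := pselect (box T (center i) (radius i) x).
    by rewrite psiE; apply: Sol_mix => //; exact: gY.
  apply: skip; have [j Tj hj] : exists2 j, T j & radius i <= `|center i 0 j - x 0 j|.
    apply: contrapT => H; apply: xout => j Tj; rewrite ltNge; apply/negP => hj.
    by apply: H; exists j.
  (* Some coordinate of [x] is at distance at least [radius i] from the centre, so a margin of a
     quarter keeps [y] out of the box of radius [3/4 * radius i] outside which the bump is 0. *)
  have r4 : 0 < radius i / 4 by rewrite divr_gt0.
  have : nbhs x (box T x (radius i / 4)).
    by apply: open_nbhs_nbhs; split; [exact: open_box|exact: box_center].
  apply: filterS => y xy; rewrite psiE; apply: bump_out => // /(_ j Tj) hy.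
  have := xy j Tj => hxy.
  have := ler_distD (y 0 j) (center i 0 j) (x 0 j); rewrite (distrC (y 0 j)).
  by lra.
have Sol_nest x s Z : U x -> Sol x Z -> Sol x (nest s Z).
  by move=> Ux SZ; elim: s => //= i s IH; exact: Sol_step.
have nest_ext s Z Z' k y : Z k y = Z' k y -> nest s Z k y = nest s Z' k y.
  by move=> E; elim: s => //= i s IH; rewrite /mix IH.
have nest_stop s1 i s2 Z k y : psi i y = 1 ->
    nest (s1 ++ i :: s2) Z k y = nest s1 (Y i) k y.
  move=> p1; rewrite /nest foldr_cat; apply: nest_ext.
  by rewrite /= /mix p1 mul1r subrr mul0r addr0.
pose first y n := psi n y = 1 /\ forall i, psi i y = 1 -> (n <= i)%N.
have firstP y i : psi i y = 1 -> exists n, first y n.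
  move=> /eqP pi; have ex : exists i, psi i y == 1 by exists i.
  case: (ex_minnP ex) => n /eqP pn mn; exists n; split=> // j /eqP; exact: mn.
have /choice[idx Hidx] : forall y, exists n, (exists i, psi i y = 1) -> first y n.
  move=> y; have [[i pi]|ni] := pselect (exists i, psi i y = 1).
    by have [n fn] := firstP y i pi; exists n.
  by exists 0%N.
(* The stopping index varies with [y], but by [nest_stop] the value at [y] does not change if one
   stops at a later index. So near [x] a single index [i] serves all points, and [Sol_eq]
   applies. *)
exists (fun k y => nest (iota 0 (idx y)) (Y (idx y)) k y) => x Ux.
have [i [Z [gZ xi]]] := good_near Ux.
have gY : good i (Y i) by apply: HY; exists Z.
have [r0 gS] := gY.
have SY : Sol x (Y i).
  apply: gS => // j Tj; rewrite (lt_trans (xi j Tj))// ltr_pdivrMr//.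
  by rewrite ltr_pMr// ltr1n.
apply: (Sol_eq _ (Sol_nest x (iota 0 i) _ Ux SY)).
have : nbhs x (box T (center i) (radius i / 2)).
  by apply: open_nbhs_nbhs; split; [exact: open_box|].
apply: filterS => y yi k.
have pi : psi i y = 1 by rewrite /psi asboolT//; exact: bump_in.
have [pn nle] := Hidx y (ex_intro _ i pi).
have := nle i pi; rewrite leq_eqVlt => /predU1P[->//|ni].
rewrite -(subnKC ni) iotaD.
have -> : iota 0 (idx y).+1 = iota 0 (idx y) ++ [:: idx y].
  by rewrite -addn1 iotaD.
by rewrite -catA cat1s; apply: nest_stop.
Unshelve. all: by end_near. Qed.

End Gluing.

(** * Integration along the fibres *)

Section Primitive.
Context {R : realType} {m : nat}.
Local Notation space := 'rV[R]_m.+1.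
Implicit Types (U V W : set space) (f g : space -> R^o) (x y c v : space).

Definition udir (j : 'I_m.+1) := j != ord0.

Lemma uproj_eqP x y : uproj x = uproj y <-> forall j, udir j -> x 0 j = y 0 j.
Proof.
split=> [E j|E]; last first.
  by apply/rowP => i; rewrite !mxE /ucoord E//= eq_sym neq_lift.
case: (unliftP ord0 j) => [i ->|->]; last by rewrite /udir eqxx.
by move/rowP: E => /(_ i); rewrite !mxE.
Qed.

(** The [t]-coordinate maps a connected fibre onto an interval, and a point of the fibre is
    determined by its [t]. *)
Lemma fiber_segment U x y (s : R) :
  connected (U `&` uproj @^-1` [set uproj y]) ->
  U x -> U y -> uproj x = uproj y ->
  0 <= s <= 1 -> U (scal (pred1 ord0) x s y).
Proof.
move=> cU Ux Uy xy /andP[s0 s1].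
set A := U `&` _ in cU.
have iA : is_interval [set z 0 ord0 | z in A].
  apply/connected_intervalP; apply: connected_continuous_connected cU _.
  by apply: continuous_subspaceT => z; exact: coord_continuous.
have [z [Uz /= zy] zs] : [set z 0 ord0 | z in A] (x 0 ord0 + s * (y 0 ord0 - x 0 ord0)).
  have Ax : [set z 0 ord0 | z in A] (x 0 ord0) by exists x.
  have Ay : [set z 0 ord0 | z in A] (y 0 ord0) by exists y.
  have [le|le] := leP (x 0 ord0) (y 0 ord0).
    apply: (iA _ _ Ax Ay); apply/andP; split; first by rewrite lerDl mulr_ge0// subr_ge0.
    by rewrite -lerBrDl ler_piMl// subr_ge0.
  apply: (iA _ _ Ay Ax); apply/andP; split.
    by rewrite -lerBlDl ler_niMl// subr_le0 ltW.
  by rewrite gerDl mulr_ge0_le0// subr_le0 ltW.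
suff -> : scal (pred1 ord0) x s y = z by [].
apply/rowP => j; rewrite mxE /=; case: eqP => [->|/eqP j0]; first by rewrite zs.
by symmetry; move/uproj_eqP: zy; apply.
Qed.

Lemma smooth_bumpV T c e V : smooth V (@bump R m.+1 T c e).
Proof. exact: smoothS (@subsetT _ V) (smooth_bump T c e). Qed.

Lemma smooth_mix T c e V f g : open V -> smooth V f -> smooth V g ->
  smooth V (fun x => bump T c e x * f x + (1 - bump T c e x) * g x).
Proof.
move=> oV sf sg; have sb := @smooth_bumpV T c e V.
exact: (smoothD oV (smoothM oV sb sf)
  (smoothM oV (smoothB oV (smooth_cst 1 oV) sb) sg)).
Qed.

Lemma partial_mix T c e V f g x : open V -> smooth V f -> smooth V g -> V x ->
  ~~ T ord0 ->
  partial ord0 (fun x => bump T c e x * f x + (1 - bump T c e x) * g x) x =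
  bump T c e x * partial ord0 f x + (1 - bump T c e x) * partial ord0 g x.
Proof.
move=> oV sf sg Vx T0; have sb := @smooth_bumpV T c e V.
have s1 := smooth_cst 1 oV.
have sb' := smoothB oV s1 sb.
rewrite (partialD ord0 (smooth_C1 (smoothM oV sb sf)) (smooth_C1 (smoothM oV sb' sg)) Vx).
rewrite (partialM ord0 (smooth_C1 sb) (smooth_C1 sf) Vx).
rewrite (partialM ord0 (smooth_C1 sb') (smooth_C1 sg) Vx).
have sNb := smoothZ (-1) oV sb.
have -> : partial ord0 (fun x => 1 - bump T c e x) x = 0.
  have E y : V y -> 1 - bump T c e y = (cst 1 + (fun z => -1 * bump T c e z)) y.
    by move=> _; rewrite fctE mulN1r.
  rewrite [LHS](eq_iter_partial [:: ord0] oV E)//=.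
  rewrite (partialD ord0 (smooth_C1 s1) (smooth_C1 sNb) Vx) partial_cst add0r.
  by rewrite (partialZ _ _ (smooth_C1 sb) Vx) partial_bump// mulr0.
by rewrite partial_bump// !mulr0 !addr0.
Qed.

Lemma nbhs_exists_open x (A : set space) : nbhs x A ->
  exists V, [/\ open V, V x & V `<=` A].
Proof. by rewrite nbhsE => -[V [oV Vx] VA]; exists V. Qed.

(** In general no value of [t] occurs in all fibres, so primitives are taken locally, starting from
    the [t]-coordinate of a given point. The bumps that glue them depend on [u] alone and commute
    with the [t]-derivative. *)
Lemma tprimitive U f : open U ->
  (forall u, connected (U `&` uproj @^-1` [set u])) -> smooth U f ->
  exists2 F, smooth U F & forall x, U x -> partial ord0 F x = f x.
Proof.
move=> oU cU sf.
pose Sol x (Y : unit -> space -> R^o) := exists V, [/\ open V, V x, smooth V (Y tt) &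
  forall y, V y -> partial ord0 (Y tt) y = f y].
have [Y HY] : exists Y, forall x, U x -> Sol x Y.
  apply: (@glue _ _ _ udir).
  - move=> x Y Z /nbhs_exists_open[W [oW Wx WYZ]] [V [oV Vx sY pY]].
    have oVW : open (V `&` W) by exact: openI.
    exists (V `&` W); split=> //.
      apply: (@eq_smooth _ _ _ (Y tt)) => //; first by move=> y [_ /WYZ/(_ tt)].
      by apply: smoothS sY => y [].
    move=> y [Vy Wy]; rewrite -pY//; apply/esym.
    by apply: (eq_iter_partial [:: ord0] oW) => // z /WYZ/(_ tt).
  - move=> x c e Y Z Ux [V [oV Vx sY pY]] [W [oW Wx sZ pZ]].
    have oVW : open (V `&` W) by exact: openI.
    have sY' : smooth (V `&` W) (Y tt) by apply: smoothS sY => y [].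
    have sZ' : smooth (V `&` W) (Z tt) by apply: smoothS sZ => y [].
    exists (V `&` W); split; [exact: oVW|by []|exact: (smooth_mix _ c e oVW sY' sZ')|].
    move=> y [Vy Wy].
    rewrite [LHS](partial_mix c e oVW sY' sZ' (conj Vy Wy)) ?eqxx//.
    by rewrite pY// pZ// -mulrDl addrC subrK mul1r.
  - move=> x Ux; have [e e0 eU] := open_box_in oU Ux.
    exists e => //.
    pose O := U `&` box udir x e.
    have oO : open O by apply: openI => //; exact: open_box.
    have OU : scal_into (pred1 ord0) x O U.
      move=> y [Uy yx] r r01.
      (* The starting point of the integration in the fibre of [y]; it lies in [U] because [y] is
         close to [x] in the [u]-coordinates. *)
      pose z : space := \row_j (if j == ord0 then x 0 ord0 else y 0 j).
      have Uz : U z.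
        apply: eU => j _; rewrite mxE; case: eqP => [->|/eqP j0].
          by rewrite subrr normr0.
        exact: yx.
      have zy : uproj z = uproj y.
        by apply/uproj_eqP => j; rewrite /udir mxE => /negbTE ->.
      have -> : scal (pred1 ord0) x r y = scal (pred1 ord0) z r y.
        by apply/rowP => j; rewrite !mxE /=; case: eqP => // ->.
      exact: fiber_segment.
    pose c0 := fun y : space => y 0 ord0 - x 0 ord0.
    pose F0 := radint (pred1 ord0) x 0 f.
    have sc0 : smooth O c0 by exact: smoothB oO (smooth_coord ord0 oO) (smooth_cst _ oO).
    have sF0 : smooth O F0 by exact: (smooth_radint 0 oO oU sf OU).
    exists (fun _ y => c0 y * F0 y) => y Uy yx; exists O.
    split; [exact: oO|by []|exact: (smoothM oO sc0 sF0)|].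
    move=> z Oz; rewrite (partialM ord0 (smooth_C1 sc0) (smooth_C1 sF0) Oz).
    rewrite (@partial_radint _ _ (pred1 ord0) x O U 0 f ord0 z oU sf OU Oz)/=.
    have -> : partial ord0 c0 z = 1.
      rewrite (partialD ord0 (@C1_coord _ _ O ord0) (C1_cst (- x 0 ord0)) Oz).
      by rewrite partial_coord partial_cst addr0.
    rewrite mulr1 addrC -[RHS](radint_ftc 0 oU sf OU Oz) mul1r big_pred1_eq.
    by [].
exists (Y tt).
  by apply: smooth_local => x /HY[V [_ Vx sY _]]; exists V.
by move=> x /HY[V [_ Vx _ pY]]; exact: pY.
Qed.

(** The product of the [t]-axis with [p(U)]. Functions on [p(U)] are treated as [t]-independent
    functions on it, so that a second space with its own calculus is avoided. *)
Definition cyl U : set space := [set x | exists2 y, U y & uproj y = uproj x].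

Lemma sub_cyl U : U `<=` cyl U.
Proof. by move=> x Ux; exists x. Qed.

Lemma open_cyl U : open U -> open (cyl U).
Proof.
move=> oU; rewrite openE => x [y Uy yx].
have [e e0 eU] := open_box_in oU Uy.
suff: nbhs x (box udir x e).
  apply: filterS => z zx.
  exists (\row_j (if j == ord0 then y 0 ord0 else z 0 j)).
    apply: eU => j _; rewrite mxE; case: eqP => [->|/eqP j0].
      by rewrite subrr normr0.
    by move/uproj_eqP: yx => ->//; exact: zx.
  by apply/uproj_eqP => j; rewrite /udir mxE => /negbTE ->.
by apply: open_nbhs_nbhs; split; [exact: open_box|exact: box_center].
Qed.

(** Required at all points, also off the cylinder; it thus passes to partial derivatives without a
    condition on the domain. *)
Definition tindep f := forall x y, uproj x = uproj y -> f x = f y.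

Lemma tconst_fiber U f x y : open U ->
  (forall u, connected (U `&` uproj @^-1` [set u])) -> smooth U f ->
  (forall x, U x -> partial ord0 f x = 0) -> U x -> U y -> uproj x = uproj y ->
  f x = f y.
Proof.
move=> oU cU sf df Ux Uy xy.
have Us s : 0 <= s <= 1 -> U (scal (pred1 ord0) x s y) by exact: fiber_segment.
pose g (s : R) : R^o := f (scal (pred1 ord0) x s y).
have dg (s : R) : 0 <= s <= 1 -> is_derive s 1 g 0.
  move=> s01; apply: is_derive_eq.
    apply: is_derive_scal => j.
      near=> z; have Uz : U z by near: z; exact: (open_nbhs_nbhs (conj oU (Us s s01))).
      exact: (smooth_C1 sf Uz).2.
    exact: (smooth_C1 (smooth_partial j sf) (Us s s01)).1.
  by rewrite big_pred1_eq df ?mulr0//; exact: Us.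
have in01 (s : R) : s \in `[0, 1] -> 0 <= s <= 1 by rewrite in_itv.
have dg' (s : R) : s \in `]0, 1[ -> is_derive s 1 g (cst 0 s).
  by move=> s01; apply/dg/in01; apply: subset_itv_oo_cc s01.
have cg : {within `[0, 1], continuous g}.
  by apply: derivable_within_continuous => s /in01/dg[].
have [c cb] := MVT_segment ler01 dg' cg.
rewrite mul0r => /eqP; rewrite subr_eq0 /g scal1 => /eqP ->.
congr f; apply/rowP => j; rewrite mxE /=; case: eqP => [->|/eqP j0].
  by rewrite mul0r addr0.
by move/uproj_eqP: xy => ->.
Unshelve. all: by end_near. Qed.

(** [g] evaluates [f] at a point of [U] chosen in the same fibre. The choice need not be continuous,
    but [f] is constant on fibres, so near [x] one may use the points with the fixed [t]-coordinate
    of [pick x] instead. *)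
Lemma tindep_extend U f : open U ->
  (forall u, connected (U `&` uproj @^-1` [set u])) -> smooth U f ->
  (forall x, U x -> partial ord0 f x = 0) ->
  exists g, [/\ smooth (cyl U) g, tindep g & forall x, U x -> f x = g x].
Proof.
move=> oU cU sf df.
pose pick x := xget 0 [set y | U y /\ uproj y = uproj x].
pose g x : R^o := f (pick x).
have pickP x : cyl U x -> U (pick x) /\ uproj (pick x) = uproj x.
  by move=> [y Uy yx]; apply: (@xgetPex _ 0 [set y | U y /\ uproj y = uproj x]); exists y.
have fE x y : U y -> uproj y = uproj x -> g x = f y.
  move=> Uy yx; have [Up px] := pickP x (ex_intro2 _ _ y Uy yx).
  by apply: (tconst_fiber oU cU sf df); rewrite // px.
exists g; split; last by move=> x Ux; rewrite (fE x x).
  apply: smooth_local => x Cx; have [Uy yx] := pickP x Cx; set y := pick x in Uy yx.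
  have [e e0 eU] := open_box_in oU Uy.
  pose a : space := \row_j (if j == ord0 then y 0 ord0 else 0).
  pose b : space := \row_j (if j == ord0 then 0 else 1).
  have oB : open (box udir x e) by exact: open_box.
  exists (box udir x e); first exact: box_center.
  have BU z : box udir x e z -> U (aff a b z).
    move=> zx; apply: eU => j _; rewrite !mxE; case: eqP => [->|/eqP j0].
      by rewrite mul0r addr0 subrr normr0.
    by rewrite add0r mul1r; move/uproj_eqP: yx => ->//; exact: zx.
  apply: (@eq_smooth _ _ _ (f \o aff a b)) => //; last exact: (smooth_aff oB sf BU).
  move=> z zx; rewrite /= (fE z (aff a b z))//; first exact: BU.
  by apply/uproj_eqP => j; rewrite /udir !mxE => /negbTE ->; rewrite add0r mul1r.
move=> x y xy; rewrite /g /pick; congr (f (xget _ _)).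
by apply/seteqP; split=> z /= [Uz zE]; split => //; rewrite zE.
Qed.

End Primitive.

(** * The Koszul complex of the Euler vector field *)

Section ExteriorSigns.
Local Close Scope classical_set_scope.
Context {R : realFieldType} {m : nat}.
Implicit Types (S T : {set 'I_m}) (i j : 'I_m).

(** For [j] outside [S], the sign in [d_j /\ d_S = sg j S d_(j |: S)]. *)
Definition sg j S : R := (-1) ^+ #|[set i in S | (i < j)%N]|.

Lemma sgU1 i j S : i \notin S -> sg j (i |: S) = (-1) ^+ (i < j)%N * sg j S.
Proof.
move=> iS; rewrite /sg -exprD; congr (_ ^+ _).
have [ij|ij] := boolP (i < j)%N.
  rewrite (_ : [set _ in _ | _] = i |: [set k in S | (k < j)%N]).
    by rewrite cardsU1 !inE (negPf iS).
  by apply/setP => k; rewrite !inE; case: eqVneq => // ->; rewrite ij.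
congr #|pred_of_set _|; apply/setP => k; rewrite !inE.
by case: eqVneq => //= ->; rewrite (negPf ij) andbF.
Qed.

Lemma sg_sqr j S : sg j S * sg j S = 1.
Proof. by rewrite /sg -expr2 sqrr_sign. Qed.

Lemma sg_neq0 j S : sg j S != 0.
Proof. by rewrite /sg expf_neq0// oppr_eq0 oner_neq0. Qed.

Lemma sg_swap i j T : i != j -> i \notin T -> j \notin T ->
  sg j (i |: T) * sg i (j |: T) = - (sg i T * sg j T).
Proof.
move=> ij iT jT; rewrite !sgU1//.
have : ((i < j) + (j < i) = 1)%N.
  by case: ltngtP => // /val_inj E; rewrite E eqxx in ij.
case: (i < j)%N; case: (j < i)%N => //= _; rewrite ?expr1 ?expr0; ring.
Qed.

(* Multiplication and contraction satisfy the canonical anticommutation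
   relations; X carries the coefficients, which need not commute with either. *)
Lemma anticommutation (X : 'I_m -> 'I_m -> {set 'I_m} -> R) S :
  \sum_(i in S) sg i (S :\ i) *
    (\sum_(j | j \notin S :\ i) sg j (S :\ i) * X i j (j |: (S :\ i))) +
  \sum_(j | j \notin S) sg j S *
    (\sum_(i in j |: S) sg i ((j |: S) :\ i) * X i j ((j |: S) :\ i)) =
  \sum_j X j j S.
Proof.
have E1 i : i \in S -> \sum_(j | j \notin S :\ i) sg j (S :\ i) * X i j (j |: (S :\ i)) =
    sg i (S :\ i) * X i i S +
    \sum_(j | j \notin S) sg j (S :\ i) * X i j (j |: (S :\ i)).
  move=> iS; rewrite (bigD1 i) ?setD11//= finset.setD1K//; congr (_ + _).
  apply: eq_bigl => j; rewrite !inE negb_and negbK.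
  by case: eqVneq => //= [->|_]; rewrite ?iS// andbT.
have E2 j : j \notin S -> \sum_(i in j |: S) sg i ((j |: S) :\ i) * X i j ((j |: S) :\ i) =
    sg j S * X j j S + \sum_(i in S) sg i ((j |: S) :\ i) * X i j ((j |: S) :\ i).
  move=> jS; rewrite (bigD1 j) ?setU11//= finset.setU1K//; congr (_ + _).
  apply: eq_bigl => i; rewrite !inE.
  by case: eqVneq => //= [->|_]; rewrite ?(negPf jS)// andbT.
under eq_bigr => i iS do rewrite E1// mulrDr mulrA sg_sqr mul1r mulr_sumr.
rewrite big_split/=.
under [X in _ + X]eq_bigr => j jS do rewrite E2// mulrDr mulrA sg_sqr mul1r mulr_sumr.
rewrite [X in _ + X]big_split/= [X in _ + (_ + X)]exchange_big/=.
rewrite addrACA -big_split/= [X in _ + X]big1 => [|i iS]; last first.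
  rewrite -big_split/= big1// => j jS.
  have ij : i != j by apply: contraTneq iS => ->.
  have E : (j |: S) :\ i = j |: (S :\ i).
    by apply/setP => k; rewrite !inE; case: (eqVneq k j) => // ->; rewrite eq_sym ij.
  rewrite E !mulrA -mulrDl.
  have := @sg_swap i j (S :\ i) ij; rewrite finset.setD1K// !inE eqxx/= negb_and jS orbT.
  move=> /(_ isT isT); move=> ->.
  by rewrite subrr mul0r.
rewrite addr0 [RHS](bigID (mem S))/=; congr (_ + _).
Qed.

(** This is [u /\ u = 0]: the terms for [(i, j)] and [(j, i)] are opposite, so the sum equals its
    own negative. *)
Lemma ext_sqr (u : 'I_m -> R) (a : {set 'I_m} -> R) S :
  \sum_(i in S) sg i (S :\ i) * (u i *
    \sum_(j in S :\ i) sg j (S :\ i :\ j) * (u j * a (S :\ i :\ j))) = 0.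
Proof.
pose t i j := sg i (S :\ i) * (u i * (sg j (S :\ i :\ j) * (u j * a (S :\ i :\ j)))).
have -> : \sum_(i in S) sg i (S :\ i) * (u i *
    \sum_(j in S :\ i) sg j (S :\ i :\ j) * (u j * a (S :\ i :\ j))) =
    \sum_(i in S) \sum_(j in S | j != i) t i j.
  apply: eq_bigr => i iS; rewrite !mulr_sumr; apply: eq_bigl => j.
  by rewrite !inE andbC.
have anti i j : i \in S -> j \in S -> j != i -> t i j = - t j i.
  move=> iS jS ji; rewrite /t.
  have -> : S :\ j :\ i = S :\ i :\ j by apply/setP => k; rewrite !inE andbCA.
  set T := S :\ i :\ j.
  have Si : S :\ i = j |: T by rewrite finset.setD1K// !inE ji.
  have Sj : S :\ j = i |: T.
    by apply/setP => k; rewrite !inE; case: (eqVneq k i) => [->|] //=; rewrite eq_sym ji iS.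
  have ij : i != j by rewrite eq_sym.
  have iT : i \notin T by rewrite !inE eqxx andbF.
  have jT : j \notin T by rewrite !inE eqxx.
  rewrite Si Sj !sgU1//.
  have : ((i < j) + (j < i) = 1)%N.
    by case: ltngtP => // /val_inj E; rewrite E eqxx in ij.
  by case: (i < j)%N; case: (j < i)%N => //= _; rewrite ?expr1 ?expr0; ring.
set s := LHS; have : s = - s.
  rewrite {1}/s (exchange_big_dep (mem S))/= => [|i j _ /andP[]//].
  rewrite /s -sumrN; apply: eq_bigr => i iS; rewrite -sumrN.
  rewrite (eq_bigl (fun j => (j \in S) && (j != i))); last first.
    by move=> j /=; rewrite iS/= eq_sym.
  apply: eq_bigr => j /andP[jS ji]; rewrite anti// eq_sym//.
by move=> ss; lra.
Qed.

End ExteriorSigns.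

Section Koszul.
Context {R : realType} {m : nat}.
Local Notation space := 'rV[R]_m.+1.
Local Notation form := ({set 'I_m} -> space -> R^o).
Implicit Types (U V W : set space) (f g : space -> R^o) (x y c v : space).
Implicit Types (A B : form) (S : {set 'I_m}) (i j : 'I_m).
Local Notation "'u_ j" := (ucoord j) (at level 8, j at level 2).
Local Notation pu j := (partial (lift ord0 j)).
Local Opaque partial.

Definition wedgeE A : form := fun S x =>
  \sum_(j in S) sg j (S :\ j) * (ucoord j x * A (S :\ j) x).

(** Differentiation along [u_j] and contraction with [du_j], summed over [j]: up to sign, the
    divergence of multivector fields in the [u]-coordinates. *)
Definition divg A : form := fun S x =>
  \sum_(j | j \notin S) sg j S * pu j (A (j |: S)) x.

Definition eulerD f : space -> R^o := fun x => \sum_j ucoord j x * pu j f x.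

Lemma eq_partial U (i : 'I_m.+1) f g x : open U -> (forall y, U y -> f y = g y) -> U x ->
  partial i f x = partial i g x.
Proof. by move=> oU fg; exact: (eq_iter_partial [:: i] oU fg). Qed.

Lemma partial_eq0 U (i : 'I_m.+1) f x : open U -> (forall y, U y -> f y = 0) -> U x ->
  partial i f x = 0.
Proof.
by move=> oU f0 Ux; rewrite (@eq_partial U i f (cst 0) x oU f0 Ux) partial_cst.
Qed.

Lemma smooth_ucoord U j : open U -> smooth U (ucoord j).
Proof. exact: smooth_coord. Qed.

Lemma C1_ucoord U j : C1 U (ucoord j).
Proof. exact: C1_coord. Qed.

Lemma partial_ucoordM U i k f x : smooth U f -> U x ->
  partial k (fun x => ucoord i x * f x) x =
  ucoord i x * partial k f x + (lift ord0 i == k)%:R * f x.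
Proof.
move=> sf Ux; rewrite (partialM k (@C1_ucoord U i) (smooth_C1 sf) Ux).
by rewrite partial_coord [f x * _]mulrC.
Qed.

Lemma smooth_wedgeE U A : open U -> (forall S, smooth U (A S)) ->
  forall S, smooth U (wedgeE A S).
Proof.
move=> oU sA S; apply: (smooth_sum _ oU) => j jS.
exact: (smoothZ _ oU (smoothM oU (smooth_ucoord j oU) (sA _))).
Qed.

Lemma smooth_divg U A : open U -> (forall S, smooth U (A S)) ->
  forall S, smooth U (divg A S).
Proof.
move=> oU sA S; apply: (smooth_sum _ oU) => j jS.
exact: (smoothZ _ oU (smooth_partial _ (sA _))).
Qed.

Lemma wedgeE_sqr A S x : wedgeE (wedgeE A) S x = 0.
Proof. exact: (ext_sqr (fun j => ucoord j x) (fun S => A S x) S). Qed.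

Lemma eq_wedgeE A B S x : (forall S, A S x = B S x) ->
  wedgeE A S x = wedgeE B S x.
Proof. by move=> AB; apply: eq_bigr => j jS; rewrite AB. Qed.

Lemma partial_wedgeE U A S k x : open U -> (forall S, smooth U (A S)) -> U x ->
  partial k (wedgeE A S) x = \sum_(j in S) sg j (S :\ j) *
    (ucoord j x * partial k (A (S :\ j)) x + (lift ord0 j == k)%:R * A (S :\ j) x).
Proof.
move=> oU sA Ux.
have sM j : smooth U (fun x => ucoord j x * A (S :\ j) x).
  exact: (smoothM oU (smooth_ucoord j oU) (sA _)).
rewrite /wedgeE (partial_sum _ _ oU _ Ux); last first.
  by move=> j _; exact: (smoothZ _ oU (sM j)).
apply: eq_bigr => j jS; rewrite (partialZ _ _ (smooth_C1 (sM j)) Ux).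
by rewrite (partial_ucoordM _ _ (sA _) Ux).
Qed.

Lemma sum_udir x (g : 'I_m.+1 -> R) :
  \sum_(j | udir j) (x 0 j - (0 : space) 0 j) * g j =
  \sum_j ucoord j x * g (lift ord0 j).
Proof.
rewrite big_mkcond big_ord_recl/= add0r; apply: eq_bigr => j _.
by rewrite mxE subr0.
Qed.

Lemma scal_ucoord r x j : ucoord j (scal udir 0 r x) = r * ucoord j x.
Proof. by rewrite /ucoord mxE /udir /= mxE add0r subr0. Qed.

Local Notation K q := (radint udir 0 q).

(* The homotopy is contraction with du followed by a radial average: the Koszul
   differential and [divg] anticommute to E plus a multiple of the degree. The
   vanishing on u = 0 in top degree is the only obstruction. *)
Lemma koszul_star W A k : open W -> scal_into udir 0 W W ->
  (forall S, smooth W (A S)) ->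
  (forall S x, #|S| != k -> W x -> A S x = 0) ->
  (forall S x, W x -> wedgeE A S x = 0) ->
  (k = m -> forall x, W x -> uproj x = 0 -> A [set: 'I_m]%SET x = 0) ->
  forall S x, W x -> A S x = wedgeE (fun S => K (m - k) (divg A S)) S x.
Proof.
move=> oW WW sA dA EA tA S x Wx.
have cW f : smooth W f -> unit_on udir 0 (fun y => {for y, continuous f}) x.
  by move=> sf r r01; exact: (smooth_C1 sf (WW x Wx r r01)).1.
(* [divg] and [wedgeE] anticommute to [E + (m - k)] in degree [k], as [m - k] indices lie outside
   [S]; this fixes the weight of the radial average. *)
set q := (m - k)%N.
have KS B S' : (forall y, W y -> B S' y = 0) -> K q (B S') x = 0.
  move=> B0; rewrite (@eq_radint _ _ _ _ q _ (fun=> 0)); last first.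
    by move=> r r01; apply/B0/WW.
  rewrite /radint; under eq_Rintegral do rewrite mulr0.
  by rewrite Rintegral_cst// mul0r.
have Kdiv S' : K q (divg A S') x =
    \sum_(j | j \notin S') sg j S' * K q (pu j (A (j |: S'))) x.
  have [_ <-] := @radint_sum _ _ udir 0 _ (index_enum _) (fun j => j \notin S') q
    (fun j => pu j (A (j |: S'))) (fun j => sg j S') x
    (fun j _ => cW _ (smooth_partial _ (sA _))).
  by apply: eq_Rintegral => r _; rewrite /divg mulr_sumr; apply: eq_bigr => j _; rewrite mulrCA.
have [Sk|Sk] := eqVneq #|S| k; last first.
  rewrite dA// [RHS]big1// => j jS; rewrite KS ?mulr0// => y Wy.
  rewrite /divg big1// => i iS.
  rewrite (partial_eq0 _ oW _ Wy) ?mulr0// => z Wz.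
  apply: dA => //; apply: contra Sk => /eqP <-.
  by rewrite cardsU1 iS (cardsD1 j S) jS.
have := radint_ftc_pow q oW (sA S) WW Wx; rewrite sum_udir.
(* For [q > 0] the power vanishes; [q = 0] is the top degree, and there the hypothesis on [u = 0]
   enters. *)
have -> : 0 ^+ q * A S (scal udir 0 0 x) = 0.
  case: (posnP q) => [q0|q0]; last by rewrite expr0n gtn_eqF ?mul0r.
  rewrite q0 expr0 mul1r.
  have km : k = m.
    apply/eqP; rewrite eqn_leq -{1}Sk -[X in (_ <= X)%N](card_ord m) max_card/=.
    by rewrite -subn_eq0 -/q q0.
  have -> : S = [set: 'I_m]%SET.
    by apply/eqP; rewrite eqEcard finset.subsetT finset.cardsT card_ord Sk km leqnn.
  apply: tA => //; first by apply: WW; rewrite // lexx ler01.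
  by apply/rowP => i; rewrite !mxE scal_ucoord mul0r.
rewrite subr0 => <-.
pose X i j S := ucoord i x * K q (pu j (A S)) x.
pose P := \sum_(i in S) sg i (S :\ i) *
  (\sum_(j | j \notin S :\ i) sg j (S :\ i) * X i j (j |: (S :\ i))).
pose Q := \sum_(j | j \notin S) sg j S *
  (\sum_(i in j |: S) sg i ((j |: S) :\ i) * X i j ((j |: S) :\ i)).
have EP : P = wedgeE (fun S => K q (divg A S)) S x.
  apply: eq_bigr => i iS; rewrite Kdiv !mulr_sumr; apply: eq_bigr => j _.
  by congr (_ * _); rewrite /X mulrCA.
suff EQ : Q = - (q%:R * K q.-1 (A S) x).
  transitivity (q%:R * K q.-1 (A S) x + (P + Q)).
    by congr (_ + _); exact: (esym (anticommutation X S)).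
  by rewrite EQ addrC subrK.
(* At the dilated point [u_i] equals [r u_i], so moving [u_i] under the integral uses up one power
   of [r]. *)
have KX (I : Type) (s : seq I) (p : pred I) (i : I -> 'I_m) (a : I -> R) (f : I -> space -> R^o) :
    (0 < q)%N -> (forall l, p l -> smooth W (f l)) ->
    \sum_(l <- s | p l) a l * (ucoord (i l) x * K q (f l) x) =
    K q.-1 (fun y => \sum_(l <- s | p l) a l * (ucoord (i l) y * f l y)) x.
  move=> q0 sf.
  have [_ E] := @radint_sum _ _ udir 0 _ s p q f (fun l => a l * ucoord (i l) x) x
    (fun l Pl => cW _ (sf l Pl)).
  under eq_bigr do rewrite mulrA; rewrite -E /radint; apply: eq_Rintegral => r _.
  rewrite mulr_sumr; apply: eq_bigr => l _; rewrite scal_ucoord.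
  by rewrite -{1}(prednK q0) exprS; ring.
have CS : #|~: S| = q by rewrite cardsCs finset.setCK card_ord Sk.
have -> : Q = \sum_(j | j \notin S) - K q.-1 (A S) x.
  apply: eq_bigr => j jS.
  have q0 : (0 < q)%N by rewrite -CS; apply/card_gt0P; exists j; rewrite inE.
  rewrite /X (KX _ _ _ id (fun i => sg i ((j |: S) :\ i))
    (fun i => pu j (A ((j |: S) :\ i))) q0); last first.
    by move=> i _; apply: smooth_partial; exact: sA.
  (* This is the derivative of [E /\ A = 0] along [u_j]: where it hits the factor [u_j], the term
     [sg j S * A S] appears. *)
  have eK y : W y -> \sum_(i in j |: S) sg i ((j |: S) :\ i) *
      (ucoord i y * pu j (A ((j |: S) :\ i)) y) = - (sg j S * A S y).
    move=> Wy; have := partial_eq0 (lift ord0 j) oW (EA (j |: S)) Wy.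
    rewrite (partial_wedgeE _ _ oW sA Wy).
    under eq_bigr do rewrite mulrDr; rewrite big_split/= => /eqP.
    rewrite addr_eq0 => /eqP ->; congr (- _).
    rewrite (bigD1 j) ?setU11//= eqxx mul1r setU1K// big1 ?addr0// => i /andP[_ ij].
    by rewrite (inj_eq lift_inj) (negPf ij) mul0r mulr0.
  rewrite (@eq_radint _ _ _ _ _ _ (fun y => - (sg j S * A S y))); last first.
    by move=> r r01; apply: eK; exact: WW.
  have [_ E] := @radint_sum _ _ udir 0 _ [:: tt] xpredT q.-1 (fun=> A S) (fun=> - sg j S) x
    (fun _ _ => cW _ (sA S)).
  rewrite big_seq1 in E.
  transitivity (sg j S * (- sg j S * K q.-1 (A S) x)); last first.
    by rewrite mulNr mulrN mulrA sg_sqr mul1r.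
  rewrite -E; congr (_ * _); apply: eq_Rintegral => r _; rewrite big_seq1.
  by rewrite mulrN mulNr mulrCA.
rewrite sumr_const -CS mulr_natl -mulNrn.
by congr (_ *+ _); apply: eq_card => j; rewrite !inE.
Qed.

(** Contraction with [du_j / u_j], whose pairing with [E] is 1, is a homotopy for the Koszul
    differential. *)
Lemma koszul_coord A j S x : ucoord j x != 0 ->
  (forall S, wedgeE A S x = 0) ->
  wedgeE (fun S y => if j \in S then 0
    else sg j S * ((ucoord j y)^-1 * A (j |: S) y)) S x = A S x.
Proof.
move=> j0 EA.
pose X i k S := if k == j then ucoord i x * (ucoord j x)^-1 * A S x else 0.
transitivity (\sum_k X k k S); last first.
  by rewrite (bigD1 j)//= /X eqxx divff// mul1r big1 ?addr0// => k /negbTE ->.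
rewrite -(anticommutation X S) [X in _ = _ + X]big1 ?addr0 => [|k kS]; last first.
  have [->|kj] := eqVneq k j; last first.
    by rewrite big1 ?mulr0// => i _; rewrite /X (negPf kj) mulr0.
  rewrite /X eqxx; under eq_bigr => i _ do rewrite mulrAC mulrA.
  by rewrite -mulr_suml [X in X / _](EA (j |: S)) mul0r mulr0.
apply: eq_bigr => i iS; congr (_ * _); rewrite (bigID (pred1 j))/=.
rewrite [X in _ = _ + X]big1 ?addr0 => [|k /andP[_ /negbTE kj]]; last first.
  by rewrite /X kj mulr0.
case: ifPn => jS.
  by rewrite mulr0 big1// => k /andP[+ /eqP kj]; rewrite kj jS.
rewrite (bigD1 j) ?jS ?eqxx//= big1 ?addr0 => [|k /andP[/andP[_ /eqP ->]]]; last first.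
  by rewrite eqxx.
by rewrite /X eqxx; ring.
Qed.

Lemma mix_wedgeE (psi : space -> R^o) A B S x :
  wedgeE (mix psi A B) S x =
  psi x * wedgeE A S x + (1 - psi x) * wedgeE B S x.
Proof.
rewrite /wedgeE !mulr_sumr -big_split/=; apply: eq_bigr => j _.
by rewrite /mix; ring.
Qed.

(** [E /\ _] is linear over functions, so local solutions may be mixed by bumps in all coordinates.
    The degree condition is part of [Sol], as it has to survive the gluing. *)
Lemma koszul U A k : open U ->
  (forall S, smooth U (A S)) ->
  (forall S x, #|S| != k -> U x -> A S x = 0) ->
  (forall S x, U x -> wedgeE A S x = 0) ->
  (k = m -> forall x, U x -> uproj x = 0 -> A [set: 'I_m]%SET x = 0) ->
  exists B, [/\ forall S, smooth U (B S),
    forall S x, #|S|.+1 != k -> U x -> B S x = 0 &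
    forall S x, U x -> A S x = wedgeE B S x].
Proof.
move=> oU sA dA EA tA.
pose Sol x B := exists V, [/\ open V, V x, forall S, smooth V (B S) &
  forall S y, V y -> (#|S|.+1 != k -> B S y = 0) /\ A S y = wedgeE B S y].
have [B HB] : exists B, forall x, U x -> Sol x B.
  apply: (@glue _ _ _ xpredT).
  - move=> x Y Z /nbhs_exists_open[W [oW Wx WYZ]] [V [oV Vx sY pY]].
    have oVW : open (V `&` W) by exact: openI.
    exists (V `&` W); split; [exact: oVW|by []| |].
      move=> S; apply: (@eq_smooth _ _ _ (Y S)); first exact: oVW.
        by move=> y [_ /WYZ].
      by apply: smoothS (sY S) => y [].
    move=> S y [Vy Wy]; have [h1 h2] := pY S y Vy.
    by rewrite -WYZ// h2; split=> //; apply: eq_wedgeE => S'; exact: WYZ.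
  - move=> x c e Y Z Ux [V [oV Vx sY pY]] [W [oW Wx sZ pZ]].
    have oVW : open (V `&` W) by exact: openI.
    exists (V `&` W); split; [exact: oVW|by []| |].
      move=> S; apply: (smooth_mix _ c e oVW).
        by apply: smoothS (sY S) => y [].
      by apply: smoothS (sZ S) => y [].
    move=> S y [Vy Wy]; have [h1 h2] := pY S y Vy; have [h3 h4] := pZ S y Wy.
    split=> [Sk|]; first by rewrite /mix h1// h3// !mulr0 addr0.
    by rewrite mix_wedgeE -h2 -h4 -mulrDl addrC subrK mul1r.
  - move=> x Ux; have [x0|x0] := pselect (uproj x = 0).
      have [e e0 eU] := open_box_in oU Ux; exists e => //.
      set W := box _ _ _ in eU.
      have oW : open W by exact: open_box.
      have WW : scal_into udir 0 W W.
        move=> y Wy r r01; have -> : scal udir 0 r y = scal udir x r y.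
          apply/rowP => j; rewrite !mxE; case: ifP => // uj.
          have -> // : x 0 j = 0.
          have /uproj_eqP E : uproj x = uproj (0 : space).
            by rewrite x0; apply/rowP => i; rewrite !mxE /ucoord mxE.
          by rewrite E// mxE.
        exact: scal_box Wy _ r01.
      have sW S : smooth W (A S) by exact: smoothS (sA S).
      have dW S y : #|S| != k -> W y -> A S y = 0 by move=> Sk /eU; exact: dA.
      have EW S y : W y -> wedgeE A S y = 0 by move=> /eU; exact: EA.
      have tW : k = m -> forall y, W y -> uproj y = 0 -> A [set: 'I_m]%SET y = 0.
        by move=> km y /eU; exact: tA.
      exists (fun S => K (m - k) (divg A S)) => y Uy Wy; exists W.
      split; [exact: oW|exact: Wy| |].
        move=> S; exact: (smooth_radint _ oW oW (smooth_divg oW sW S) WW).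
      move=> S z Wz; split; last exact: (koszul_star oW WW sW dW EW tW).
      move=> Sk; rewrite (@eq_radint _ _ _ _ _ _ (fun=> 0)); last first.
        move=> r r01; rewrite /divg big1// => j jS.
        rewrite (partial_eq0 _ oW _ (WW z Wz r r01)) ?mulr0// => w Ww.
        by apply: dW => //; rewrite cardsU1 jS.
      rewrite /radint; under eq_Rintegral do rewrite mulr0.
      by rewrite Rintegral_cst// mul0r.
    have [j j0] : exists j, ucoord j x != 0.
      apply: contrapT => H; apply: x0; apply/rowP => j; rewrite !mxE.
      by apply/eqP; apply: contrapT => /negP nj; apply: H; exists j.
    pose O := U `&` [set y | ucoord j y != 0].
    have oO : open O.
      apply: openI => //.
      apply: (@open_comp _ _ (ucoord j) [set r : R | r != 0]).
        by move=> y _; exact: coord_continuous.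
      exact: open_neq.
    have [e e0 eO] := open_box_in oO (conj Ux j0 : O x).
    have sO S : smooth O (A S) by apply: smoothS (sA S) => y [].
    have sI : smooth O (fun y => (ucoord j y)^-1).
      by apply: (smoothV oO (smooth_ucoord j oO)) => y [].
    exists e => //; exists (fun S y => if j \in S then 0
      else sg j S * ((ucoord j y)^-1 * A (j |: S) y)) => y Uy /eO Oy.
    exists O; split; [exact: oO|exact: Oy| |].
      move=> S; case: (j \in S); first exact: (smooth_cst 0 oO).
      exact: (smoothZ _ oO (smoothM oO sI (sO _))).
    move=> S z [Uz jz]; split; last first.
      by rewrite koszul_coord// => S'; exact: EA.
    move=> Sk; case: ifPn => // jS; rewrite dA ?mulr0//.
    by rewrite cardsU1 jS.
exists B; split.
- move=> S; apply: smooth_local => x /HB[V [_ Vx sB _]]; exists V => //; exact: sB.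
- by move=> S x Sk /HB[V [_ Vx _ /(_ S x Vx)[+ _]]]; exact.
- by move=> S x /HB[V [_ Vx _ /(_ S x Vx)[]]].
Qed.

End Koszul.

(** * Taylor coefficients and homogeneous functions *)

Section Jets.
Context {R : realType} {m : nat}.
Local Notation space := 'rV[R]_m.+1.
Implicit Types (U V W : set space) (f g h q : space -> R^o) (x y : space).
Implicit Types (j : 'I_m) (s : seq 'I_m).
Local Notation pu j := (partial (lift ord0 j)).

Definition udiff s f : space -> R^o := iter_partial (map (lift ord0) s) f.

Lemma tindep_partial i f : tindep f -> tindep (partial i f).
Proof.
move=> tf x y xy; rewrite /partial /derive.
have -> : f \o shift x = f \o shift y.
  apply/funext => z; apply: tf; apply/rowP => k.
  by move/rowP: xy => /(_ k); rewrite !mxE /ucoord !mxE => ->.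
by rewrite (tf x y xy).
Qed.

Lemma partial_tindep f x : tindep f -> partial ord0 f x = 0.
Proof.
move=> tf; rewrite /partial /derive.
have -> : f \o shift x = (fun z => f (z + x)) by [].
have E (r : R) : f (r *: delta_mx 0 ord0 + x) = f x.
  by apply: tf; apply/rowP => k; rewrite !mxE /ucoord !mxE/= mulr0 add0r.
under eq_fun do rewrite E subrr scaler0.
exact: lim_cst.
Qed.

Lemma uproj_scal r x y : uproj x = uproj y ->
  uproj (scal udir 0 r x) = uproj (scal udir 0 r y).
Proof.
by move=> xy; apply/rowP => k; move/rowP: xy => /(_ k); rewrite !mxE !scal_ucoord => ->.
Qed.

Lemma tindep_radint p f : tindep f -> tindep (radint udir 0 p f).
Proof.
move=> tf x y xy; rewrite /radint.
suff -> : (fun r => r ^+ p * f (scal udir 0 r x)) =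
    (fun r => r ^+ p * f (scal udir 0 r y)) by [].
by apply/funext => r; rewrite (tf _ _ (uproj_scal r xy)).
Qed.

Lemma tindep_ucoord j : tindep (ucoord j : space -> R^o).
Proof. by move=> x y /rowP/(_ j); rewrite !mxE. Qed.

Local Opaque partial.

Lemma smooth_udiff U s f : smooth U f -> smooth U (udiff s f).
Proof. by move=> sf; elim: s => [|j s IH]; [exact: sf|exact: smooth_partial]. Qed.

Lemma udiff_move U s1 j s2 f x : open U -> smooth U f -> U x ->
  udiff (s1 ++ j :: s2) f x = udiff (j :: s1 ++ s2) f x.
Proof.
move=> oU sf; elim: s1 x => [//|i s1 IH] x Ux.
rewrite [LHS](eq_partial (lift ord0 i) oU IH Ux).
exact: (schwarz _ _ oU (smooth_udiff (s1 ++ s2) sf) Ux).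
Qed.

Lemma udiff_perm U s s' f x : open U -> smooth U f -> U x -> perm_eq s s' ->
  udiff s f x = udiff s' f x.
Proof.
move=> oU sf; elim: s s' x => [|j s IH] s' x Ux.
  by rewrite perm_sym => /perm_nilP ->.
move=> ps; have js' : j \in s' by rewrite -(perm_mem ps) mem_head.
case/splitPr: js' ps => s1 s2 ps.
rewrite (udiff_move _ _ _ oU sf Ux).
have ps' : perm_eq s (s1 ++ s2).
  by rewrite -(perm_cons j) (perm_trans ps)// -cat1s perm_catCA.
exact: (eq_partial (lift ord0 j) oU (fun y Uy => IH _ y Uy ps') Ux).
Qed.

Lemma udiff_ucoord U s j f x : open U -> smooth U f -> U x ->
  udiff s (fun x => ucoord j x * f x) x =
  ucoord j x * udiff s f x + (count_mem j s)%:R * udiff (rem j s) f x.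
Proof.
move=> oU sf; elim: s x => [|i s IH] x Ux; first by rewrite /= mul0r addr0.
rewrite [LHS](eq_partial (lift ord0 i) oU IH Ux).
have s1 := smooth_udiff s sf; have s2 := smooth_udiff (rem j s) sf.
have su := smoothM oU (smooth_ucoord j oU) s1.
have sr := smoothZ (count_mem j s)%:R oU s2.
rewrite (partialD _ (smooth_C1 su) (smooth_C1 sr) Ux).
rewrite (partial_ucoordM _ _ s1 Ux) (partialZ _ _ (smooth_C1 s2) Ux).
rewrite -addrA; congr (_ + _); rewrite /= (inj_eq lift_inj) [j == i]eq_sym.
case: eqVneq => [->|ij]; last by rewrite mul0r add0r add0n.
rewrite mul1r natrD mulrDl mul1r; congr (_ + _).
have [js|js] := boolP (j \in s); last by rewrite (count_memPn js) !mul0r.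
congr (_ * _); apply/esym.
exact: (udiff_perm oU sf Ux (perm_to_rem js)).
Qed.

Lemma udiff_sum U s (I : Type) (r : seq I) (F : I -> space -> R^o) x : open U ->
  (forall i, smooth U (F i)) -> U x ->
  udiff s (fun x => \sum_(i <- r) F i x) x = \sum_(i <- r) udiff s (F i) x.
Proof.
move=> oU sF; elim: s x => [//|j s IH] x Ux.
rewrite [LHS](eq_partial (lift ord0 j) oU IH Ux).
by rewrite (partial_sum _ _ oU (fun i _ => smooth_udiff s (sF i)) Ux).
Qed.

Lemma udiffZ U s a f x : open U -> smooth U f -> U x ->
  udiff s (fun x => a * f x) x = a * udiff s f x.
Proof.
move=> oU sf; elim: s x => [//|j s IH] x Ux.
rewrite [LHS](eq_partial (lift ord0 j) oU IH Ux).
exact: (partialZ _ _ (smooth_C1 (smooth_udiff s sf)) Ux).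
Qed.

Lemma udiffD U s f g x : open U -> smooth U f -> smooth U g -> U x ->
  udiff s (fun x => f x + g x) x = udiff s f x + udiff s g x.
Proof.
move=> oU sf sg Ux.
have sF (b : bool) : smooth U (if b then f else g) by case: b.
have := udiff_sum s [:: true; false] oU sF Ux.
rewrite !big_cons big_nil addr0 => <-.
apply: (eq_iter_partial _ oU _ Ux) => y _.
by rewrite !big_cons big_nil addr0.
Qed.

Lemma eq_udiff U s f g x : open U -> (forall y, U y -> f y = g y) -> U x ->
  udiff s f x = udiff s g x.
Proof. by move=> oU fg Ux; exact: (eq_iter_partial _ oU fg Ux). Qed.

Definition multfact s : nat := \prod_j (count_mem j s)`!.

Lemma multfact_gt0 s : (0 < multfact s)%N.
Proof. by apply: prodn_gt0 => j; exact: fact_gt0. Qed.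

Lemma multfact_rem s j : j \in s ->
  multfact s = (count_mem j s * multfact (rem j s))%N.
Proof.
move=> js; rewrite /multfact (bigD1 j)//= [in RHS](bigD1 j)//= mulnA.
have E i : count_mem i s = ((j == i) + count_mem i (rem j s))%N.
  by rewrite (permP (perm_to_rem js))/=.
rewrite !(E j) eqxx add1n factS; congr (_ * _)%N.
by apply: eq_bigr => i ij; rewrite E eq_sym (negPf ij).
Qed.

(* For |s| = k and f homogeneous of degree k, this is the coefficient of u_s. *)
Definition jet (p : space) s f : R := udiff s f p / (multfact s)%:R.

(** On [u = 0] only the terms remain in which one derivative hits [u_j]. Their number is the
    multiplicity of [j], which is also the quotient of the two multifactorials. *)
Lemma jet_ucoord U s j f p : open U -> smooth U f -> U p -> uproj p = 0 ->
  jet p s (fun x => ucoord j x * f x) =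
  if j \in s then jet p (rem j s) f else 0.
Proof.
move=> oU sf Up p0; rewrite /jet (udiff_ucoord _ _ oU sf Up).
have -> : ucoord j p = 0 by move/rowP: p0 => /(_ j); rewrite !mxE.
rewrite mul0r add0r; case: ifPn => [js|js]; last first.
  by rewrite (count_memPn js) !mul0r.
rewrite (multfact_rem js) natrM invfM mulrACA divff ?mul1r//.
by rewrite pnatr_eq0 -lt0n -has_count has_pred1.
Qed.

Lemma jet_perm U s s' f p : open U -> smooth U f -> U p -> perm_eq s s' ->
  jet p s f = jet p s' f.
Proof.
move=> oU sf Up ps; rewrite /jet (udiff_perm oU sf Up ps); congr (_ / _%:R).
by apply: eq_bigr => j _; rewrite (permP ps).
Qed.

Lemma jetD U s f g p : open U -> smooth U f -> smooth U g -> U p ->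
  jet p s (fun x => f x + g x) = jet p s f + jet p s g.
Proof. by move=> oU sf sg Up; rewrite /jet (udiffD _ oU sf sg Up) mulrDl. Qed.

Lemma jetZ U s a f p : open U -> smooth U f -> U p ->
  jet p s (fun x => a * f x) = a * jet p s f.
Proof. by move=> oU sf Up; rewrite /jet (udiffZ _ _ oU sf Up) mulrA. Qed.

Lemma jet_sum U s (I : Type) (r : seq I) (F : I -> space -> R^o) p : open U ->
  (forall i, smooth U (F i)) -> U p ->
  jet p s (fun x => \sum_(i <- r) F i x) = \sum_(i <- r) jet p s (F i).
Proof. by move=> oU sF Up; rewrite /jet (udiff_sum _ _ oU sF Up) mulr_suml. Qed.

Lemma eq_jet U s f g p : open U -> (forall y, U y -> f y = g y) -> U p ->
  jet p s f = jet p s g.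
Proof. by move=> oU fg Up; rewrite /jet (eq_udiff _ oU fg Up). Qed.

Lemma smooth_euler U f : open U -> smooth U f -> smooth U (eulerD f).
Proof.
move=> oU sf; apply: (smooth_sum _ oU) => j _.
exact: (smoothM oU (smooth_ucoord j oU) (smooth_partial _ sf)).
Qed.

(** Each derivative in [s] yields one copy of the jet, when it hits the factor [u_j] of [E].
    Consequently [E f - k f] has no coefficients of order [k]. *)
Lemma jet_euler U s f p : open U -> smooth U f -> U p -> uproj p = 0 ->
  jet p s (eulerD f) = (size s)%:R * jet p s f.
Proof.
move=> oU sf Up p0.
have sM j := smoothM oU (smooth_ucoord j oU) (smooth_partial (lift ord0 j) sf).
rewrite /jet (udiff_sum _ _ oU sM Up) mulrA; congr (_ / _).
transitivity (\sum_j (count_mem j s)%:R * udiff s f p); last first.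
  rewrite -mulr_suml -natr_sum; congr (_%:R * _).
  elim: s => [|i s IH]; first by rewrite big1.
  by rewrite /= big_split/= IH (bigD1 i)//= eqxx big1 ?addn0 ?add1n// => k; rewrite eq_sym => /negbTE ->.
apply: eq_bigr => j _; rewrite (udiff_ucoord _ _ oU (smooth_partial _ sf) Up).
have -> : ucoord j p = 0 by move/rowP: p0 => /(_ j); rewrite !mxE.
rewrite mul0r add0r; have [js|js] := boolP (j \in s); last first.
  by rewrite (count_memPn js) !mul0r.
congr (_ * _).
have -> : udiff (rem j s) (pu j f) p = udiff (rcons (rem j s) j) f p.
  by rewrite /udiff /iter_partial map_rcons foldr_rcons.
apply/esym/(udiff_perm oU sf Up).
by rewrite (perm_trans (perm_to_rem js))// perm_sym perm_rcons.
Qed.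

End Jets.

(** * Functions independent of t, homogeneous functions and Taylor's formula *)

Section Homogeneous.
Context {R : realType} {m : nat}.
Local Notation space := 'rV[R]_m.+1.
Implicit Types (f g h q : space -> R^o) (x y : space).
Implicit Types (j : 'I_m) (s : seq 'I_m).
Variables (W : set space) (p0 : space).
Hypotheses (oW : open W) (WW : scal_into udir 0 W W).
Hypotheses (Wp0 : W p0) (up0 : uproj p0 = 0).
Local Notation pu j := (partial (lift ord0 j)).
Local Notation K q := (radint udir 0 q).
Local Opaque partial.

Definition basic f := smooth W f /\ tindep f.

(** Homogeneity is expressed by Euler's equation instead of a polynomial representation. By
    [homog_jet0] such a function is determined by its Taylor coefficients of order [k]. *)
Definition homog k f :=
  basic f /\ forall x, W x -> eulerD f x = k%:R * f x.

Lemma basicD f g : basic f -> basic g -> basic (fun x => f x + g x).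
Proof.
move=> [sf tf] [sg tg]; split; first exact: (smoothD oW sf sg).
by move=> x y xy; rewrite (tf _ _ xy) (tg _ _ xy).
Qed.

Lemma basicZ a f : basic f -> basic (fun x => a * f x).
Proof.
move=> [sf tf]; split; first exact: (smoothZ a oW sf).
by move=> x y xy; rewrite (tf _ _ xy).
Qed.

Lemma basic_ucoord j f : basic f -> basic (fun x => ucoord j x * f x).
Proof.
move=> [sf tf]; split; first exact: (smoothM oW (smooth_ucoord j oW) sf).
by move=> x y xy; rewrite (tf _ _ xy) (tindep_ucoord j xy).
Qed.

Lemma basic_cst a : basic (cst a).
Proof. by split=> //; exact: (smooth_cst a oW). Qed.

Lemma basic_partial i f : basic f -> basic (partial i f).
Proof.
by move=> [sf tf]; split; [exact: smooth_partial|exact: tindep_partial].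
Qed.

Lemma basic_radint p f : basic f -> basic (K p f).
Proof.
move=> [sf tf]; split; last exact: tindep_radint.
exact: (smooth_radint p oW oW sf WW).
Qed.

Lemma basic_sum (I : Type) (r : seq I) (F : I -> space -> R^o) :
  (forall i, basic (F i)) -> basic (fun x => \sum_(i <- r) F i x).
Proof.
move=> bF; split; first by apply: (smooth_sum _ oW) => i _; exact: (bF i).1.
by move=> x y xy; apply: eq_bigr => i _; exact: ((bF i).2 _ _ xy).
Qed.

Lemma eulerDD f g x : smooth W f -> smooth W g -> W x ->
  eulerD (fun x => f x + g x) x = eulerD f x + eulerD g x.
Proof.
move=> sf sg Wx; rewrite /eulerD -big_split/=; apply: eq_bigr => j _.
by rewrite (partialD _ (smooth_C1 sf) (smooth_C1 sg) Wx) mulrDr.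
Qed.

Lemma eulerDZ a f x : smooth W f -> W x ->
  eulerD (fun x => a * f x) x = a * eulerD f x.
Proof.
move=> sf Wx; rewrite /eulerD mulr_sumr; apply: eq_bigr => j _.
by rewrite (partialZ _ _ (smooth_C1 sf) Wx) mulrCA.
Qed.

Lemma eulerD_ucoord j f x : smooth W f -> W x ->
  eulerD (fun x => ucoord j x * f x) x = ucoord j x * (f x + eulerD f x).
Proof.
move=> sf Wx; rewrite /eulerD mulrDr mulr_sumr.
under eq_bigr => i _ do rewrite (partial_ucoordM _ _ sf Wx) mulrDr addrC.
rewrite big_split/=; congr (_ + _); last by apply: eq_bigr => i _; rewrite mulrCA.
rewrite (bigD1 j)//= eqxx mul1r big1 ?addr0// => i /negbTE ij.
by rewrite (inj_eq lift_inj) eq_sym ij mul0r mulr0.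
Qed.

Lemma eulerD_sum (I : Type) (r : seq I) (F : I -> space -> R^o) x :
  (forall i, smooth W (F i)) -> W x ->
  eulerD (fun x => \sum_(i <- r) F i x) x = \sum_(i <- r) eulerD (F i) x.
Proof.
move=> sF Wx; rewrite /eulerD exchange_big/=; apply: eq_bigr => j _.
by rewrite (partial_sum _ _ oW (fun i _ => sF i) Wx) mulr_sumr.
Qed.

Lemma partial_euler j f x : smooth W f -> W x ->
  pu j (eulerD f) x = pu j f x + eulerD (pu j f) x.
Proof.
move=> sf Wx.
have sM i := smoothM oW (smooth_ucoord i oW) (smooth_partial (lift ord0 i) sf).
rewrite /eulerD (partial_sum _ _ oW (fun i _ => sM i) Wx).
under eq_bigr => i _ do rewrite (partial_ucoordM _ _ (smooth_partial _ sf) Wx) addrC.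
rewrite big_split/=.
have -> : \sum_i (lift ord0 i == lift ord0 j)%:R * pu i f x = pu j f x.
  rewrite (bigD1 j)//= eqxx mul1r big1 ?addr0// => i /negbTE ij.
  by rewrite (inj_eq lift_inj) ij mul0r.
have E (i : 'I_m) : pu j (pu i f) x = pu i (pu j f) x.
  exact: (schwarz _ _ oW sf Wx).
apply: (congr1 (fun z => pu j f x + z)).
apply: eq_bigr => i _.
exact: (congr1 (fun z => ucoord i x * z) (E i)).
Qed.

Lemma homogD k f g : homog k f -> homog k g -> homog k (fun x => f x + g x).
Proof.
move=> [bf ef] [bg eg]; split; first exact: basicD.
by move=> x Wx; rewrite (eulerDD bf.1 bg.1 Wx) ef// eg// mulrDr.
Qed.

Lemma homogZ k a f : homog k f -> homog k (fun x => a * f x).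
Proof.
move=> [bf ef]; split; first exact: basicZ.
by move=> x Wx; rewrite (eulerDZ _ bf.1 Wx) ef// mulrCA.
Qed.

Lemma homog_ucoord k j f : homog k f -> homog k.+1 (fun x => ucoord j x * f x).
Proof.
move=> [bf ef]; split; first exact: basic_ucoord.
move=> x Wx; rewrite (eulerD_ucoord _ bf.1 Wx) ef// -[k.+1]add1n natrD.
by rewrite -[X in _ * (X + _)]mul1r -mulrDl mulrCA.
Qed.

Lemma homog_sum k (I : Type) (r : seq I) (F : I -> space -> R^o) :
  (forall i, homog k (F i)) -> homog k (fun x => \sum_(i <- r) F i x).
Proof.
move=> hF; split; first by apply: basic_sum => i; exact: (hF i).1.
move=> x Wx; rewrite (eulerD_sum _ (fun i => (hF i).1.1) Wx) mulr_sumr.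
by apply: eq_bigr => i _; exact: (hF i).2.
Qed.

Lemma homog_cst a : homog 0 (cst a).
Proof.
split=> [|x Wx]; first exact: basic_cst.
by rewrite mul0r /eulerD big1// => j _; rewrite partial_cst mulr0.
Qed.

Lemma homog_umonomial (I : seq 'I_m) : homog (size I) (umonomial I).
Proof.
elim: I => [|j I IH].
  have -> : umonomial [::] = cst 1 :> (space -> R^o).
    by apply/funext => x; rewrite /umonomial big_nil.
  exact: homog_cst.
have -> : umonomial (j :: I) = (fun x => ucoord j x * umonomial I x) :> (space -> R^o).
  by apply/funext => x; rewrite /umonomial big_cons.
exact: homog_ucoord.
Qed.

Lemma eq_eulerD f g x : (forall y, W y -> f y = g y) -> W x -> eulerD f x = eulerD g x.
Proof.
by move=> fg Wx; apply: eq_bigr => j _; rewrite (eq_partial (lift ord0 j) oW fg Wx).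
Qed.

Lemma homog_partial k j f : homog k.+1 f -> homog k (pu j f).
Proof.
move=> [bf ef]; split; first exact: basic_partial.
move=> x Wx; have := eq_partial (lift ord0 j) oW ef Wx.
rewrite (partial_euler _ bf.1 Wx) (partialZ _ _ (smooth_C1 bf.1) Wx).
by rewrite -[k.+1]addn1 natrD mulrDl mul1r [RHS]addrC => /addrI.
Qed.

Lemma radint_eulerD p f x : smooth W f -> W x ->
  p.+1%:R * K p f x + eulerD (K p f) x = f x.
Proof.
move=> sf Wx; rewrite -[RHS](radint_ftc p oW sf WW Wx) sum_udir; congr (_ + _).
apply: eq_bigr => j _; congr (_ * _).
by rewrite (partial_radint p _ oW sf WW Wx) addn1.
Qed.

Lemma scal0_p0 f x : tindep f -> f (scal udir 0 0 x) = f p0.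
Proof.
by move=> tf; apply: tf; rewrite up0; apply/rowP => j; rewrite !mxE scal_ucoord mul0r.
Qed.

Lemma hadamard f x : basic f -> W x ->
  f x = f p0 + \sum_j ucoord j x * K 0 (pu j f) x.
Proof.
move=> [sf tf] Wx; have := radint_ftc0 oW sf WW Wx.
by rewrite sum_udir scal0_p0// => ->; rewrite addrC subrK.
Qed.

(** The hypothesis says that [r f(r u)] has zero derivative in [r]; it vanishes at [r = 0], hence
    also at [r = 1]. *)
Lemma euler_shift_inj f x : smooth W f ->
  (forall y, W y -> f y + eulerD f y = 0) -> W x -> f x = 0.
Proof.
move=> sf f0 Wx; rewrite -[LHS](radint_ftc 0 oW sf WW Wx) sum_udir mul1r.
have cf g : smooth W g -> unit_on udir 0 (fun y => {for y, continuous g}) x.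
  by move=> sg r r01; exact: (smooth_C1 sg (WW Wx r01)).1.
have [I1 E1] := @radint_sum _ _ udir 0 _ [:: tt] xpredT 0 (fun=> f) (fun=> 1) x
  (fun _ _ => cf _ sf).
have [I2 E2] := @radint_sum _ _ udir 0 _ (index_enum _) xpredT 1
  (fun j => pu j f) (fun j => ucoord j x) x (fun j _ => cf _ (smooth_partial _ sf)).
rewrite big_seq1 mul1r in E1; rewrite -E1 -E2.
have mI : measurable (`[0, 1]%classic : set (measurableTypeR R)) by [].
rewrite -(RintegralD mI I1 I2).
transitivity (\int[lebesgue_measure]_(r in `[0%R, 1%R]) (0 : R)); last first.
  by rewrite Rintegral_cst// mul0r.
apply: eq_Rintegral => r; rewrite inE/= in_itv/= => r01.
rewrite big_seq1 mul1r expr0 mul1r expr1 -[RHS](f0 _ (WW Wx r01)); congr (_ + _).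
by apply: eq_bigr => j _; rewrite scal_ucoord; ring.
Qed.

Lemma homog0_cst f x : homog 0 f -> W x -> f x = f p0.
Proof.
move=> [bf ef] Wx; rewrite (hadamard bf Wx) big1 ?addr0// => j _.
have pf0 y : W y -> pu j f y = 0.
  move=> Wy; apply: (euler_shift_inj (smooth_partial _ bf.1)) Wy => z Wz.
  rewrite -(partial_euler _ bf.1 Wz).
  by apply: (partial_eq0 _ oW _ Wz) => w Ww; rewrite ef// mul0r.
rewrite (@eq_radint _ _ _ _ _ _ (fun=> 0)); last first.
  by move=> r r01; apply: pf0; exact: WW.
rewrite /radint; under eq_Rintegral do rewrite mulr0.
by rewrite Rintegral_cst// mul0r mulr0.
Qed.

(** By induction all [u]-derivatives of [f] vanish, and Euler's equation then reads
    [(k + 1) f = 0]. *)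
Lemma homog_jet0 k f x : homog k f -> (forall s, size s = k -> jet p0 s f = 0) ->
  W x -> f x = 0.
Proof.
elim: k f x => [|k IH] f x hf jf Wx.
  rewrite (homog0_cst hf Wx); have := jf [::] erefl.
  by rewrite /jet /multfact big1 ?divr1.
have pf j y : W y -> pu j f y = 0.
  apply: IH; first exact: homog_partial.
  move=> s sk; have := jf (rcons s j); rewrite size_rcons sk => /(_ erefl) /eqP.
  rewrite /jet /udiff /iter_partial map_rcons foldr_rcons mulf_eq0 invr_eq0.
  rewrite pnatr_eq0 -[_ == 0%N]negbK -lt0n multfact_gt0 orbF => /eqP ->.
  by rewrite mul0r.
have := hf.2 x Wx; rewrite /eulerD big1 => [|j _]; last by rewrite pf ?mulr0.
by move=> /esym/eqP; rewrite mulf_eq0 pnatr_eq0/= => /eqP.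
Qed.

(** Induction through Hadamard's lemma, since [u_j (E - k) h = (E - (k + 1)) (u_j h)]. The value at
    the origin has degree 0 and is absorbed by the image of [E - (k + 1)], which is where the
    division by [k + 1] comes from. *)
Lemma taylor k f : basic f -> exists q h, [/\ homog k q, basic h &
  forall x, W x -> f x = q x + (eulerD h x - k%:R * h x)].
Proof.
elim: k f => [|k IH] f bf.
  have bK j : basic (K 0 (pu j f)) by exact/basic_radint/basic_partial.
  have bKK j : basic (K 0 (K 0 (pu j f))) by exact: basic_radint.
  have bu j := basic_ucoord j (bKK j).
  (* [E (u_j g) = u_j (1 + E) g], and [K 0] inverts [1 + E]: hence one more [K 0] than in Hadamard's
     formula. *)
  exists (cst (f p0)), (fun x => \sum_j ucoord j x * K 0 (K 0 (pu j f)) x).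
  split; [exact: homog_cst|exact: basic_sum|].
  move=> x Wx; rewrite mul0r subr0 (eulerD_sum _ (fun j => (bu j).1) Wx).
  rewrite (hadamard bf Wx); congr (_ + _); apply: eq_bigr => j _.
  rewrite (eulerD_ucoord _ (bKK j).1 Wx) -[in LHS](radint_eulerD 0 (bK j).1 Wx).
  by rewrite mul1r.
have bK j : basic (K 0 (pu j f)) by exact/basic_radint/basic_partial.
have /choice[q /choice[h H]] : forall j, exists q, exists h, [/\ homog k q, basic h &
    forall x, W x -> K 0 (pu j f) x = q x + (eulerD h x - k%:R * h x)].
  by move=> j; exact: IH.
have hq j : homog k (q j) by have [] := H j.
have bh j : basic (h j) by have [] := H j.
pose c := - (f p0 / k.+1%:R).
pose h1 x := \sum_j ucoord j x * h j x.
have bu j := basic_ucoord j (bh j).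
have bh1 : basic h1 by exact: basic_sum.
exists (fun x => \sum_j ucoord j x * q j x), (fun x => cst c x + h1 x).
split; [|exact: (basicD (basic_cst c) bh1)|].
  by apply: homog_sum => j; exact: homog_ucoord.
move=> x Wx; rewrite (eulerDD (basic_cst c).1 bh1.1 Wx).
rewrite (homog_cst c).2// mul0r add0r mulrDr /= {1}/c mulrN mulrC divfK ?pnatr_eq0//.
rewrite (eulerD_sum _ (fun j => (bu j).1) Wx) (hadamard bf Wx).
rewrite opprD opprK addrCA addrA [RHS]addrC -addrA; congr (_ + _).
rewrite /h1 mulr_sumr -sumrN -!big_split/=; apply: eq_bigr => j _.
have [_ _ ->//] := H j; rewrite (eulerD_ucoord _ (bh j).1 Wx) -[k.+1]addn1 natrD; ring.
Qed.

End Homogeneous.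

(** * Admissible pairs *)

Section Combinatorics.
Context {m : nat}.
Implicit Types (I J : seq 'I_m) (S T : {set 'I_m}) (i j : 'I_m).

Definition cmax S : nat := (\max_(j in ~: S) j.+1)%N.

Lemma max_idx_ge I i : i \in I -> (i < max_idx I)%N.
Proof. by move=> iI; rewrite /max_idx (big_rem i)//= leq_maxl. Qed.

Lemma max_idx_leP I (n : nat) :
  reflect (forall i, i \in I -> (i < n)%N) (max_idx I <= n)%N.
Proof.
apply: (iffP idP) => [In i /max_idx_ge iI|H]; first exact: leq_trans In.
by rewrite /max_idx; apply/bigmax_leqP_seq => i iI _; exact: H.
Qed.

Lemma max_idx_perm I J : perm_eq I J -> max_idx I = max_idx J.
Proof. by move=> IJ; apply: perm_big. Qed.

Lemma max_idx_mem I : (0 < max_idx I)%N -> exists2 i, i \in I & i.+1 = max_idx I.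
Proof.
elim: I => [|i I IH]; first by rewrite /max_idx big_nil.
rewrite /max_idx big_cons -/(max_idx I); case: (leqP i.+1 (max_idx I)) => h.
  by move=> /IH[j jI <-]; exists j => //; rewrite inE jI orbT.
by exists i; rewrite ?mem_head.
Qed.

Lemma cmax_ge S i : i \notin S -> (i < cmax S)%N.
Proof. by move=> iS; rewrite /cmax (bigD1 i) ?inE//= leq_maxl. Qed.

Lemma cmax_leP S (n : nat) :
  reflect (forall i, i \notin S -> (i < n)%N) (cmax S <= n)%N.
Proof.
apply: (iffP idP) => [Sn i /cmax_ge iS|H]; first exact: leq_trans Sn.
by apply/bigmax_leqP => i; rewrite inE; exact: H.
Qed.

Lemma cmax_mem S : (0 < cmax S)%N -> exists2 i, i \notin S & i.+1 = cmax S.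
Proof.
move=> S0; have [i iS] : exists i, i \in ~: S.
  apply/existsP; apply: contraLR S0 => /existsPn H.
  by rewrite /cmax big1// => i; rewrite (negPf (H i)).
have := @eq_bigmax_cond _ (mem (~: S)) (fun i => i.+1) (introT card_gt0P (ex_intro _ i iS)).
by move=> [j jS E]; exists j; [rewrite inE in jS|rewrite /cmax E].
Qed.

Definition adm I S := (max_idx I <= cmax S)%N.

Lemma adm_perm I J S : perm_eq I J -> adm I S = adm J S.
Proof. by move=> IJ; rewrite /adm (max_idx_perm IJ). Qed.

(** The largest entry of [I] exceeds every index outside [S]. So it lies in [S], and its removal
    makes it the largest missing index. *)
Lemma nadm_top I S : ~~ adm I S -> exists i,
  [/\ i \in I, i \in S, i.+1 = max_idx I & cmax (S :\ i) = i.+1].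
Proof.
rewrite /adm -ltnNge => h.
have [i iI iE] := max_idx_mem (leq_ltn_trans (leq0n _) h).
have iS : i \in S by apply: contraTT h => /cmax_ge; rewrite -iE -leqNgt.
exists i; split=> //; apply/eqP; rewrite eqn_leq cmax_ge ?setD11// andbT.
apply/cmax_leP => j; rewrite !inE negb_and negbK => /orP[/eqP->//|jS].
by rewrite (leq_trans (cmax_ge jS))// ltnW// iE.
Qed.

Lemma adm_rem I S i : i.+1 = max_idx I -> adm (rem i I) (S :\ i).
Proof.
move=> iE; apply: (@leq_trans i.+1); last by apply: cmax_ge; rewrite setD11.
by apply/max_idx_leP => j /mem_rem/max_idx_ge; rewrite -iE.
Qed.

(** The entry [i] stays in the list and still exceeds every missing index, the new one [j]
    included. *)
Lemma nadm_rem I S i j : ~~ adm I S -> i \in I -> i.+1 = max_idx I ->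
  j \in I -> j != i -> ~~ adm (rem j I) (S :\ j).
Proof.
rewrite /adm -!ltnNge => h iI iE jI ji.
have iI' : i \in rem j I.
  have : i \in j :: rem j I by rewrite -(perm_mem (perm_to_rem jI)).
  by rewrite inE eq_sym (negPf ji).
apply: leq_trans (max_idx_ge iI'); rewrite ltnS.
apply/cmax_leP => l; rewrite !inE negb_and negbK => /orP[/eqP->|lS].
  rewrite ltn_neqAle ji/= -ltnS iE; exact: max_idx_ge.
by have := leq_ltn_trans (cmax_ge lS) h; rewrite -iE ltnS.
Qed.

(** If [S] were full, admissibility would force [I] to be empty, against [size I = m > 0]. *)
Lemma adm_cmax_gt0 I S : (0 < m)%N -> size I = #|S| -> adm I S -> (0 < cmax S)%N.
Proof.
move=> m0 IS; rewrite /adm lt0n; apply: contraTneq => S0; rewrite S0 -ltnNge.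
have Sf i : i \in S.
  by apply: contraTT isT => /cmax_ge; rewrite S0.
have : (0 < size I)%N by rewrite IS; apply/card_gt0P; exists (Ordinal m0).
by case: I {IS} => // i I _; exact: leq_ltn_trans (leq0n i) (max_idx_ge (mem_head _ _)).
Qed.

(** Adding the largest missing index to both components undoes the removal in [nadm_top] and
    [adm_rem]. *)
Lemma nadm_cons I S i : i \notin S -> i.+1 = cmax S -> adm I S ->
  ~~ adm (i :: I) (i |: S) /\ i.+1 = max_idx (i :: I).
Proof.
move=> iS iE aI.
have E : i.+1 = max_idx (i :: I).
  apply/eqP; rewrite eqn_leq max_idx_ge ?mem_head//=.
  apply/max_idx_leP => j; rewrite inE => /predU1P[->//|/max_idx_ge jI].
  by rewrite iE (leq_trans jI).
split=> //; rewrite /adm -ltnNge -E ltnS.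
apply/cmax_leP => j; rewrite !inE negb_or => /andP[ji jS].
by rewrite ltn_neqAle ji -ltnS iE cmax_ge.
Qed.

Section Koszul.
Variable R : realFieldType.
Implicit Types (c d : seq 'I_m -> {set 'I_m} -> R).

(** The operator [E /\ _] on coefficients, [c I S] being that of [u_I d_S]. Lists stand for
    multisets here, which is why [perm_inv] accompanies it. *)
Definition epsmul c I S : R :=
  \sum_(j in S) sg j (S :\ j) * (if j \in I then c (rem j I) (S :\ j) else 0).

Definition perm_inv c := forall I J S, perm_eq I J -> c I S = c J S.

Lemma epsmul_nadm c I S i : (forall I S, ~~ adm I S -> c I S = 0) ->
  ~~ adm I S -> i \in I -> i \in S -> i.+1 = max_idx I ->
  epsmul c I S = sg i (S :\ i) * c (rem i I) (S :\ i).
Proof.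
move=> c0 nIS iI iS iE; rewrite /epsmul (bigD1 i)//= iI big1 ?addr0// => j /andP[jS ji].
case: ifP => jI; rewrite ?mulr0// c0 ?mulr0//.
exact: (nadm_rem nIS iI iE jI ji).
Qed.

(* On non-admissible (I, S) with largest entry i, the coefficient of E /\ d is
   that of d at (I - i, S - i) up to sign, when d is supported on admissible
   pairs; [d] is read off from there. *)
Lemma epsmul_solve c : perm_inv c -> exists d,
  [/\ perm_inv d, forall I S, ~~ adm I S -> d I S = 0 &
   forall I S, ~~ adm I S -> epsmul d I S = c I S].
Proof.
move=> pc.
(* At most one [i] satisfies the condition; writing a sum avoids choosing it. *)
pose d I S := if adm I S then
  \sum_(i | (i \notin S) && (i.+1 == cmax S)) sg i S * c (i :: I) (i |: S) else 0.
have d0 I S : ~~ adm I S -> d I S = 0 by rewrite /d => /negbTE ->.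
exists d; split=> // [I J S IJ|I S nIS].
  rewrite /d (adm_perm _ IJ); case: ifP => // _; apply: eq_bigr => i _.
  by rewrite (pc _ (i :: J))// perm_cons.
have [i [iI iS iE iC]] := nadm_top nIS.
rewrite (epsmul_nadm d0 nIS iI iS iE) /d adm_rem// (bigD1 i)/=; last first.
  by rewrite setD11 iC eqxx.
rewrite big1 ?addr0 => [|j /andP[/andP[_ /eqP jE] ji]]; last first.
  by move: ji; rewrite -(inj_eq val_inj)/=; move: jE; rewrite iC => -[->]; rewrite eqxx.
rewrite mulrA sg_sqr mul1r finset.setD1K//; apply: pc.
by rewrite perm_sym perm_to_rem.
Qed.

(** The coefficient at [(I, S)] is read off, up to sign, from [epsmul c] at the non-admissible pair
    obtained by adding the largest missing index. *)
Lemma epsmul_inj c k : (0 < m)%N -> (forall I S, ~~ adm I S -> c I S = 0) ->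
  (forall I S, size I = k.+1 -> #|S| = k.+1 -> ~~ adm I S -> epsmul c I S = 0) ->
  forall I S, size I = k -> #|S| = k -> c I S = 0.
Proof.
move=> m0 c0 e0 I S Ik Sk; have [aIS|/c0//] := boolP (adm I S).
have [i iS iE] := cmax_mem (adm_cmax_gt0 m0 (etrans Ik (esym Sk)) aIS).
have [nIS iM] := nadm_cons iS iE aIS.
have := e0 (i :: I) (i |: S); rewrite /= Ik cardsU1 iS Sk => /(_ erefl erefl nIS).
rewrite (epsmul_nadm c0 nIS (mem_head _ _) (setU11 _ _) iM) /= eqxx finset.setU1K//.
by move/eqP; rewrite mulf_eq0 (negPf (sg_neq0 _ _))/= => /eqP.
Qed.

End Koszul.
End Combinatorics.

(** * Polynomial forms and their reduction to admissible monomials *)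

Section PolyForms.
Context {R : realType} {m : nat}.
Local Notation space := 'rV[R]_m.+1.
Local Notation form := ({set 'I_m} -> space -> R^o).
Implicit Types (f g h : space -> R^o) (x y : space) (A B q : form).
Implicit Types (j : 'I_m) (s : seq 'I_m) (S : {set 'I_m}) (U W : set space).
Implicit Types (c d : seq 'I_m -> {set 'I_m} -> R).
Local Opaque partial.

Definition weakly_sorted (I : seq 'I_m) := sorted (fun i j : 'I_m => (i <= j)%N) I.

Definition polyform k c : form := fun S x =>
  \sum_(I : k.-tuple 'I_m | weakly_sorted I) c I S * umonomial I x.

Lemma smooth_umonomial U (I : seq 'I_m) : open U ->
  smooth U (umonomial I : space -> R^o).
Proof. by move=> oU; apply: (smooth_prod _ oU) => j _; exact: smooth_ucoord. Qed.

Lemma jet_umonomial U p s (I : seq 'I_m) : open U -> U p -> uproj p = 0 ->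
  size s = size I -> jet p s (umonomial I) = (perm_eq s I)%:R :> R.
Proof.
move=> oU Up p0; elim: I s => [|j I IH] s.
  move/size0nil => ->; rewrite /jet /multfact big1 ?divr1//.
  by rewrite /udiff/= /umonomial big_nil.
move=> sI; have -> : umonomial (j :: I) = (fun x => ucoord j x * umonomial I x) :> (space -> R^o).
  by apply/funext => x; rewrite /umonomial big_cons.
rewrite (jet_ucoord _ _ oU (smooth_umonomial I oU) Up p0); case: ifPn => js.
  rewrite IH ?size_rem ?sI//; congr (_%:R); congr nat_of_bool.
  by rewrite (permPl (perm_to_rem js)) perm_cons.
rewrite (_ : perm_eq _ _ = false)//; apply/negP => /perm_mem/(_ j).
by rewrite mem_head (negPf js).
Qed.

Lemma weakly_sorted_perm s1 s2 : weakly_sorted s1 -> weakly_sorted s2 ->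
  perm_eq s1 s2 -> s1 = s2.
Proof.
apply: sorted_eq => [i j l|i j]; first exact: leq_trans.
by rewrite -eqn_leq => /eqP/val_inj.
Qed.

Lemma smooth_polyform U k c S : open U -> smooth U (polyform k c S).
Proof.
by move=> oU; apply: (smooth_sum _ oU) => I _; exact: (smoothZ _ oU (smooth_umonomial I oU)).
Qed.

Lemma jet_polyform U p k c S s : open U -> U p -> uproj p = 0 -> perm_inv c ->
  size s = k -> jet p s (polyform k c S) = c s S.
Proof.
move=> oU Up p0 pc sk.
have sF (I : k.-tuple 'I_m) :
    smooth U (fun x => (if weakly_sorted I then c I S else 0) * umonomial I x).
  exact: (smoothZ _ oU (smooth_umonomial I oU)).
rewrite (eq_jet (U := U) s (g := fun x => \sum_(I : k.-tuple 'I_m)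
  (if weakly_sorted I then c I S else 0) * umonomial I x) oU _ Up); last first.
  by move=> y _; rewrite /polyform big_mkcond/=; apply: eq_bigr => I _; case: ifP; rewrite ?mul0r.
rewrite (jet_sum s _ oU sF Up).
under eq_bigr => I _ do rewrite (jetZ _ _ oU (smooth_umonomial I oU) Up)
  (jet_umonomial oU Up p0) ?size_tuple//.
pose r (i j : 'I_m) := (i <= j)%N.
have st : size (sort r s) == k by rewrite size_sort sk.
have rs : weakly_sorted (sort r s) by apply: sort_sorted => i j; exact: leq_total.
have ps : perm_eq s (sort r s) by rewrite perm_sym perm_sort.
rewrite (bigD1 (Tuple st))//= rs ps mulr1 -(pc _ _ _ ps) big1 ?addr0// => I IT.
case: ifP => [sI|_]; last by rewrite mul0r.
case: (boolP (perm_eq s I)) => pI; last by rewrite mulr0.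
case/eqP: IT; apply/val_inj => /=; apply: weakly_sorted_perm => //.
by rewrite -(permPl pI).
Qed.

Lemma jet_wedgeE U p A S s : open U -> (forall S, smooth U (A S)) -> U p ->
  uproj p = 0 ->
  jet p s (wedgeE A S) = epsmul (fun s S => jet p s (A S)) s S.
Proof.
move=> oU sA Up p0.
have sM j := smoothM oU (smooth_ucoord j oU) (sA (S :\ j)).
have sF j : smooth U (fun x => (if j \in S then sg j (S :\ j) else 0) *
    (ucoord j x * A (S :\ j) x)) by exact: (smoothZ _ oU (sM j)).
rewrite (eq_jet (U := U) s (g := fun x => \sum_j (if j \in S then sg j (S :\ j) else 0) *
    (ucoord j x * A (S :\ j) x)) oU _ Up); last first.
  by move=> y _; rewrite /wedgeE big_mkcond/=; apply: eq_bigr => j _; case: ifP; rewrite ?mul0r.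
rewrite (jet_sum s _ oU sF Up) /epsmul [RHS]big_mkcond/=; apply: eq_bigr => j _.
rewrite (jetZ _ _ oU (sM j) Up) (jet_ucoord _ _ oU (sA _) Up p0).
by case: (j \in S); rewrite ?mul0r.
Qed.

Lemma rem_perm_eq s1 s2 j : perm_eq s1 s2 -> perm_eq (rem j s1) (rem j s2).
Proof.
move=> p12; have [j1|j1] := boolP (j \in s1); last first.
  by rewrite !rem_id// -(perm_mem p12).
have j2 : j \in s2 by rewrite -(perm_mem p12).
rewrite -(perm_cons j) -(permPl (perm_to_rem j1)) (perm_trans p12)//.
exact: perm_to_rem.
Qed.

Lemma epsmul_perm c : perm_inv c -> perm_inv (epsmul c).
Proof.
move=> pc I J S IJ; apply: eq_bigr => j jS; rewrite (perm_mem IJ).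
by case: ifP => // _; rewrite (pc _ _ _ (rem_perm_eq j IJ)).
Qed.

Section Reduction.
Variables (W : set space) (p0 : space).
Hypotheses (oW : open W) (WW : scal_into udir 0 W W).
Hypotheses (Wp0 : W p0) (up0 : uproj p0 = 0).

Lemma homog_polyform k c S : homog W k (polyform k c S).
Proof.
have h (I : k.-tuple 'I_m) : homog W k (fun x =>
    (if weakly_sorted I then c I S else 0) * umonomial I x).
  apply: (homogZ oW); rewrite -{1}(size_tuple I); exact: homog_umonomial.
have := homog_sum oW (index_enum _) h.
congr (homog W k _); apply/funext => x.
by rewrite /polyform [RHS]big_mkcond/=; apply: eq_bigr => I _; case: ifP; rewrite ?mul0r.
Qed.

Lemma homog_wedgeE k A S : (forall S, homog W k (A S)) -> homog W k.+1 (wedgeE A S).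
Proof.
move=> hA; have h j : homog W k.+1 (fun x => (if j \in S then sg j (S :\ j) else 0) *
    (ucoord j x * A (S :\ j) x)).
  by apply: (homogZ oW); apply: (homog_ucoord oW); exact: hA.
have := homog_sum oW (index_enum _) h.
congr (homog W _ _); apply/funext => x.
by rewrite /wedgeE [RHS]big_mkcond/=; apply: eq_bigr => j _; case: ifP; rewrite ?mul0r.
Qed.

(** [E /\ q] is made to match the jets of [A] on non-admissible pairs, and the difference on
    admissible ones defines [c]. Both sides are homogeneous of degree [k], so equality of the jets
    at [p0] is enough. *)
Lemma homog_reduce k A : (forall S, homog W k (A S)) ->
  (forall S x, #|S| != k -> W x -> A S x = 0) ->
  exists c q, [/\ forall I S, ~~ adm I S -> c I S = 0,
    forall S, homog W k.-1 (q S),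
    forall S x, #|S|.+1 != k -> q S x = 0 &
    forall S x, W x -> A S x = (if #|S| == k then polyform k c S x else 0) + wedgeE q S x].
Proof.
move=> hA dA; pose c0 s S := jet p0 s (A S).
have pc0 : perm_inv c0 by move=> I J S IJ; exact: (jet_perm oW (hA S).1.1 Wp0 IJ).
have [d [pd d0 dE]] := epsmul_solve pc0.
(* The truncation puts [q] in degree [k - 1] and does not change [epsmul] on sets of size [k]. *)
pose d' s S := if #|S|.+1 == k then d s S else 0.
have pd' : perm_inv d' by move=> I J S IJ; rewrite /d' (pd _ _ _ IJ).
have ed' s S : #|S| = k -> epsmul d' s S = epsmul d s S.
  move=> Sk; apply: eq_bigr => j jS; congr (_ * _); case: ifP => // _.
  by rewrite /d' -Sk (cardsD1 j S) jS eqxx.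
pose c I S := if adm I S then c0 I S - epsmul d' I S else 0.
have pc : perm_inv c.
  move=> I J S IJ; rewrite /c (adm_perm _ IJ) (pc0 _ _ _ IJ).
  by rewrite (epsmul_perm pd' _ IJ).
exists c, (polyform k.-1 d'); split.
- by move=> I S; rewrite /c => /negbTE ->.
- by move=> S; exact: homog_polyform.
- by move=> S x Sk; rewrite /polyform big1// => I _; rewrite /d' (negPf Sk) mul0r.
move=> S x Wx; case: eqP => Sk; last first.
  rewrite dA//; last exact/eqP.
  rewrite add0r /wedgeE big1// => j jS; rewrite /polyform big1 ?mulr0// => I _.
  rewrite /d' (_ : _ == k = false) ?mul0r//; apply/negP => /eqP E.
  by apply: Sk; rewrite -E (cardsD1 j S) jS.
have hw : homog W k (wedgeE (polyform k.-1 d') S).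
  have [k0|k0] := posnP k; last first.
    by rewrite -{1}(prednK k0); apply: homog_wedgeE => S'; exact: homog_polyform.
  have -> : wedgeE (polyform k.-1 d') S = cst 0.
    apply/funext => y; rewrite /wedgeE big1// => j jS.
    by move: Sk; rewrite k0 (cardsD1 j S) jS.
  by rewrite k0; exact: homog_cst.
have hp := homog_polyform k c S.
have hD := homogD oW hp hw.
have hB := homogD oW (hA S) (homogZ oW (-1) hD).
suff : A S x + -1 * (polyform k c S x + wedgeE (polyform k.-1 d') S x) = 0.
  by move=> /eqP; rewrite mulN1r subr_eq0 => /eqP.
suff Hj s : size s = k -> jet p0 s (fun x => A S x +
    -1 * (polyform k c S x + wedgeE (polyform k.-1 d') S x)) = 0.
  exact: (homog_jet0 oW WW up0 hB Hj Wx).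
move=> sk.
rewrite (jetD _ oW (hA S).1.1 (homogZ oW (-1) hD).1.1 Wp0).
rewrite (jetZ _ _ oW hD.1.1 Wp0) (jetD _ oW hp.1.1 hw.1.1 Wp0).
rewrite (jet_polyform _ oW Wp0 up0 pc sk).
rewrite (jet_wedgeE _ _ oW (fun S' => smooth_polyform _ _ S' oW) Wp0 up0).
have -> : epsmul (fun s S => jet p0 s (polyform k.-1 d' S)) s S = epsmul d' s S.
  apply: eq_bigr => j jS; congr (_ * _); case: ifP => // js.
  by rewrite (jet_polyform _ oW Wp0 up0 pd')// size_rem// sk.
rewrite -/(c0 s S) /c; case: ifPn => [_|nadm]; first by rewrite subrK mulN1r subrr.
by rewrite add0r ed'// dE// mulN1r subrr.
Qed.

End Reduction.
End PolyForms.

(** * The book differential in components *)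

Section Translation.
Local Close Scope classical_set_scope.
Context {R : realType} {m : nat}.
Local Notation space := 'rV[R]_m.+1.
Local Notation form := ({set 'I_m} -> space -> R^o).
Implicit Types (P Q X : mvfield R m.+1) (A B : form) (x y : space).
Implicit Types (S : {set 'I_m}) (T : {set 'I_m.+1}) (j k : 'I_m).
Local Opaque partial.
Local Notation "0t" := (ord0 : 'I_m.+1).
Local Notation up := (lift (ord0 : 'I_m.+1)).

Definition liftS S : {set 'I_m.+1} := up @: S.

Lemma mem_liftS S j : (up j \in liftS S) = (j \in S).
Proof. by rewrite mem_imset//; exact: lift_inj. Qed.

Lemma ord0_liftS S : (0t \in liftS S) = false.
Proof. by apply/imsetP => -[j _ /eqP]; rewrite (negPf (neq_lift _ _)). Qed.

Lemma liftSP T T' : (0t \in T) = (0t \in T') ->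
  (forall j, (up j \in T) = (up j \in T')) -> T = T'.
Proof. by move=> h0 h; apply/setP => a; case: (unliftP 0t a) => [j|] ->. Qed.

Lemma up_neq0 j : (up j == 0t) = false.
Proof. by rewrite eq_sym (negPf (neq_lift _ _)). Qed.

Lemma liftSD1 S j : liftS S :\ up j = liftS (S :\ j).
Proof.
apply: liftSP => [|k]; first by rewrite !inE !ord0_liftS andbF.
by rewrite !(inE, mem_liftS) (inj_eq lift_inj).
Qed.

Lemma liftSU1 S j : up j |: liftS S = liftS (j |: S).
Proof.
apply: liftSP => [|k]; first by rewrite !inE !ord0_liftS eq_sym up_neq0.
by rewrite !(inE, mem_liftS) (inj_eq lift_inj).
Qed.

Lemma ord0U_liftSD1 S j : (0t |: liftS S) :\ up j = 0t |: liftS (S :\ j).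
Proof.
apply: liftSP => [|k]; first by rewrite !inE eqxx eq_sym up_neq0.
by rewrite !(inE, mem_liftS) up_neq0 (inj_eq lift_inj).
Qed.

Lemma ord0U_liftSK S : (0t |: liftS S) :\ 0t = liftS S.
Proof.
apply: liftSP => [|k]; first by rewrite !inE eqxx ord0_liftS.
by rewrite !(inE, mem_liftS) up_neq0.
Qed.

Lemma card_liftS S : #|liftS S| = #|S|.
Proof. by rewrite card_imset//; exact: lift_inj. Qed.

Lemma card_ord0U S : #|0t |: liftS S| = #|S|.+1.
Proof. by rewrite cardsU1 ord0_liftS card_liftS. Qed.

Definition unliftS T : {set 'I_m} := [set j | up j \in T]%SET.

Lemma unliftSK T : T = if 0t \in T then 0t |: liftS (unliftS T) else liftS (unliftS T).
Proof.
case: ifP => h0; apply: liftSP => [|j]; rewrite ?h0 !(inE, mem_liftS, ord0_liftS, eqxx)//.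
Qed.

Lemma liftSK S : unliftS (liftS S) = S.
Proof. by apply/setP => j; rewrite inE mem_liftS. Qed.

Lemma ord0U_liftSK' S : unliftS (0t |: liftS S) = S.
Proof. by apply/setP => j; rewrite !inE mem_liftS up_neq0. Qed.

(** The set inside [ext_sign] is a classical set, counted through its boolean reflection; as a
    finite set it is within reach of the cardinality lemmas. *)
Lemma ext_signE T T' : ext_sign T T' = (-1) ^+ #|[set ij : 'I_m.+1 * 'I_m.+1 |
  [&& ij.1 \in T, ij.2 \in T' & (ij.2 < ij.1)%N]]%SET| :> R.
Proof.
rewrite /ext_sign; congr (_ ^+ _); apply: eq_card => p.
by rewrite inE [LHS]asboolb.
Qed.

Lemma ext_sign1 (a : 'I_m.+1) T :
  ext_sign [set a]%SET T = (-1) ^+ #|[set b in T | (b < a)%N]%SET| :> R.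
Proof.
rewrite ext_signE; congr (_ ^+ _).
have inj : injective (fun b : 'I_m.+1 => (a, b)) by move=> ? ? [].
rewrite -(card_imset _ inj).
suff -> : [set ij : 'I_m.+1 * 'I_m.+1 |
    [&& ij.1 \in [set a]%SET, ij.2 \in T & (ij.2 < ij.1)%N]]%SET =
  [set (a, b) | b in [set b in T | (b < a)%N]%SET]%SET by [].
apply/setP => -[b c]; rewrite !inE/=; apply/idP/imsetP.
  by move=> /and3P[/eqP -> cT ca]; exists c; rewrite ?inE ?cT.
by move=> [d + [-> ->]]; rewrite inE eqxx.
Qed.

Lemma ext_sign_ord0 T : ext_sign [set 0t]%SET T = 1 :> R.
Proof.
rewrite ext_sign1 (_ : [set b in T | _]%SET = finset.set0) ?cards0//.
by apply/setP => b; rewrite !inE andbF.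
Qed.

Lemma ext_sign_up j S : ext_sign [set up j]%SET (liftS S) = sg j S :> R.
Proof.
rewrite ext_sign1 /sg -(card_liftS [set i in S | (i < j)%N]%SET); congr (_ ^+ _).
congr (#|pred_of_set _|)%N; apply: liftSP => [|k]; rewrite !(inE, ord0_liftS, mem_liftS)//.
Qed.

Lemma ext_sign_up0 j S : ext_sign [set up j]%SET (0t |: liftS S) = - sg j S :> R.
Proof.
rewrite ext_sign1 /sg -[RHS]mulN1r -[RHS]exprS; congr (_ ^+ _).
rewrite -(card_ord0U [set i in S | (i < j)%N]%SET).
congr (#|pred_of_set _|)%N; apply: liftSP => [|k]; rewrite !(inE, ord0_liftS, mem_liftS, eqxx)//.
Qed.

Lemma ext_sign_0up j T : ext_sign (0t |: [set up j])%SET T = ext_sign [set up j]%SET T :> R.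
Proof.
rewrite !ext_signE; congr (_ ^+ _); apply: eq_card => -[a b]; rewrite !inE/=.
by case: eqVneq => //= ->; rewrite ltn0 andbF eq_sym up_neq0.
Qed.

Lemma wedge_mono X Q (T0 : {set 'I_m.+1}) (c : R) T x :
  (forall T', X T' x = c * (T' == T0)%:R) ->
  wedge X Q T x = if T0 \subset T
    then ext_sign T0 (T :\: T0) * (c * Q (T :\: T0) x) else 0.
Proof.
move=> XE; rewrite /wedge; case: ifP => sT; last first.
  apply: big1 => T' T'T; rewrite XE (_ : (_ == _) = false) ?mulr0 ?mul0r ?mulr0//.
  by apply: contraFF sT => /eqP <-.
rewrite (bigD1 T0)//= XE eqxx mulr1 big1 ?addr0// => T' /andP[_ /negbTE T'0].
by rewrite XE T'0 mulr0 mul0r mulr0.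
Qed.

Lemma wedge_suml (I : finType) (X : I -> mvfield R m.+1) Y Q T x :
  (forall T', Y T' x = \sum_i X i T' x) ->
  wedge Y Q T x = \sum_i wedge (X i) Q T x.
Proof.
move=> YE; rewrite /wedge exchange_big/=; apply: eq_bigr => T' _.
by rewrite YE mulr_suml mulr_sumr.
Qed.

Lemma eulerE T x : euler T x = \sum_j ucoord j x * (T == [set up j]%SET)%:R.
Proof. by rewrite /euler mvsumE. Qed.

Lemma setD_single (a : 'I_m.+1) T : T :\: [set a]%SET = T :\ a.
Proof. by []. Qed.

Lemma bookE T x : book T x = \sum_j ucoord j x * (T == 0t |: [set up j])%SET%:R.
Proof.
rewrite /book (@wedge_mono dt euler [set 0t]%SET 1 T x); last first.
  by move=> T'; rewrite mul1r.
rewrite finset.sub1set ext_sign_ord0 !mul1r eulerE; case: ifPn => h0.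
  apply: eq_bigr => j _; congr (_ * _%:R); congr nat_of_bool.
  apply/eqP/eqP => [<-|->]; first by rewrite finset.setD1K.
  by rewrite finset.setU1K// inE eq_sym up_neq0.
rewrite big1// => j _; rewrite (_ : _ == _ = false) ?mulr0//.
by apply/negP => /eqP E; rewrite E !inE eqxx in h0.
Qed.

Lemma partial_ucoord (i : 'I_m.+1) j x :
  partial i (ucoord j : space -> R^o) x = (up j == i)%:R.
Proof. exact: partial_coord. Qed.

(** The sign is that of [d_t /\ d_j = - d_j /\ d_t], as the derivative acts from the right; it is
    the sign of [- E /\ A_t] in the differential. *)
Lemma mvdr_book0 T x : mvdr 0t book T x = - euler T x.
Proof.
rewrite /mvdr eulerE -sumrN; case: ifP => h0.
  rewrite big1// => j _; rewrite (_ : _ == _ = false) ?mulr0 ?oppr0//.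
  by apply/negP => /eqP E; rewrite E !inE eq_sym up_neq0 in h0.
rewrite bookE mulr_sumr; apply: eq_bigr => j _.
have -> : (0t |: T == 0t |: [set up j])%SET = (T == [set up j]%SET).
  apply/eqP/eqP => [E|->//].
  by rewrite -(finset.setU1K (negbT h0)) E finset.setU1K// inE eq_sym up_neq0.
case: eqP => [->|_]; last by rewrite !mulr0 oppr0.
rewrite ext_sign1 (_ : [set b in [set 0t] | _]%SET = [set 0t]%SET); last first.
  by apply/setP => b; rewrite !inE; case: eqP => // ->; rewrite lt0n.
by rewrite cards1 expr1 mulN1r.
Qed.

Lemma mvdr_book k T x : mvdr (up k) book T x = ucoord k x * (T == [set 0t]%SET)%:R.
Proof.
rewrite /mvdr; case: ifP => hk.
  rewrite (_ : _ == _ = false) ?mulr0//.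
  by apply/negP => /eqP E; rewrite E !inE up_neq0 in hk.
rewrite bookE; case: eqP => [->|T0].
  rewrite ext_sign_ord0 mul1r (bigD1 k)//= finset.setUC eqxx big1 ?addr0// => j jk.
  rewrite (_ : _ == _ = false) ?mulr0//; apply/negP => /eqP /setP/(_ (up j)).
  by rewrite !inE !up_neq0 eqxx (inj_eq lift_inj) (negPf jk).
rewrite big1 ?mulr0// => j _; rewrite (_ : _ == _ = false) ?mulr0//.
apply/negP => /eqP E; apply: T0; rewrite -(finset.setU1K (negbT hk)) E.
have jk : j = k.
  have := setU11 (up k) T; rewrite E !inE up_neq0 (inj_eq lift_inj) => /eqP ->//.
by rewrite jk finset.setUC finset.setU1K// inE up_neq0.
Qed.

Lemma mvpartial_book0 T x : mvpartial 0t book T x = 0.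
Proof.
rewrite /mvpartial; have E y : setT y -> book T y =
    \sum_j (T == 0t |: [set up j])%SET%:R * ucoord j y.
  by move=> _; rewrite bookE; apply: eq_bigr => j _; rewrite mulrC.
rewrite (eq_partial 0t openT E (I : setT x)).
have su j := @smooth_ucoord R m setT j openT.
rewrite (partial_sum _ _ openT (fun j _ => smoothZ _ openT (su j)) (I : setT x)).
rewrite big1// => j _; rewrite (partialZ _ _ (smooth_C1 (su j)) (I : setT x)).
by rewrite partial_ucoord up_neq0 mulr0.
Qed.

Lemma mvpartial_book k T x :
  mvpartial (up k) book T x = 1 * (T == 0t |: [set up k])%SET%:R.
Proof.
rewrite /mvpartial; have E y : setT y -> book T y =
    \sum_j (T == 0t |: [set up j])%SET%:R * ucoord j y.
  by move=> _; rewrite bookE; apply: eq_bigr => j _; rewrite mulrC.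
rewrite (eq_partial (up k) openT E (I : setT x)).
have su j := @smooth_ucoord R m setT j openT.
rewrite (partial_sum _ _ openT (fun j _ => smoothZ _ openT (su j)) (I : setT x)).
rewrite (bigD1 k)//= (partialZ _ _ (smooth_C1 (su k)) (I : setT x)).
rewrite partial_ucoord eqxx mulr1 mul1r big1 ?addr0// => j jk.
rewrite (partialZ _ _ (smooth_C1 (su j)) (I : setT x)).
by rewrite partial_ucoord (inj_eq lift_inj) (negPf jk) mulr0.
Qed.

(** [P = upart P + d_t /\ tpart P], with the index sets of both parts taken among the
    [u]-coordinates. *)
Definition upart P : form := fun S => P (liftS S).
Definition tpart P : form := fun S => P (0t |: liftS S).

Lemma schouten_bookE P T x : schouten book P T x =
  - (\sum_j wedge (fun T' y => ucoord j y * (T' == [set up j]%SET)%:R) (mvpartial 0t P) T x) +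
  (\sum_k (wedge (mvdr (up k) book) (mvpartial (up k) P) T x
     - wedge (mvpartial (up k) book) (mvdl (up k) P) T x)).
Proof.
rewrite /schouten mvsumE big_ord_recl; congr (_ + _).
rewrite -[LHS]/(wedge (mvdr 0t book) (mvpartial 0t P) T x
  - wedge (mvpartial 0t book) (mvdl 0t P) T x).
rewrite (@wedge_mono (mvpartial 0t book) _ finset.set0 0); last first.
  by move=> T'; rewrite mvpartial_book0 mul0r.
rewrite [if _ then _ else _](_ : _ = 0) ?subr0; last first.
  by case: ifP; rewrite ?mul0r ?mulr0.
rewrite -(@wedge_suml _ (fun j T' y => ucoord j y * (T' == [set up j]%SET)%:R) euler); last first.
  by move=> T'; rewrite eulerE.
by rewrite /wedge -sumrN; apply: eq_bigr => T' _; rewrite mvdr_book0 mulNr mulrN.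
Qed.

(** The terms with an index [u_k] of the bracket all contain [d_t], so only the one with [t]
    contributes. *)
Lemma schouten_book_upart P S x :
  schouten book P (liftS S) x = - wedgeE (fun S => partial 0t (upart P S)) S x.
Proof.
rewrite schouten_bookE [X in _ + X]big1 ?addr0 => [|k _]; last first.
  rewrite (wedge_mono _ _ (mvdr_book k ^~ x)) finset.sub1set ord0_liftS.
  rewrite (wedge_mono _ _ (mvpartial_book k ^~ x)) finset.subUset finset.sub1set ord0_liftS/=.
  by rewrite subr0.
congr (- _); rewrite /wedgeE [RHS]big_mkcond/=; apply: eq_bigr => j _.
rewrite (@wedge_mono _ _ [set up j]%SET (ucoord j x))// finset.sub1set mem_liftS.
by case: ifP => // jS; rewrite liftSD1 ext_sign_up.
Qed.

(** The terms [u_k d_t] of the right derivative of [book] give the derivative along [E]. The terms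
    [d_t /\ d_k] contract [d_k] and put it back, once for each [k] in [S], whence [- #|S|]. *)
Lemma schouten_book_tpart P S x :
  schouten book P (0t |: liftS S) x =
  eulerD (upart P S) x - #|S|%:R * upart P S x +
  wedgeE (fun S => partial 0t (tpart P S)) S x.
Proof.
rewrite schouten_bookE addrC; congr (_ + _); last first.
  rewrite /wedgeE -sumrN [RHS]big_mkcond/=; apply: eq_bigr => j _.
  rewrite (@wedge_mono _ _ [set up j]%SET (ucoord j x))// finset.sub1set !inE up_neq0 mem_liftS/=.
  case: ifP => jS; last by rewrite oppr0.
  by rewrite setD_single ord0U_liftSD1 ext_sign_up0 mulNr opprK.
rewrite sumrB; congr (_ - _).
  apply: eq_bigr => k _; rewrite (wedge_mono _ _ (mvdr_book k ^~ x)) finset.sub1set setU11.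
  by rewrite ext_sign_ord0 mul1r setD_single ord0U_liftSK.
rewrite -sum1_card natr_sum mulr_suml [RHS]big_mkcond/=; apply: eq_bigr => k _.
rewrite (wedge_mono _ _ (mvpartial_book k ^~ x)) finset.subUset !finset.sub1set setU11/= !inE up_neq0 mem_liftS/=.
case: ifP => // kS.
have -> : (0t |: liftS S) :\: (0t |: [set up k])%SET = liftS (S :\ k).
  apply: liftSP => [|j]; rewrite !(inE, ord0_liftS, mem_liftS, eqxx)// up_neq0/=.
rewrite ext_sign_0up ext_sign_up /mvdl mem_liftS setD11 ext_sign_up liftSU1 finset.setD1K//.
by rewrite !mul1r mulrA sg_sqr mul1r.
Qed.

End Translation.

(** * Solving the cocycle equations *)

Section BookForms.
Context {R : realType} {m : nat}.
Local Notation space := 'rV[R]_m.+1.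
Local Notation form := ({set 'I_m} -> space -> R^o).
Implicit Types (f g h : space -> R^o) (x y : space) (A B C Q q : form).
Implicit Types (j : 'I_m) (S : {set 'I_m}).
Implicit Types (c d : seq 'I_m -> {set 'I_m} -> R).
Local Notation dt f := (partial ord0 f).
Local Opaque partial.

(** The Lie derivative along [E], as [[E, d_S] = - |S| d_S]. *)
Definition lieE A : form := fun S x => eulerD (A S) x - #|S|%:R * A S x.

Definition dtf A : form := fun S => dt (A S).

Definition smooth_form U A := forall S, smooth U (A S).
Definition deg_form U k A := forall S x, #|S| != k -> U x -> A S x = 0.

(* Degree k - 1, which means A = 0 when k = 0. *)
Definition pre_deg_form U k A := forall S x, #|S|.+1 != k -> U x -> A S x = 0.

Lemma smooth_lieE U A : open U -> smooth_form U A -> smooth_form U (lieE A).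
Proof.
move=> oU sA S; exact: (smoothB oU (smooth_euler oU (sA S)) (smoothZ _ oU (sA S))).
Qed.

Lemma smooth_dtf U A : smooth_form U A -> smooth_form U (dtf A).
Proof. by move=> sA S; exact: smooth_partial. Qed.

Lemma dt_euler U f x : open U -> smooth U f -> U x ->
  dt (eulerD f) x = eulerD (dt f) x.
Proof.
move=> oU sf Ux.
have sM j := smoothM oU (smooth_ucoord j oU) (smooth_partial (lift ord0 j) sf).
rewrite /eulerD (partial_sum _ _ oU (fun j _ => sM j) Ux); apply: eq_bigr => j _.
rewrite (partial_ucoordM _ _ (smooth_partial _ sf) Ux) eq_sym (negPf (neq_lift _ _)).
rewrite mul0r addr0; apply: (congr1 (fun z => ucoord j x * z)).
exact: (schwarz _ _ oU sf Ux).
Qed.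

Lemma dtf_lieE U A S x : open U -> smooth_form U A -> U x ->
  dtf (lieE A) S x = lieE (dtf A) S x.
Proof.
move=> oU sA Ux.
have se := smooth_euler oU (sA S).
have E y : U y -> lieE A S y = ((fun z => eulerD (A S) z) + (fun z => - #|S|%:R * A S z)) y.
  by move=> _; rewrite /lieE fctE mulNr.
rewrite /dtf (eq_partial ord0 oU E Ux).
rewrite (partialD _ (smooth_C1 se) (smooth_C1 (smoothZ _ oU (sA S))) Ux).
by rewrite (partialZ _ _ (smooth_C1 (sA S)) Ux) (dt_euler oU (sA S) Ux) mulNr.
Qed.

Lemma dtf_wedgeE U A S x : open U -> smooth_form U A -> U x ->
  dtf (wedgeE A) S x = wedgeE (dtf A) S x.
Proof.
move=> oU sA Ux; rewrite /dtf (partial_wedgeE S ord0 oU sA Ux); apply: eq_bigr => j _.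
by rewrite eq_sym (negPf (neq_lift _ _)) mul0r addr0.
Qed.

(** A form of [[E, E] = 0]: the extra term from [E u_j = u_j] cancels the increase of the degree by
    one. *)
Lemma lieE_wedgeE U A S x : open U -> smooth_form U A -> U x ->
  lieE (wedgeE A) S x = wedgeE (lieE A) S x.
Proof.
move=> oU sA Ux; rewrite /lieE /wedgeE.
have sM j := smoothM oU (smooth_ucoord j oU) (sA (S :\ j)).
have -> : eulerD (wedgeE A S) x = \sum_(j in S) sg j (S :\ j) *
    (ucoord j x * (A (S :\ j) x + eulerD (A (S :\ j)) x)).
  rewrite /eulerD.
  under eq_bigr => i _ do rewrite (partial_wedgeE S (lift ord0 i) oU sA Ux) mulr_sumr.
  rewrite exchange_big/=; apply: eq_bigr => j jS.
  rewrite -(eulerD_ucoord _ (sA _) Ux) /eulerD mulr_sumr; apply: eq_bigr => i _.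
  by rewrite (partial_ucoordM _ _ (sA _) Ux); ring.
rewrite mulr_sumr -sumrB; apply: eq_bigr => j jS.
by rewrite (cardsD1 j S) jS add1n -natr1; ring.
Qed.

Lemma eq_lieE U A B S x : open U -> (forall y, U y -> A S y = B S y) -> U x ->
  lieE A S x = lieE B S x.
Proof. by move=> oU AB Ux; rewrite /lieE (eq_eulerD oU AB Ux) AB. Qed.

Lemma lieED U A B S x : open U -> smooth_form U A -> smooth_form U B -> U x ->
  lieE (fun S x => A S x + B S x) S x = lieE A S x + lieE B S x.
Proof.
by move=> oU sA sB Ux; rewrite /lieE (eulerDD (sA S) (sB S) Ux); ring.
Qed.

Lemma dtfD U A B S x : open U -> smooth_form U A -> smooth_form U B -> U x ->
  dtf (fun S x => A S x + B S x) S x = dtf A S x + dtf B S x.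
Proof.
move=> oU sA sB Ux; exact: (partialD _ (smooth_C1 (sA S)) (smooth_C1 (sB S)) Ux).
Qed.

Lemma wedgeED A B S x :
  wedgeE (fun S x => A S x + B S x) S x = wedgeE A S x + wedgeE B S x.
Proof.
by rewrite /wedgeE -big_split/=; apply: eq_bigr => j _; ring.
Qed.

Lemma wedgeEZ (a : R) A S x : wedgeE (fun S x => a * A S x) S x = a * wedgeE A S x.
Proof. by rewrite /wedgeE mulr_sumr; apply: eq_bigr => j _; ring. Qed.

Lemma wedgeE_at0 A S x : uproj x = 0 -> wedgeE A S x = 0.
Proof.
move=> x0; rewrite /wedgeE big1// => j _.
have -> : ucoord j x = 0 by move/rowP: x0 => /(_ j); rewrite !mxE.
by rewrite mul0r mulr0.
Qed.

Lemma eulerD_at0 f x : uproj x = 0 -> eulerD f x = 0.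
Proof.
move=> x0; rewrite /eulerD big1// => j _.
have -> : ucoord j x = 0 by move/rowP: x0 => /(_ j); rewrite !mxE.
by rewrite mul0r.
Qed.

Definition trunc k A : form := fun S x => if #|S|.+1 == k then A S x else 0.

Lemma smooth_trunc U k A : open U -> smooth_form U A -> smooth_form U (trunc k A).
Proof.
move=> oU sA S; rewrite /trunc.
by case: (#|S|.+1 == k); [exact: sA|exact: (smooth_cst 0 oU)].
Qed.

Lemma pre_deg_trunc U k A : pre_deg_form U k (trunc k A).
Proof. by move=> S x Sk _; rewrite /trunc (negPf Sk). Qed.

(** A [t]-primitive of [f] when [f] is independent of [t]; it puts terms [E /\ q] with such a [q]
    into the shape of a coboundary. *)
Definition tmul f : space -> R^o := fun x => x 0 ord0 * f x.

Lemma smooth_tmul U f : open U -> smooth U f -> smooth U (tmul f).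
Proof. by move=> oU sf; exact: (smoothM oU (smooth_coord ord0 oU) sf). Qed.

Lemma dt_tmul U f x : open U -> smooth U f -> tindep f -> U x ->
  dt (tmul f) x = f x.
Proof.
move=> oU sf tf Ux.
rewrite (partialM ord0 (@C1_coord R m.+1 U ord0) (smooth_C1 sf) Ux).
by rewrite partial_coord partial_tindep// mulr0 add0r mulr1.
Qed.

Section OnU.
Variables (U : set space).
Hypotheses (oU : open U)
  (cU : forall u, connected (U `&` uproj @^-1` [set u])).
Let W := cyl U.
Let oW : open W := open_cyl oU.
Hypothesis WW : scal_into udir 0 W W.
Variable p0 : space.
Hypotheses (Up0 : U p0) (up0 : uproj p0 = 0).
Let Wp0 : W p0 := sub_cyl Up0.

Lemma smooth_cylU f : smooth W f -> smooth U f.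
Proof. by apply: smoothS => x; exact: sub_cyl. Qed.

Lemma tindep_cyl f g x : tindep f -> tindep g -> (forall y, U y -> f y = g y) ->
  W x -> f x = g x.
Proof. by move=> tf tg fg [y Uy yx]; rewrite -(tf _ _ yx) -(tg _ _ yx) fg. Qed.

Lemma tprimitive_form k A : smooth_form U A ->
  exists B, [/\ smooth_form U B, pre_deg_form U k B &
    forall S x, U x -> dtf B S x = trunc k A S x].
Proof.
move=> sA; have /choice[B HB] : forall S, exists F, smooth U F /\
    forall x, U x -> dt F x = A S x.
  by move=> S; have [F sF dF] := tprimitive oU cU (sA S); exists F.
exists (trunc k B); split=> [S|S x Sk Ux|S x Ux].
- exact: (@smooth_trunc U k B oU (fun S => (HB S).1) S).
- exact: pre_deg_trunc Ux.
- rewrite /dtf /trunc; case: ifP => Sk; first by have [_ ->] := HB S.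
  exact: (partial_cst ord0 0 x).
Qed.

(** [A_t = E /\ C] is integrated twice in [t]. With the first primitive [A1] of [C], the form
    [A - E /\ A1] is independent of [t]; the second writes [A1] as a [t]-derivative, the shape that
    coboundaries have. *)
Lemma split_form k A : smooth_form U A -> deg_form U k A ->
  (forall S x, U x -> wedgeE (dtf A) S x = 0) ->
  (k = m -> forall x, U x -> uproj x = 0 -> dtf A [set: 'I_m]%SET x = 0) ->
  exists A0 A2, [/\ smooth_form U A0, pre_deg_form U k A0,
    forall S, basic W (A2 S), deg_form W k A2 &
    forall S x, U x -> A S x = wedgeE (dtf A0) S x + A2 S x].
Proof.
move=> sA dA EA tA.
have ddA : deg_form U k (dtf A).
  by move=> S x Sk Ux; apply: (partial_eq0 _ oU _ Ux) => y Uy; exact: dA.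
have [C [sC dC AC]] := koszul oU (smooth_dtf sA) ddA EA tA.
have [A1 [sA1 dA1 A1E]] := tprimitive_form k sC.
have [A0 [sA0 dA0 A0E]] := tprimitive_form k sA1.
have sEA0 S : smooth U (wedgeE (dtf A0) S).
  exact: (smooth_wedgeE oU (smooth_dtf sA0) S).
pose D S : space -> R^o := fun x => A S x - wedgeE (dtf A0) S x.
have sD S : smooth U (D S) by exact: (smoothB oU (sA S) (sEA0 S)).
have eqA0 S y : U y -> dtf A0 S y = A1 S y.
  move=> Uy; rewrite A0E// /trunc; case: ifPn => // Sk.
  by rewrite dA1.
have dD S x : U x -> dt (D S) x = 0.
  move=> Ux.
  have E y : U y -> D S y = (A S + (fun z => -1 * wedgeE A1 S z)) y.
    move=> Uy; rewrite /D fctE mulN1r; congr (_ - _); apply: eq_wedgeE => S'.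
    exact: eqA0.
  have sE1 := smooth_wedgeE oU sA1 S.
  rewrite (eq_partial ord0 oU E Ux).
  rewrite (partialD _ (smooth_C1 (sA S)) (smooth_C1 (smoothZ _ oU sE1)) Ux).
  rewrite (partialZ _ _ (smooth_C1 sE1) Ux).
  have -> : dt (wedgeE A1 S) x = wedgeE (dtf A1) S x by exact: (dtf_wedgeE S oU sA1 Ux).
  rewrite -/(dtf A S x) AC// mulN1r; apply/eqP; rewrite subr_eq0; apply/eqP.
  apply: eq_wedgeE => S'; rewrite A1E// /trunc; case: ifPn => // Sk.
  by rewrite dC.
have /choice[A2 HA2] : forall S, exists g, [/\ smooth W g, tindep g &
    forall x, U x -> D S x = g x].
  by move=> S; exact: (tindep_extend oU cU (sD S) (dD S)).
exists A0, A2; split=> // [S|S x Sk [y Uy yx]|S x Ux].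
- by have [] := HA2 S.
- have [_ tg Dg] := HA2 S; rewrite -(tg _ _ yx) -Dg// /D dA// sub0r.
  rewrite /wedgeE big1 ?oppr0// => j jS; rewrite eqA0// dA1 ?mulr0//.
  by apply: contra Sk => /eqP <-; rewrite (cardsD1 j S) jS.
- by have [_ _ <-//] := HA2 S; rewrite /D addrC subrK.
Qed.

(** Decompose the coefficients of [B] as [q + (E - (k - 1)) h]. Then [L (A - E /\ h) = E /\ q] is
    homogeneous of degree [k] and also in the image of [E - k]. Its jets of order [k] vanish, so it
    is zero, and [A - E /\ h] is homogeneous. *)
Lemma solve_form k A B : (forall S, basic W (A S)) -> deg_form W k A ->
  (forall S, basic W (B S)) ->
  (forall S x, W x -> lieE A S x = wedgeE B S x) ->
  exists Q C, [/\ forall S, homog W k (Q S), deg_form W k Q,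
    forall S, basic W (C S), pre_deg_form W k C &
    forall S x, W x -> A S x = Q S x + wedgeE C S x].
Proof.
move=> bA dA bB AB.
have /choice[q /choice[h Hqh]] : forall S, exists q : space -> R^o, exists h, [/\ homog W k.-1 q, basic W h &
    forall x, W x -> B S x = q x + (eulerD h x - k.-1%:R * h x)].
  by move=> S; exact: (taylor oW WW up0 k.-1 (bB S)).
pose h' := trunc k h.
have bh' S : basic W (h' S).
  rewrite /h' /trunc; case: (#|S|.+1 == k); last exact: (basic_cst oW 0).
  by have [] := Hqh S.
have sh' : smooth_form W h' by move=> S; exact: (bh' S).1.
have hq S : homog W k.-1 (q S) by have [] := Hqh S.
have bEh S : basic W (wedgeE h' S).
  split; first exact: (smooth_wedgeE oW sh' S).
  move=> x y xy; apply: eq_bigr => j _.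
  by rewrite (tindep_ucoord j xy) ((bh' _).2 _ _ xy).
have bQ S : basic W (fun x => A S x + -1 * wedgeE h' S x).
  exact: (basicD oW (bA S) (basicZ oW (-1) (bEh S))).
exists (fun S x => A S x + -1 * wedgeE h' S x), h'.
have dQ : deg_form W k (fun S x => A S x + -1 * wedgeE h' S x).
  move=> S x Sk Wx; rewrite dA// add0r /wedgeE big1 ?mulr0// => j jS.
  rewrite /h' /trunc (_ : #|_|.+1 = #|S|) ?(negPf Sk) ?mulr0//.
  by rewrite (cardsD1 j S) jS.
split=> // [S|S x Sk Wx|S x Wx]; first last.
- by rewrite mulN1r subrK.
- exact: pre_deg_trunc Wx.
have [Sk|Sk] := eqVneq #|S| k; last first.
  split=> // x Wx; have E y : W y -> A S y + -1 * wedgeE h' S y = cst 0 y.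
    by move=> Wy; exact: dQ.
  by rewrite (eq_eulerD oW E Wx) (homog_cst oW 0).2// E// mul0r mulr0.
split=> // x Wx.
have EL y : W y -> eulerD (fun x => A S x + -1 * wedgeE h' S x) y -
    k%:R * (A S y + -1 * wedgeE h' S y) = wedgeE q S y.
  move=> Wy.
  have L1 : eulerD (A S) y - k%:R * A S y = wedgeE B S y by rewrite -AB// /lieE Sk.
  have L2 : eulerD (wedgeE h' S) y - k%:R * wedgeE h' S y = wedgeE (lieE h') S y.
    by rewrite -(lieE_wedgeE S oW sh' Wy) /lieE Sk.
  have L3 : wedgeE B S y = wedgeE q S y + wedgeE (lieE h') S y.
    rewrite -wedgeED; apply: eq_bigr => j jS; congr (_ * (_ * _)).
    have Sj : #|S :\ j|.+1 == k by rewrite -Sk (cardsD1 j S) jS.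
    have [_ _ ->//] := Hqh (S :\ j).
    by rewrite /lieE /h' /trunc Sj -(eqP Sj).
  rewrite (eulerDD (bA S).1 (basicZ oW (-1) (bEh S)).1 Wy) (eulerDZ _ (bEh S).1 Wy).
  move: L1 L2 L3; move: (eulerD _ _) (A S y) (eulerD _ _) (wedgeE h' S y).
  by move=> a b c d /eqP; rewrite subr_eq => /eqP -> /eqP; rewrite subr_eq => /eqP -> ->; ring.
have hEq : homog W k (wedgeE q S).
  have [k0|k0] := posnP k; last by rewrite -(prednK k0); exact: (homog_wedgeE oW S hq).
  have -> : wedgeE q S = cst 0.
    apply/funext => y; rewrite /wedgeE big1// => j jS.
    by move: Sk; rewrite k0 (cardsD1 j S) jS.
  by rewrite k0; exact: homog_cst.
have Eq0 : wedgeE q S x = 0.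
  suff Hj s : size s = k -> jet p0 s (wedgeE q S) = 0.
    exact: (homog_jet0 oW WW up0 hEq Hj Wx).
  move=> sk; rewrite -(eq_jet s oW EL Wp0).
  pose f0 : space -> R^o := fun x => A S x + -1 * wedgeE h' S x.
  have sf0 : smooth W f0 := (bQ S).1.
  have se := smooth_euler oW sf0.
  have E y : W y -> eulerD f0 y - k%:R * f0 y = (fun z => eulerD f0 z + (- k%:R) * f0 z) y.
    by move=> _; rewrite mulNr.
  rewrite (eq_jet s oW E Wp0) (jetD s oW se (smoothZ _ oW sf0) Wp0).
  by rewrite (jetZ s _ oW sf0 Wp0) (jet_euler s oW sf0 Wp0 up0) sk mulNr subrr.
by have := EL x Wx; rewrite Eq0 => /eqP; rewrite subr_eq0 => /eqP.
Qed.

Lemma basic_lieE A S : basic W (A S) -> basic W (lieE A S).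
Proof.
move=> bA; have bE : basic W (eulerD (A S)).
  apply: (basic_sum oW) => j; apply: (basic_ucoord oW); exact: basic_partial.
have := basicD oW bE (basicZ oW (- #|S|%:R) bA).
by congr basic; apply/funext => x; rewrite /lieE mulNr.
Qed.

Lemma basic_divg A S : (forall S, basic W (A S)) -> basic W (divg A S).
Proof.
move=> bA; have b j : basic W (fun x => (if j \notin S then sg j S else 0) *
    partial (lift ord0 j) (A (j |: S)) x).
  by apply: (basicZ oW); apply: basic_partial.
have := basic_sum oW (index_enum _) b.
congr basic; apply/funext => x; rewrite /divg [RHS]big_mkcond/=.
by apply: eq_bigr => j _; case: (j \notin S); rewrite ?mul0r.
Qed.

(** The normal form of the part of a cocycle without [d_t]. [B] enters only through the second
    equation, which supplies the top-degree condition and a factorization of [L A2] through [E]. *)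
Lemma lieE_solve k A B : (0 < m)%N -> smooth_form U A -> deg_form U k A ->
  smooth_form U B ->
  (forall S x, U x -> wedgeE (dtf A) S x = 0) ->
  (forall S x, U x -> lieE A S x + wedgeE (dtf B) S x = 0) ->
  exists c A1, [/\ forall I S, ~~ adm I S -> c I S = 0,
    smooth_form U A1, pre_deg_form U k A1 &
    forall S x, U x -> A S x =
      (if #|S| == k then polyform k c S x else 0) + wedgeE (dtf A1) S x].
Proof.
move=> m0 sA dA sB EA LA.
have [|A0 [A2 [sA0 dA0 bA2 dA2 AE]]] := split_form sA dA EA.
  (* Both [eulerD] and [wedgeE] vanish on [u = 0], so there the [t]-derivative of the second cocycle
     equation reduces to [- m A_t = 0]. *)
  move=> km x Ux x0.
  have sL := smooth_lieE oU sA; have sEB := smooth_wedgeE oU (smooth_dtf sB).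
  have E y : U y -> (lieE A [set: 'I_m]%SET + wedgeE (dtf B) [set: 'I_m]%SET) y = 0.
    by move=> Uy; rewrite fctE LA.
  have := partial_eq0 ord0 oU E Ux.
  rewrite (partialD _ (smooth_C1 (sL _)) (smooth_C1 (sEB _)) Ux).
  rewrite -[partial _ _ x]/(dtf (lieE A) [set: 'I_m]%SET x) (dtf_lieE _ oU sA Ux).
  rewrite -[dt (wedgeE _ _) x]/(dtf (wedgeE (dtf B)) [set: 'I_m]%SET x).
  rewrite (dtf_wedgeE _ oU (smooth_dtf sB) Ux) (wedgeE_at0 _ _ x0) addr0.
  rewrite /lieE (eulerD_at0 _ x0) sub0r finset.cardsT card_ord => /eqP.
  by rewrite oppr_eq0 mulf_eq0 pnatr_eq0 eqn0Ngt m0/= => /eqP.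
pose Z S x : R^o := -1 * (dtf B S x + lieE (dtf A0) S x).
have sA2 : smooth_form U A2 by move=> S; exact: (smooth_cylU (bA2 S).1).
have sdA0 := smooth_dtf sA0.
have sEA0 : smooth_form U (wedgeE (dtf A0)) by move=> S; exact: (smooth_wedgeE oU sdA0 S).
have LA2 S x : U x -> lieE A2 S x = wedgeE Z S x.
  move=> Ux; rewrite /Z wedgeEZ wedgeED -(lieE_wedgeE S oU sdA0 Ux) mulN1r.
  have := LA S x Ux; rewrite (@eq_lieE U A (fun S x => wedgeE (dtf A0) S x + A2 S x) S x oU (AE S) Ux).
  rewrite (lieED S oU sEA0 sA2 Ux) => /eqP.
  by rewrite addrC addrA addr_eq0 => /eqP ->; rewrite opprK.
have tW (f g : form) : (forall S, tindep (f S)) -> (forall S, tindep (g S)) ->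
    (forall S x, U x -> f S x = g S x) -> forall S x, W x -> f S x = g S x.
  by move=> tf tg fg S x; apply: tindep_cyl => // y; exact: fg.
have bL S : basic W (lieE A2 S) by exact: basic_lieE.
have dL : deg_form W k (lieE A2).
  move=> S x Sk Wx; rewrite /lieE dA2// mulr0 subr0 /eulerD big1// => j _.
  by rewrite (partial_eq0 _ oW _ Wx) ?mulr0// => y Wy; exact: dA2.
have EL S x : W x -> wedgeE (lieE A2) S x = 0.
  move=> Wx; apply: (tW (wedgeE (lieE A2)) (fun _ => cst 0)) Wx => // [S' y z yz|S' y Uy].
    by apply: eq_bigr => j _; rewrite (tindep_ucoord j yz) ((bL _).2 _ _ yz).
  by rewrite (eq_wedgeE _ (B := wedgeE Z)) ?wedgeE_sqr// => S''; exact: LA2.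
have tL : k = m -> forall x, W x -> uproj x = 0 -> lieE A2 [set: 'I_m]%SET x = 0.
  move=> _ x [y Uy yx] x0; rewrite -((bL _).2 _ _ yx) LA2//.
  by apply: wedgeE_at0; rewrite yx.
(* [Z] may depend on [t]. The homotopy formula on the cylinder replaces it by a form built from
   [lieE A2], which does not. *)
have LE := koszul_star oW WW (fun S => (bL S).1) dL EL tL.
have bY S : basic W (radint udir 0 (m - k) (divg (lieE A2) S)).
  by apply: (basic_radint oW WW); exact: basic_divg.
have [Q [h [hQ dQ bh dh QE]]] := solve_form bA2 dA2 bY LE.
have [c [q [c0 hq dq qE]]] := homog_reduce oW WW Wp0 up0 hQ dQ.
(* Both [q] and [h] are independent of [t], so [E /\ (q + h)] equals [E /\ (t (q + h))_t]. *)
pose g S : space -> R^o := fun x => q S x + h S x.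
have bg S : basic W (g S) by exact: (basicD oW (hq S).1 (bh S)).
have sg' S : smooth U (g S) by exact: (smooth_cylU (bg S).1).
pose tg S : space -> R^o := tmul (g S).
have stg : smooth_form U tg by move=> S; exact: (smooth_tmul oU (sg' S)).
exists c, (fun S x => A0 S x + tg S x); split.
- exact: c0.
- by move=> S; exact: (smoothD oU (sA0 S) (stg S)).
- move=> S x Sk Ux; rewrite dA0// /tg /tmul /g dq// dh ?addr0 ?mulr0 ?addr0//.
  exact: sub_cyl.
move=> S x Ux; have Wx := sub_cyl Ux.
rewrite AE// QE// qE// [_ + wedgeE q S x]addrC addrCA -!addrA addrCA; congr (_ + _).
rewrite addrCA -!wedgeED; apply: eq_wedgeE => S'.
rewrite (dtfD _ oU sA0 stg Ux); congr (_ + _).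
by rewrite /dtf (dt_tmul oU (sg' S') (bg S').2 Ux).
Qed.

(** Once [A] is in normal form, [B] may only be changed by [L A0] with [E /\ A0_t = 0], besides
    [E /\ B0_t]. The form [A00] and the [t]-independent [h2] are of this kind. *)
Lemma book_form_span k A B : (0 < m)%N ->
  smooth_form U A -> deg_form U k A -> smooth_form U B -> pre_deg_form U k B ->
  (forall S x, U x -> wedgeE (dtf A) S x = 0) ->
  (forall S x, U x -> lieE A S x + wedgeE (dtf B) S x = 0) ->
  exists c c' A0 B0, [/\ smooth_form U A0 /\ pre_deg_form U k A0,
    smooth_form U B0 /\ (forall S x, #|S|.+2 != k -> U x -> B0 S x = 0),
    (forall I S, ~~ adm I S -> c I S = 0) /\ (forall I S, ~~ adm I S -> c' I S = 0),
    forall S x, U x -> A S x =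
      (if #|S| == k then polyform k c S x else 0) - wedgeE (dtf A0) S x &
    forall S x, U x -> B S x =
      (if #|S|.+1 == k then polyform k.-1 c' S x else 0) +
      (lieE A0 S x + wedgeE (dtf B0) S x)].
Proof.
move=> m0 sA dA sB dB EA LA.
have [c [A1 [c0 sA1 dA1 AE]]] := lieE_solve m0 sA dA sB EA LA.
have sdA1 := smooth_dtf sA1.
have preL C : pre_deg_form U k C -> pre_deg_form U k (lieE C).
  move=> dC S x Sk Ux; rewrite /lieE dC// mulr0 subr0 /eulerD big1// => j _.
  by rewrite (partial_eq0 _ oU _ Ux) ?mulr0// => y Uy; exact: dC.
have sN1 : smooth_form U (fun S x => -1 * A1 S x) by move=> S; exact: (smoothZ _ oU (sA1 S)).
have dtZ a C S x : smooth_form U C -> U x ->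
    dtf (fun S x => a * C S x) S x = a * dtf C S x.
  by move=> sC Ux; exact: (partialZ _ _ (smooth_C1 (sC S)) Ux).
have lieZ a C S x : smooth_form U C -> U x ->
    lieE (fun S x => a * C S x) S x = a * lieE C S x.
  by move=> sC Ux; rewrite /lieE (eulerDZ _ (sC S) Ux); ring.
(* For [k = 0] the form [B] is zero on [U], whereas [k.-1] is 0 and not -1, so the reduction in
   degree [k.-1] is kept for [k > 0]. *)
have [k0|k0] := posnP k.
  have z : smooth_form U (fun _ => cst 0) by move=> S; exact: (smooth_cst 0 oU).
  exists c, (fun _ _ => 0), (fun S x => -1 * A1 S x), (fun _ => cst 0); split=> //.
  - by split=> // S x Sk Ux; rewrite dA1// mulr0.
  - move=> S x Ux; rewrite AE//; congr (_ + _).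
    transitivity (- wedgeE (fun S x => -1 * dtf A1 S x) S x).
      by rewrite wedgeEZ mulN1r opprK.
    by congr (- _); apply: eq_wedgeE => S'; rewrite dtZ.
  - move=> S x Ux; have Sk : #|S|.+1 != k by rewrite k0.
    rewrite (dB S x Sk Ux) (lieZ _ _ _ _ sA1 Ux) (preL A1 dA1 S x Sk Ux) mulr0.
    rewrite (negPf Sk) !add0r /wedgeE big1// => j _.
    by rewrite [dtf _ _ x](partial_cst ord0 0 x) !mulr0.
pose P S : space -> R^o := if #|S| == k then polyform k c S else cst 0.
have sP : smooth_form U P.
  move=> S; rewrite /P; case: (#|S| == k); last exact: (smooth_cst 0 oU).
  exact: (smooth_polyform k c S oU).
have LP S x : U x -> lieE P S x = 0.
  move=> Ux; rewrite /lieE /P; have [Sk|_] := eqVneq #|S| k.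
    rewrite (homog_polyform oW k c S).2 ?Sk ?subrr//; exact: sub_cyl.
  by rewrite (homog_cst oW 0).2 ?mul0r ?mulr0 ?subrr//; exact: sub_cyl.
have AEP S x : U x -> A S x = P S x + wedgeE (dtf A1) S x.
  by move=> Ux; rewrite AE// /P; case: (#|S| == k).
have sEA1 : smooth_form U (wedgeE (dtf A1)) by move=> S; exact: (smooth_wedgeE oU sdA1 S).
(* What is left of [B] after removing the coboundary that accounts for [E /\ (A1)_t] in [A]. *)
pose B3 S : space -> R^o := fun x => B S x + lieE A1 S x.
have sLA1 := smooth_lieE oU sA1.
have sB3 : smooth_form U B3 by move=> S; exact: (smoothD oU (sB S) (sLA1 S)).
have dB3 : pre_deg_form U k B3.
  by move=> S x Sk Ux; rewrite /B3 dB// preL// addr0.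
have EB3 S x : U x -> wedgeE (dtf B3) S x = 0.
  move=> Ux; transitivity (wedgeE (fun S x => dtf B S x + lieE (dtf A1) S x) S x).
    by apply: eq_wedgeE => S'; rewrite (dtfD _ oU sB sLA1 Ux) (dtf_lieE _ oU sA1 Ux).
  rewrite wedgeED -(lieE_wedgeE S oU sdA1 Ux).
  have := LA S x Ux; rewrite (@eq_lieE U A (fun S x => P S x + wedgeE (dtf A1) S x) S x oU (AEP S) Ux) (lieED S oU sP sEA1 Ux) LP// add0r.
  by rewrite addrC.
(* Only for [k = m + 1] does [B] have top degree. There [L] is [-m] on [u = 0], so [B3 + L (B3 / m)]
   vanishes on [u = 0] together with its [t]-derivative. *)
pose a : R := if k == m.+1 then m%:R^-1 else 0.
pose A00 S : space -> R^o := fun x => a * B3 S x.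
have sA00 : smooth_form U A00 by move=> S; exact: (smoothZ _ oU (sB3 S)).
have dA00 : pre_deg_form U k A00 by move=> S x Sk Ux; rewrite /A00 dB3// mulr0.
have sdB3 := smooth_dtf sB3.
have EA00 S x : U x -> wedgeE (dtf A00) S x = 0.
  move=> Ux; transitivity (wedgeE (fun S x => a * dtf B3 S x) S x).
    by apply: eq_wedgeE => S'; exact: dtZ.
  by rewrite wedgeEZ EB3// mulr0.
pose B4 S : space -> R^o := fun x => B3 S x + lieE A00 S x.
have sLA00 := smooth_lieE oU sA00.
have sB4 : smooth_form U B4 by move=> S; exact: (smoothD oU (sB3 S) (sLA00 S)).
have dtB4 S x : U x -> dtf B4 S x = dtf B3 S x + a * lieE (dtf B3) S x.
  move=> Ux; rewrite (dtfD _ oU sB3 sLA00 Ux) (dtf_lieE _ oU sA00 Ux); congr (_ + _).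
  rewrite -(lieZ _ _ _ _ sdB3 Ux).
  apply: (eq_lieE oU _ Ux) => y Uy; exact: dtZ.
have dB4 : deg_form U k.-1 B4.
  move=> S x Sk Ux; have Sk' : #|S|.+1 != k.
    by apply: contra Sk => /eqP <-.
  by rewrite /B4 dB3// preL// addr0.
have EB4 S x : U x -> wedgeE (dtf B4) S x = 0.
  move=> Ux; transitivity (wedgeE (fun S x => dtf B3 S x + a * lieE (dtf B3) S x) S x).
    by apply: eq_wedgeE => S'; exact: dtB4.
  rewrite wedgeED wedgeEZ EB3// -(lieE_wedgeE S oU sdB3 Ux) add0r.
  have E y : U y -> wedgeE (dtf B3) S y = (fun _ : {set 'I_m} => cst 0) S y.
    by move=> Uy; rewrite EB3.
  rewrite (@eq_lieE U (wedgeE (dtf B3)) (fun _ => cst 0) S x oU E Ux) /lieE (homog_cst oW 0).2; last exact: sub_cyl.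
  by rewrite /= mul0r mulr0 subrr mulr0.
have [|B0 [B5 [sB0 dB0 bB5 dB5 B4E]]] := split_form sB4 dB4 EB4.
  move=> km x Ux x0; rewrite dtB4// /lieE (eulerD_at0 _ x0) sub0r finset.cardsT card_ord.
  have -> : a = m%:R^-1 by rewrite /a -km (prednK k0) eqxx.
  by rewrite mulrN mulrA mulVf ?mul1r ?subrr// pnatr_eq0 -lt0n.
have /choice[q /choice[h Hqh]] : forall S, exists q : space -> R^o, exists h,
    [/\ homog W k.-1 q, basic W h &
    forall x, W x -> B5 S x = q x + (eulerD h x - k.-1%:R * h x)].
  by move=> S; exact: (taylor oW WW up0 k.-1 (bB5 S)).
pose q2 := trunc k q; pose h2 := trunc k h.
have hq2 S : homog W k.-1 (q2 S).
  rewrite /q2 /trunc; case: (#|S|.+1 == k); first by have [] := Hqh S.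
  have := homogZ oW 0 (homog_polyform oW k.-1 (fun _ _ => 0) S).
  by congr homog; apply/funext => x; rewrite mul0r.
have bh2 S : basic W (h2 S).
  rewrite /h2 /trunc; case: (#|S|.+1 == k); last exact: (basic_cst oW 0).
  by have [] := Hqh S.
have dq2 : deg_form W k.-1 q2.
  move=> S x Sk Wx; rewrite /q2 /trunc; case: eqP => // E.
  by rewrite -E eqxx in Sk.
have sh2 : smooth_form U h2 by move=> S; exact: (smooth_cylU (bh2 S).1).
have B5E S x : W x -> B5 S x = q2 S x + lieE h2 S x.
  move=> Wx; rewrite /q2 /lieE /h2 /trunc; have [Sk|Sk] := eqVneq #|S|.+1 k.
    by have [_ _ ->//] := Hqh S; rewrite -Sk.
  rewrite dB5//; last by apply: contra Sk => /eqP ->; rewrite prednK.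
  by rewrite (homog_cst oW 0).2// mul0r /= mulr0 subrr addr0.
have [c' [q1 [c'0 hq1 dq1 q2E]]] := homog_reduce oW WW Wp0 up0 hq2 dq2.
pose tq S : space -> R^o := tmul (q1 S).
have sq1 S : smooth U (q1 S) by exact: (smooth_cylU (hq1 S).1.1).
have stq : smooth_form U tq by move=> S; exact: (smooth_tmul oU (sq1 S)).
pose A6 S : space -> R^o := fun x => A1 S x + A00 S x.
have sA6 : smooth_form U A6 by move=> S; exact: (smoothD oU (sA1 S) (sA00 S)).
have sNA6 : smooth_form U (fun S x => -1 * A6 S x) by move=> S; exact: (smoothZ _ oU (sA6 S)).
(* [h2] is independent of [t] and leaves [A] untouched; [tq] is [t q1], whose [t]-derivative [q1]
   absorbs the remaining [E /\ q1]. *)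
exists c, c', (fun S x => h2 S x + -1 * A6 S x), (fun S x => B0 S x + tq S x); split.
- split; first by move=> S; exact: (smoothD oU (sh2 S) (sNA6 S)).
  move=> S x Sk Ux; rewrite /A6 dA1// dA00// addr0 mulr0 addr0.
  by rewrite /h2 /trunc (negPf Sk).
- split; first by move=> S; exact: (smoothD oU (sB0 S) (stq S)).
  move=> S x Sk Ux; have Sk' : #|S|.+1 != k.-1.
    by apply: contra Sk => /eqP ->; rewrite prednK.
  by rewrite dB0// /tq /tmul dq1// mulr0 addr0.
- by [].
- move=> S x Ux; rewrite AE//; congr (_ + _).
  transitivity (- wedgeE (fun S x => -1 * (dtf A1 S x + dtf A00 S x)) S x); last first.
    congr (- _); apply: eq_wedgeE => S'.
    rewrite (dtfD _ oU sh2 sNA6 Ux) (dtZ _ _ _ _ sA6 Ux) (dtfD _ oU sA1 sA00 Ux).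
    by rewrite [dtf h2 _ _](partial_tindep x (bh2 S').2) add0r.
  by rewrite wedgeEZ wedgeED EA00// addr0 mulN1r opprK.
move=> S x Ux; have Wx := sub_cyl Ux.
have -> : B S x = B4 S x - (lieE A1 S x + lieE A00 S x).
  by rewrite /B4 /B3; ring.
rewrite B4E// B5E// q2E//.
rewrite (lieED S oU sh2 sNA6 Ux) (lieZ _ _ _ _ sA6 Ux) (lieED S oU sA1 sA00 Ux).
have -> : wedgeE (dtf (fun S x => B0 S x + tq S x)) S x =
    wedgeE (dtf B0) S x + wedgeE q1 S x.
  rewrite -wedgeED; apply: eq_wedgeE => S'.
  rewrite (dtfD _ oU sB0 stq Ux); congr (_ + _).
  exact: (dt_tmul oU (sq1 S') (hq1 S').1.2 Ux).
have -> : (#|S|.+1 == k) = (#|S| == k.-1) by rewrite -{1}(prednK k0) eqSS.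
have E (a1 b c1 d e f : R) : a1 + (b + c1 + d) - (e + f) = b + (d + -1 * (e + f) + (a1 + c1)).
  by ring.
exact: E.
Qed.

(** It serves both parts of a coboundary: [C = - A_t], [F = 0] without [d_t], and [C = B_t], [F = A]
    with it. Jets of order [k] at [p0] remove [E F - k F] and leave [epsmul] of the jets of [C]. As
    [E /\ E = 0], some [E /\ D] may be subtracted from [C] to make these jets vanish on
    non-admissible pairs; by [epsmul_inj] they are then zero. *)
Lemma book_form_indep k c C F : (0 < m)%N -> smooth_form U C -> smooth_form U F ->
  (forall I S, ~~ adm I S -> c I S = 0) ->
  (forall S x, #|S| = k -> U x -> polyform k c S x =
    wedgeE C S x + (eulerD (F S) x - k%:R * F S x)) ->
  forall I S, weakly_sorted I -> size I = k -> #|S| = k -> c I S = 0.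
Proof.
move=> m0 sC sF c0 cE.
pose r (i j : 'I_m) := (i <= j)%N.
have rt : total r by move=> i j; exact: leq_total.
have rT : transitive r by move=> i j l; exact: leq_trans.
have ra : antisymmetric r by move=> i j; rewrite -eqn_leq => /eqP/val_inj.
(* Only sorted lists occur in [polyform]; composing with [sort] makes the family symmetric, as
   [jet_polyform] requires. *)
pose cs I S := c (sort r I) S.
have pcs : perm_inv cs.
  by move=> I J S IJ; rewrite /cs; congr (c _ S); apply/perm_sortP.
have sortE I : weakly_sorted I -> sort r I = I by move=> sI; exact: sorted_sort.
have polyE S : polyform k c S = polyform k cs S.
  by apply/funext => x; apply: eq_bigr => I sI; rewrite /cs sortE.
have cs0 I S : ~~ adm I S -> cs I S = 0.
  by move=> nI; apply: c0; rewrite (adm_perm S (J := I)) ?perm_sort.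
suff H : forall I S, size I = k -> #|S| = k -> cs I S = 0.
  by move=> I S sI Ik Sk; rewrite -(sortE I sI); exact: H.
pose jC I S := jet p0 I (C S).
have pjC : perm_inv jC by move=> I J S IJ; exact: (jet_perm oU (sC S) Up0 IJ).
have csE I S : size I = k -> #|S| = k -> cs I S = epsmul jC I S.
  move=> Ik Sk; rewrite -(jet_polyform S oU Up0 up0 pcs Ik) -polyE.
  have sEC := smooth_wedgeE oU sC S.
  have se := smooth_euler oU (sF S).
  have sZ := smoothZ (- k%:R) oU (sF S).
  have E y : U y -> polyform k c S y = (fun y => wedgeE C S y +
      (eulerD (F S) y + (- k%:R) * F S y)) y.
    by move=> Uy; rewrite cE// mulNr.
  rewrite (eq_jet I oU E Up0) (jetD I oU sEC (smoothD oU se sZ) Up0).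
  rewrite (jetD I oU se sZ Up0) (jetZ I _ oU (sF S) Up0).
  rewrite (jet_euler I oU (sF S) Up0 up0) Ik mulNr subrr addr0.
  exact: (jet_wedgeE S I oU sC Up0 up0).
move=> I S Ik Sk; have [k0|k0] := posnP k.
  rewrite csE// /epsmul big1// => j jS; move: Sk.
  by rewrite k0 (cardsD1 j S) jS.
have [d [pd d0 dE]] := epsmul_solve pjC.
pose d' I S := if #|S|.+1 == k.-1 then d I S else 0.
have pd' : perm_inv d' by move=> I' J' S' IJ; rewrite /d' (pd _ _ _ IJ).
pose D := polyform k.-2 d'.
have sD : smooth_form U D by move=> S'; exact: (smooth_polyform k.-2 d' S' oU).
have sED : smooth_form U (wedgeE D) by move=> S'; exact: (smooth_wedgeE oU sD S').
pose C1 S : space -> R^o := fun x => C S x + -1 * wedgeE D S x.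
pose jC1 I S := if (size I == k.-1) && (#|S| == k.-1) then jet p0 I (C1 S) else 0.
have jED I' S' : size I' = k.-1 -> #|S'| = k.-1 -> jet p0 I' (wedgeE D S') = epsmul d I' S'.
  move=> Ik' Sk'; rewrite (jet_wedgeE S' I' oU sD Up0 up0).
  apply: eq_bigr => j jS; congr (_ * _); case: ifP => // jI.
  have Sj : #|S' :\ j|.+1 == k.-1 by rewrite -Sk' (cardsD1 j S') jS.
  rewrite /D (jet_polyform _ oU Up0 up0 pd') ?size_rem ?Ik'//.
  by rewrite /d' Sj.
have jC1_0 I' S' : ~~ adm I' S' -> jC1 I' S' = 0.
  move=> nI; rewrite /jC1; case: ifP => // /andP[/eqP Ik' /eqP Sk'].
  rewrite (jetD I' oU (sC S') (smoothZ _ oU (sED S')) Up0) (jetZ I' _ oU (sED S') Up0).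
  by rewrite jED// dE// mulN1r subrr.
have jC1E I' S' : size I' = k -> #|S'| = k -> epsmul jC I' S' = epsmul jC1 I' S'.
  move=> Ik' Sk'.
  have -> : epsmul jC I' S' = epsmul (fun I S => jet p0 I (C1 S)) I' S'.
    have sC1 : smooth_form U C1 by move=> T; exact: (smoothD oU (sC T) (smoothZ _ oU (sED T))).
    rewrite -(jet_wedgeE S' I' oU sC Up0 up0) -(jet_wedgeE S' I' oU sC1 Up0 up0).
    apply: (eq_jet I' oU _ Up0) => y Uy.
    by rewrite /C1 wedgeED wedgeEZ wedgeE_sqr mulr0 addr0.
  apply: eq_bigr => j jS; congr (_ * _); case: ifP => // jI.
  by rewrite /jC1 size_rem// Ik' eqxx/= -Sk' (cardsD1 j S') jS eqxx.
have jC1z I' S' : size I' = k.-1 -> #|S'| = k.-1 -> jC1 I' S' = 0.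
  apply: (epsmul_inj m0 jC1_0) => I2 S2; rewrite (prednK k0) => I2k S2k nI2.
  by rewrite -jC1E// -csE// cs0.
rewrite csE// jC1E// /epsmul big1// => j jS; case: ifP => jI; rewrite ?mulr0//.
by rewrite jC1z ?mulr0 ?size_rem ?Ik// -Sk (cardsD1 j S) jS.
Qed.

End OnU.
End BookForms.

(** * Counting admissible pairs *)

Lemma basis_iso (R : realType) (V : lmodType R) (I : finType) (e : I -> V) (N : nat) :
  is_basis e -> #|I| = N -> exists f : {linear V -> 'rV[R]_N}, bijective f.
Proof.
move=> [efree espan] IN.
have /choice[a aE] := espan.
have auniq v b : v = \sum_i b i *: e i -> forall i, b i = a v i.
  move=> vE i; apply/eqP; rewrite -subr_eq0; apply/eqP.
  apply: (efree (fun i => b i - a v i)).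
  under eq_bigr => j _ do rewrite scalerBl.
  by rewrite sumrB -vE -aE subrr.
pose idx (j : 'I_N) : I := enum_val (cast_ord (esym IN) j).
pose rk (i : I) : 'I_N := cast_ord IN (enum_rank i).
have rkK : cancel rk idx by move=> i; rewrite /idx /rk cast_ordK enum_rankK.
have idxK : cancel idx rk by move=> i; rewrite /idx /rk enum_valK cast_ordKV.
pose f v : 'rV[R]_N := \row_j a v (idx j).
have lf : linear f.
  move=> c u v; apply/rowP => j; rewrite !mxE; apply/esym.
  apply: (auniq _ (fun i => c * a u i + a v i)).
  under eq_bigr => i _ do rewrite scalerDl -scalerA.
  by rewrite big_split/= -scaler_sumr -!aE.
pose F := HB.pack_for {linear V -> 'rV[R]_N} f (GRing.isLinear.Build _ _ _ _ f lf).
exists F; exists (fun r : 'rV[R]_N => \sum_i r 0 (rk i) *: e i) => [v|r].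
  by rewrite [RHS]aE; apply: eq_bigr => i _; rewrite mxE rkK.
apply/rowP => j; rewrite mxE -(auniq _ (fun i => r 0 (rk i)) erefl).
by rewrite idxK.
Qed.

Section MultiIndices.
Local Close Scope classical_set_scope.
Context {m : nat}.
Implicit Types (I J : seq 'I_m) (S : {set 'I_m}) (i j : 'I_m).

Lemma ltn_ord_sorted_eq J J' : sorted (fun i j : 'I_m => (i < j)%N) J ->
  sorted (fun i j : 'I_m => (i < j)%N) J' ->
  [set j in J]%SET = [set j in J']%SET -> J = J'.
Proof.
move=> sJ sJ' E; apply: (@irr_sorted_eq _ (fun i j : 'I_m => (i < j)%N)) => //.
- by move=> a b c; exact: ltn_trans.
- by move=> a; rewrite /= ltnn.
- by move=> j; move/setP/(_ j): E; rewrite !inE.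
Qed.

Lemma sorted_enum S : sorted (fun i j : 'I_m => (i < j)%N) (enum S).
Proof.
rewrite /enum_mem -enumT; apply: sorted_filter.
  by move=> a b c; exact: ltn_trans.
rewrite -(@sorted_map _ _ val ltn) val_enum_ord; exact: iota_ltn_sorted.
Qed.

Lemma uniq_ltn_sorted J : sorted (fun i j : 'I_m => (i < j)%N) J -> uniq J.
Proof.
apply: sorted_uniq; first by move=> a b c; exact: ltn_trans.
by move=> a; rewrite /= ltnn.
Qed.

Lemma card_set_seq J : sorted (fun i j : 'I_m => (i < j)%N) J ->
  #|[set j in J]%SET| = size J.
Proof. by move=> /uniq_ltn_sorted uJ; rewrite cardsE; exact/card_uniqP. Qed.

Lemma set_enum_seq S : [set j in enum S]%SET = S.
Proof. by apply/setP => j; rewrite inE mem_enum. Qed.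

Lemma max_idx_compl J : max_idx (compl_idx J) = cmax [set j in J]%SET.
Proof.
rewrite /max_idx /compl_idx /cmax big_filter big_enum_cond/=.
by apply: eq_bigl => j; rewrite !inE.
Qed.

Lemma admissibleE I J : admissible I J =
  [&& weakly_sorted I, sorted (fun i j : 'I_m => (i < j)%N) J & adm I [set j in J]%SET].
Proof. by rewrite /admissible /multi_idx_pair /adm max_idx_compl andbA. Qed.

Lemma weakly_sorted_rcons I i : weakly_sorted (rcons I i) =
  weakly_sorted I && all (fun j : 'I_m => (j <= i)%N) I.
Proof.
have rT : transitive (fun i j : 'I_m => (i <= j)%N) by move=> a b c; exact: leq_trans.
rewrite /weakly_sorted -cats1 !sorted_pairwise// pairwise_cat/= andbT andbC.
by congr (_ && _); rewrite allrel1r.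
Qed.

Definition adm_set k := [set IS : k.-tuple 'I_m * {set 'I_m} |
  [&& weakly_sorted IS.1, #|IS.2| == k & adm IS.1 IS.2]]%SET.

Definition nadm_set k := [set IS : k.-tuple 'I_m * {set 'I_m} |
  [&& weakly_sorted IS.1, #|IS.2| == k & ~~ adm IS.1 IS.2]]%SET.

Lemma card_nadm0 : #|nadm_set 0| = 0%N.
Proof.
apply: eq_card0 => -[I S]; rewrite !inE/= (tuple0 I) /adm /max_idx big_nil.
by rewrite leq0n !andbF.
Qed.

(** The largest index missing from [S] is added to both components. By admissibility it is at least
    every entry of [I], so appending it at the end keeps the list sorted; the inverse drops the last
    entry. *)
Lemma card_adm_nadm k : (0 < m)%N -> #|adm_set k| = #|nadm_set k.+1|.
Proof.
move=> m0; pose top S := odflt (Ordinal m0) [pick i : 'I_m | i.+1 == cmax S].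
have topE S : (0 < cmax S)%N -> top S \notin S /\ (top S).+1 = cmax S.
  move=> /cmax_mem[i iS iE]; rewrite /top; case: pickP => [j /eqP jE|/(_ i)]/=.
    suff -> : j = i by [].
    by apply/val_inj; apply/eqP; rewrite -eqSS jE iE.
  by rewrite iE eqxx.
pose f (IS : k.-tuple 'I_m * {set 'I_m}) :=
  ([tuple of rcons IS.1 (top IS.2)], top IS.2 |: IS.2).
have fin IS : IS \in adm_set k -> (top IS.2 \notin IS.2 /\ (top IS.2).+1 = cmax IS.2).
  rewrite inE => /and3P[_ /eqP Sk a]; apply: topE.
  by apply: adm_cmax_gt0 a => //; rewrite size_tuple.
rewrite -(@card_in_imset _ _ f); last first.
  move=> [I S] [I' S'] /fin/= [tS _] /fin/= [tS' _] [/rcons_inj[II' tt]].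
  rewrite tt => SS; congr (_, _); first exact: val_inj.
  by rewrite -(finset.setU1K tS) tt SS finset.setU1K.
congr (#|pred_of_set _|)%N; apply/setP => -[I S]; apply/imsetP/idP.
  move=> [[I' S'] /[dup] /fin/= [tS tE]]; rewrite inE/= => /and3P[sI' /eqP Sk a].
  have [nA _] := nadm_cons tS tE a; move=> [-> ->].
  rewrite inE/= cardsU1 tS Sk eqxx/= weakly_sorted_rcons sI'/=.
  rewrite (@adm_perm _ _ (top S' :: I')) ?nA ?andbT ?perm_rcons//.
  by apply/allP => j jI; rewrite -ltnS tE (leq_trans _ a)// max_idx_ge.
rewrite inE/= => /and3P[sI /eqP Sk nA].
have [i [iI iS iE iC]] := nadm_top nA.
have [b bk IE] : exists2 b, size b = k & tval I = rcons b i.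
  move: sI iI iE (size_tuple I); case/lastP: (tval I) => // b z.
  rewrite weakly_sorted_rcons => /andP[_ /allP le] iI iE; rewrite size_rcons => -[bk].
  exists b => //; congr rcons.
  apply/val_inj/eqP; rewrite eqn_leq -ltnS iE max_idx_ge ?mem_rcons ?mem_head//=.
  by move: iI; rewrite mem_rcons inE => /predU1P[->//|/le].
have tS : top (S :\ i) = i.
  have [|_] := topE (S :\ i); first by rewrite iC.
  by rewrite iC => -[/val_inj].
have bk' : size b == k by apply/eqP.
exists (Tuple bk', S :\ i); last first.
  by rewrite /f/= tS finset.setD1K//; congr (_, _); exact/val_inj.
rewrite inE/=; apply/and3P; split.
- by move: sI; rewrite IE weakly_sorted_rcons => /andP[].
- by move: Sk; rewrite (cardsD1 i S) iS add1n => -[->].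
- have := adm_rem S iE; rewrite IE (@adm_perm _ _ b)// -(perm_cons i).
  rewrite perm_sym; apply: perm_trans (perm_to_rem _); last by rewrite mem_rcons mem_head.
  by rewrite perm_sym perm_rcons.
Qed.

Lemma card_ltn_pairs k (I : finType) (P : pred I) :
  #|[set IS : I * {set 'I_m} | P IS.1 && (#|IS.2| == k)]%SET| = (#|P| * 'C(m, k))%N.
Proof.
have -> : [set IS : I * {set 'I_m} | P IS.1 && (#|IS.2| == k)]%SET =
    finset.setX [set i | P i]%SET [set S : {set 'I_m} | #|S| == k]%SET.
  by apply/setP => -[i S]; rewrite !inE.
rewrite cardsX cardsE; congr (_ * _)%N.
have := card_draws 'I_m k; rewrite card_ord => <-.
by apply: eq_card => S; rewrite !inE.
Qed.

Lemma card_weakly_sorted k : (0 < m)%N ->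
  #|[pred I : k.-tuple 'I_m | weakly_sorted I]| = 'C(m + k - 1, k).
Proof.
case: m => // m' _; rewrite addSn subn1/= addnC -card_sorted_tuples.
by apply: eq_card => I; rewrite !inE sorted_map.
Qed.

Lemma card_adm_nadm_set k : (0 < m)%N ->
  (#|adm_set k| + #|nadm_set k|)%N = ('C(m, k) * 'C(m + k - 1, k))%N.
Proof.
move=> m0; rewrite mulnC -card_weakly_sorted// -card_ltn_pairs.
rewrite -[RHS](cardsID [set IS : k.-tuple 'I_m * {set 'I_m} | adm IS.1 IS.2]%SET).
by congr (_ + _)%N; apply: eq_card => -[I S]; rewrite !inE/= ?andbA//;
  case: (adm _ _); rewrite ?andbT ?andbF.
Qed.

Section Families.
(** An abstract enumeration of the admissible pairs of length [l], so that [adm_pair] with [l = k]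
    and [adm_pair_pred] with [l = k - 1] are treated at once. *)
Variables (B : finType) (l : nat) (ij : B -> l.-tuple 'I_m * l.-tuple 'I_m).
Hypotheses (ij_inj : injective ij)
  (ij_adm : forall b, admissible (ij b).1 (ij b).2)
  (ij_sur : forall IJ : l.-tuple 'I_m * l.-tuple 'I_m,
    admissible IJ.1 IJ.2 -> exists b, ij b = IJ).

Definition idx_set b : l.-tuple 'I_m * {set 'I_m} :=
  ((ij b).1, [set j in (ij b).2]%SET).

Lemma idx_set_inj : injective idx_set.
Proof.
move=> b b' [E1 E2]; apply: ij_inj; rewrite [LHS]surjective_pairing [RHS]surjective_pairing.
rewrite E1; congr (_, _); apply/val_inj; apply: ltn_ord_sorted_eq E2.
  by have := ij_adm b; rewrite admissibleE => /and3P[].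
by have := ij_adm b'; rewrite admissibleE => /and3P[].
Qed.

Lemma idx_setP b : idx_set b \in adm_set l.
Proof.
have := ij_adm b; rewrite admissibleE inE/= => /and3P[-> sJ ->].
by rewrite card_set_seq// size_tuple eqxx.
Qed.

Lemma idx_set_sur IS : IS \in adm_set l -> exists b, idx_set b = IS.
Proof.
case: IS => I S; rewrite inE/= => /and3P[sI /eqP Sl a].
have eS : size (enum S) == l by rewrite -cardE Sl.
have [b bE] : exists b, ij b = (I, Tuple eS).
  by apply: ij_sur; rewrite admissibleE/= sI sorted_enum set_enum_seq.
by exists b; rewrite /idx_set bE/= set_enum_seq.
Qed.

Lemma card_idx_set : #|B| = #|adm_set l|.
Proof.
rewrite -(card_imset _ idx_set_inj); apply: eq_card => IS; apply/imsetP/idP.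
  by move=> [b _ ->]; exact: idx_setP.
by move=> /idx_set_sur[b <-]; exists b.
Qed.

Variable R : realType.
Implicit Types F : B -> R.

(** The coefficients of the combination of the monomials [u_I d_J] with weights [F], in the form
    that [polyform] expects. *)
Definition coef F I S : R :=
  \sum_b F b * (((ij b).1 == I :> seq _) && ([set j in (ij b).2]%SET == S))%:R.

Lemma coef_nadm F I S : ~~ adm I S -> coef F I S = 0.
Proof.
move=> nA; rewrite /coef big1// => b _.
case: andP => [[/eqP IE /eqP SE]|_]; last by rewrite mulr0.
have := ij_adm b; rewrite admissibleE IE => /and3P[_ _].
by rewrite SE (negPf nA).
Qed.

Lemma coef_idx F b : coef F (ij b).1 [set j in (ij b).2]%SET = F b.
Proof.
rewrite /coef (bigD1 b)//= !eqxx mulr1 big1 ?addr0// => b' bb'.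
case: andP => [[/eqP/val_inj IE /eqP SE]|_]; last by rewrite mulr0.
by move/eqP: bb'; case; apply: idx_set_inj; rewrite /idx_set IE SE.
Qed.

Lemma coef_of c I S : (forall I S, ~~ adm I S -> c I S = 0) ->
  weakly_sorted I -> size I = l -> #|S| = l ->
  coef (fun b => c (ij b).1 [set j in (ij b).2]%SET) I S = c I S.
Proof.
move=> c0 sI Il Sl; have [a|nA] := boolP (adm I S); last by rewrite c0// coef_nadm.
have tI : size I == l by apply/eqP.
have [|b [bI bS]] := idx_set_sur (IS := (Tuple tI, S)).
  by rewrite inE/= sI Sl eqxx.
by have := coef_idx (fun b => c (ij b).1 [set j in (ij b).2]%SET) b; rewrite bI bS.
Qed.

Lemma polyform_coef F S (x : 'rV[R]_m.+1) :
  polyform l (coef F) S x =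
  \sum_b F b * ([set j in (ij b).2]%SET == S)%:R * umonomial (ij b).1 x.
Proof.
rewrite /polyform; under eq_bigr => I _ do rewrite /coef mulr_suml.
rewrite exchange_big/=; apply: eq_bigr => b _.
have sI : weakly_sorted (ij b).1.
  by have := ij_adm b; rewrite admissibleE => /and3P[].
rewrite (bigD1 (ij b).1)//= eqxx/= big1 ?addr0// => I /andP[_ /negbTE Ib].
by rewrite (inj_eq val_inj) eq_sym Ib/= mulr0 mul0r.
Qed.

Lemma polyform_coef_of c S (x : 'rV[R]_m.+1) :
  (forall I S, ~~ adm I S -> c I S = 0) ->
  polyform l (coef (fun b => c (ij b).1 [set j in (ij b).2]%SET)) S x =
  if #|S| == l then polyform l c S x else 0.
Proof.
move=> c0; case: eqP => [Sl|Sl].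
  by apply: eq_bigr => I sI; rewrite coef_of// size_tuple.
rewrite polyform_coef big1// => b _; case: eqP => [SE|_]; last by rewrite mulr0 mul0r.
case: Sl; have := idx_setP b; rewrite inE/= => /and3P[_ /eqP E _].
by rewrite -SE.
Qed.

End Families.

Lemma adm_pairP k (b : adm_pair m k) : admissible (val b).1 (val b).2.
Proof. by case: b. Qed.

Lemma adm_pair_predP k (b : adm_pair_pred m k) : admissible (val b).1 (val b).2.
Proof. by case: b => IJ /= /andP[]. Qed.

Lemma adm_pair_pred_gt0 k (b : adm_pair_pred m k) : (0 < k)%N.
Proof. by case: b => IJ /= /andP[]. Qed.

Lemma adm_pair_sur k (IJ : k.-tuple 'I_m * k.-tuple 'I_m) :
  admissible IJ.1 IJ.2 -> exists b : adm_pair m k, val b = IJ.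
Proof. by move=> a; exists (exist _ IJ a). Qed.

Lemma adm_pair_pred_sur k (IJ : k.-1.-tuple 'I_m * k.-1.-tuple 'I_m) : (0 < k)%N ->
  admissible IJ.1 IJ.2 -> exists b : adm_pair_pred m k, val b = IJ.
Proof. by move=> k0 a; have a' := introT andP (conj k0 a); exists (exist _ IJ a'). Qed.

Lemma card_adm_pair k : #|{: adm_pair m k}| = #|adm_set k|.
Proof. exact: (card_idx_set val_inj (@adm_pairP k) (@adm_pair_sur k)). Qed.

Lemma card_adm_pair_pred k : (0 < m)%N -> #|{: adm_pair_pred m k}| = #|nadm_set k|.
Proof.
move=> m0; case: k => [|k].
  by rewrite card_nadm0; apply: eq_card0 => -[].
rewrite -(card_adm_nadm k m0).
exact: (card_idx_set val_inj (@adm_pair_predP k.+1) (fun IJ => @adm_pair_pred_sur k.+1 IJ isT)).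
Qed.

Lemma card_book_index n k : (2 <= n)%N -> m = n.-1 ->
  #|{: adm_pair_pred m k + adm_pair m k}| = ('C(n.-1, k) * 'C(n + k - 2, k))%N.
Proof.
case: n => [//|[//|n]] _ mE; rewrite card_sum card_adm_pair card_adm_pair_pred ?mE//.
by rewrite -mE addnC card_adm_nadm_set mE// !addSn subn1 subn2.
Qed.

End MultiIndices.

(** * The generators *)

Section Assembly.
Local Close Scope classical_set_scope.
Context {R : realType} {m : nat}.
Local Notation space := 'rV[R]_m.+1.
Local Notation form := ({set 'I_m} -> space -> R^o).
Implicit Types (P Q : mvfield R m.+1) (A B : form) (x y : space).
Implicit Types (S : {set 'I_m}) (T : {set 'I_m.+1}) (j : 'I_m) (I J : seq 'I_m).
Implicit Types U : set space.
Local Opaque partial.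
Local Notation "0t" := (ord0 : 'I_m.+1).
Local Notation up := (lift (ord0 : 'I_m.+1)).

(* A + dt /\ B *)
Definition mvform A B : mvfield R m.+1 := fun T =>
  if 0t \in T then B (unliftS T) else A (unliftS T).

Lemma upart_mvform A B : upart (mvform A B) = A.
Proof. by apply/funext => S; rewrite /upart /mvform ord0_liftS liftSK. Qed.

Lemma tpart_mvform A B : tpart (mvform A B) = B.
Proof. by apply/funext => S; rewrite /tpart /mvform setU11 ord0U_liftSK'. Qed.

Lemma lift_set_ind (Pr : {set 'I_m.+1} -> Prop) :
  (forall S, Pr (liftS S)) -> (forall S, Pr (0t |: liftS S)) -> forall T, Pr T.
Proof. by move=> h1 h2 T; rewrite (unliftSK T); case: ifP. Qed.

Lemma eq_on_parts U P Q :
  (forall S x, U x -> upart P S x = upart Q S x) ->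
  (forall S x, U x -> tpart P S x = tpart Q S x) -> eq_on U P Q.
Proof. by move=> hu ht; apply: lift_set_ind => S x Ux; [exact: hu|exact: ht]. Qed.

Lemma smooth_mvfield_parts U k P :
  smooth_form U (upart P) -> smooth_form U (tpart P) ->
  deg_form U k (upart P) -> pre_deg_form U k (tpart P) -> smooth_mvfield U k P.
Proof.
move=> su st du dt; split; first by apply: lift_set_ind => S; [exact: su|exact: st].
apply: lift_set_ind => S x.
  by rewrite card_liftS => Sk Ux; exact: du.
by rewrite card_ord0U => Sk Ux; exact: dt.
Qed.

Lemma smooth_mvfield_components U k P : smooth_mvfield U k P ->
  [/\ smooth_form U (upart P), smooth_form U (tpart P),
      deg_form U k (upart P) & pre_deg_form U k (tpart P)].
Proof.
move=> [sP dP]; split=> [S|S|S x Sk|S x Sk]; [exact: sP|exact: sP| |].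
- by apply: dP; rewrite card_liftS.
- by apply: dP; rewrite card_ord0U.
Qed.

Lemma cocycle_parts U k P :
  smooth_mvfield U k P ->
  (forall S x, U x -> wedgeE (dtf (upart P)) S x = 0) ->
  (forall S x, U x -> lieE (upart P) S x + wedgeE (dtf (tpart P)) S x = 0) ->
  cocycle U book k P.
Proof.
move=> sP hu ht; split=> //; apply: lift_set_ind => S x Ux.
  by rewrite schouten_book_upart -/(wedgeE (dtf (upart P)) S x) hu// oppr0.
by rewrite schouten_book_tpart; exact: ht.
Qed.

Lemma cocycle_components U k P : cocycle U book k P ->
  (forall S x, U x -> wedgeE (dtf (upart P)) S x = 0) /\
  (forall S x, U x -> lieE (upart P) S x + wedgeE (dtf (tpart P)) S x = 0).
Proof.
move=> [_ cP]; split=> S x Ux.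
  by have /eqP := cP (liftS S) x Ux; rewrite schouten_book_upart oppr_eq0 => /eqP.
by have := cP (0t |: liftS S) x Ux; rewrite schouten_book_tpart.
Qed.

(** The description is uniform in [k]: for [k = 0] the degree conditions leave only [A = B = 0] on
    [U], in agreement with [coboundary]. *)
Lemma coboundaryE U k P : open U -> smooth_mvfield U k P ->
  coboundary U book k P <-> exists A B, [/\ smooth_form U A /\ pre_deg_form U k A,
    smooth_form U B /\ (forall S x, #|S|.+2 != k -> U x -> B S x = 0),
    forall S x, U x -> upart P S x = - wedgeE (dtf A) S x &
    forall S x, U x -> tpart P S x = lieE A S x + wedgeE (dtf B) S x].
Proof.
move=> oU sP; case: k sP => [|l] sP; split.
- move=> P0; have z : smooth_form U (fun _ => cst 0) by move=> S; exact: (smooth_cst 0 oU).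
  exists (fun _ => cst 0), (fun _ => cst 0); split=> //.
  + move=> S x Ux; rewrite /upart P0// [wedgeE _ _ _]big1 ?oppr0// => j _.
    by rewrite [dtf _ _ x](partial_cst ord0 0 x) !mulr0.
  + move=> S x Ux; rewrite /tpart P0// [wedgeE _ _ _]big1 ?addr0 => [|j _]; last first.
      by rewrite [dtf _ _ x](partial_cst ord0 0 x) !mulr0.
    rewrite /lieE /eulerD big1 ?mulr0 ?subr0// => j _.
    by rewrite partial_cst mulr0.
- move=> [A [B [[sA dA] [sB dB] uP tP]]]; apply: eq_on_parts => S x Ux.
    rewrite uP// [wedgeE _ _ _]big1 ?oppr0// => j _.
    by rewrite [dtf _ _ x](partial_eq0 _ oU _ Ux) ?mulr0// => y Uy; exact: dA.
  rewrite tP// [wedgeE _ _ _]big1 ?addr0 => [|j _]; last first.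
    by rewrite [dtf _ _ x](partial_eq0 _ oU _ Ux) ?mulr0// => y Uy; exact: dB.
  rewrite /lieE dA// /eulerD big1 ?mulr0 ?subr0// => j _.
  by rewrite (partial_eq0 _ oU _ Ux) ?mulr0// => y Uy; exact: dA.
- move=> [Q /smooth_mvfield_components[sA sB dA dB] PQ].
  exists (upart Q), (tpart Q); split.
  + by split=> // S x Sk Ux; exact: (dA S x Sk Ux).
  + by split=> // S x Sk Ux; exact: (dB S x Sk Ux).
  + by move=> S x Ux; rewrite /upart PQ// schouten_book_upart.
  + by move=> S x Ux; rewrite /tpart PQ// schouten_book_tpart.
- move=> [A [B [[sA dA] [sB dB] uP tP]]]; exists (mvform A B).
    apply: smooth_mvfield_parts; rewrite ?upart_mvform ?tpart_mvform//.
  apply: lift_set_ind => S x Ux.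
    by rewrite schouten_book_upart upart_mvform; exact: uP.
  by rewrite schouten_book_tpart upart_mvform tpart_mvform; exact: tP.
Qed.

(** [J] is increasing, so each wedge inserts an index below all the others and no sign arises. *)
Lemma dwedgeE J T x : sorted (fun i j : 'I_m => (i < j)%N) J ->
  (dwedge J : mvfield R m.+1) T x = (T == liftS [set j in J]%SET)%:R.
Proof.
elim: J T x => [|j J IH] T x sJ.
  rewrite /= /mv1; congr (_ == _)%:R.
  apply: liftSP => [|i]; rewrite ?ord0_liftS ?mem_liftS !inE//.
have jJ : j \notin J.
  by have := uniq_ltn_sorted sJ; rewrite /= => /andP[].
have sJ' : sorted (fun i j : 'I_m => (i < j)%N) J by exact: path_sorted sJ.
have E : liftS [set i in j :: J]%SET = up j |: liftS [set i in J]%SET.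
  by rewrite liftSU1; congr liftS; apply/setP => i; rewrite !inE.
rewrite -[dwedge _]/(wedge (du j) (dwedge J)).
rewrite (@wedge_mono _ _ (du j) (dwedge J) [set up j]%SET 1 T x); last first.
  by move=> T'; rewrite mul1r.
rewrite finset.sub1set mul1r IH// E; case: ifPn => jT; last first.
  by case: eqP jT => // ->; rewrite setU11.
have -> : (T :\: [set up j] == liftS [set i in J])%SET = (T == up j |: liftS [set i in J]%SET).
  apply/eqP/eqP => [<-|->]; first by rewrite setD_single finset.setD1K.
  by rewrite setD_single finset.setU1K// mem_liftS inE.
case: eqP => [->|_]; last by rewrite mulr0.
rewrite setD_single finset.setU1K ?mem_liftS ?inE// ext_sign_up /sg.
rewrite (_ : [set i in _ | _]%SET = finset.set0) ?cards0//; last first.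
  apply/setP => i; rewrite !inE; apply/negP => /andP[iJ ij].
  move: sJ; rewrite /= (path_sortedE (leT := fun i j : 'I_m => (i < j)%N)); last first.
    by move=> a b c; exact: ltn_trans.
  by move=> /andP[/allP/(_ i iJ) ji _]; rewrite ltnNge ltnW in ij.
by rewrite expr0 mulr1.
Qed.

Lemma liftS_inj : injective (@liftS m).
Proof. by move=> S S' /(congr1 unliftS); rewrite !liftSK. Qed.

Definition monoform (IJ : seq 'I_m * seq 'I_m) : form := fun S x =>
  ([set j in IJ.2]%SET == S)%:R * umonomial IJ.1 x.

Lemma upart_gen IJ S x : sorted (fun i j : 'I_m => (i < j)%N) IJ.2 ->
  upart (mvscale (umonomial IJ.1) (dwedge IJ.2)) S x = monoform IJ S x.
Proof.
move=> sJ; rewrite /upart /mvscale dwedgeE// (inj_eq liftS_inj) eq_sym.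
by rewrite mulrC.
Qed.

Lemma tpart_gen IJ S x : sorted (fun i j : 'I_m => (i < j)%N) IJ.2 ->
  tpart (mvscale (umonomial IJ.1) (dwedge IJ.2)) S x = 0.
Proof.
move=> sJ; rewrite /tpart /mvscale dwedgeE// (_ : (_ == _) = false) ?mulr0//.
by apply/negP => /eqP/setP/(_ 0t); rewrite ord0_liftS setU11.
Qed.

Lemma upart_dt_wedge P S x : upart (wedge dt P) S x = 0.
Proof.
rewrite /upart (@wedge_mono _ _ dt P [set 0t]%SET 1); last by move=> T'; rewrite mul1r.
by rewrite finset.sub1set ord0_liftS.
Qed.

Lemma tpart_dt_wedge P S x : tpart (wedge dt P) S x = upart P S x.
Proof.
rewrite /tpart (@wedge_mono _ _ dt P [set 0t]%SET 1); last by move=> T'; rewrite mul1r.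
by rewrite finset.sub1set setU11 setD_single ord0U_liftSK ext_sign_ord0 !mul1r.
Qed.

Section Generators.
Variable k : nat.
Local Notation gen := (@book_generator R m k).

Lemma sorted_adm I J : admissible I J -> sorted (fun i j : 'I_m => (i < j)%N) J.
Proof. by rewrite admissibleE => /and3P[]. Qed.

Lemma upart_inl b : upart (gen (inl b)) = fun _ => cst 0.
Proof. by apply/funext => S; apply/funext => x; rewrite upart_dt_wedge. Qed.

Lemma tpart_inl b :
  tpart (gen (inl b)) = monoform (val (val b).1, val (val b).2).
Proof.
apply/funext => S; apply/funext => x; rewrite tpart_dt_wedge.
rewrite -(@upart_gen (val (val b).1, val (val b).2))//=.
exact: sorted_adm (adm_pair_predP b).
Qed.

Lemma upart_inr b :
  upart (gen (inr b)) = monoform (val (val b).1, val (val b).2).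
Proof.
apply/funext => S; apply/funext => x.
rewrite -(@upart_gen (val (val b).1, val (val b).2))//=.
exact: sorted_adm (adm_pairP b).
Qed.

Lemma tpart_inr b : tpart (gen (inr b)) = fun _ => cst 0.
Proof.
apply/funext => S; apply/funext => x.
rewrite (@tpart_gen (val (val b).1, val (val b).2))//=.
exact: sorted_adm (adm_pairP b).
Qed.

Lemma smooth_monoform U IJ : open U -> smooth_form U (monoform IJ).
Proof. by move=> oU S; exact: (smoothZ _ oU (smooth_umonomial _ oU)). Qed.

Lemma deg_monoform U l IJ : sorted (fun i j : 'I_m => (i < j)%N) IJ.2 ->
  size IJ.2 = l -> deg_form U l (monoform IJ).
Proof.
move=> sJ Jl S x Sl _; rewrite /monoform (_ : (_ == _) = false) ?mul0r//.
by apply: contraNF Sl => /eqP <-; rewrite card_set_seq ?Jl.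
Qed.

Lemma wedgeE_dtf_tindep A S x : (forall S, tindep (A S)) -> wedgeE (dtf A) S x = 0.
Proof.
move=> tA; rewrite [LHS]big1// => j _.
by rewrite [dtf _ _ x](partial_tindep x (tA _)) !mulr0.
Qed.

Lemma tindep_monoform IJ S : tindep (monoform IJ S).
Proof.
by move=> x y xy; congr (_ * _); apply: eq_bigr => i _; exact: tindep_ucoord.
Qed.

(** Nothing depends on [t], and [L] kills [u_I d_J] because [I] and [J] have the same length; the
    generators with [d_t] have no other part on which [L] could act. *)
Lemma book_generator_cocycle U b : open U -> cocycle U book k (gen b).
Proof.
move=> oU; have z : smooth_form U (fun _ => cst 0) by move=> S; exact: (smooth_cst 0 oU).
have tz S : tindep (cst 0 : space -> R^o) by [].
apply: cocycle_parts.
- apply: smooth_mvfield_parts; case: b => b; rewrite ?upart_inl ?upart_inr ?tpart_inl ?tpart_inr//.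
  + exact: smooth_monoform.
  + exact: smooth_monoform.
  + by apply: deg_monoform; [exact: sorted_adm (adm_pairP b)|rewrite /= size_tuple].
  + move=> S x Sk; apply: (@deg_monoform _ k.-1).
    - exact: sorted_adm (adm_pair_predP b).
    - by rewrite /= size_tuple.
    - apply: contra Sk => /eqP ->; rewrite prednK//.
      exact: adm_pair_pred_gt0 b.
- move=> S x Ux; apply: wedgeE_dtf_tindep => S'.
  by case: b => b; rewrite ?upart_inl ?upart_inr//; exact: tindep_monoform.
- move=> S x Ux; rewrite wedgeE_dtf_tindep ?addr0; last first.
    by move=> S'; case: b => b; rewrite ?tpart_inl ?tpart_inr//; exact: tindep_monoform.
  case: b => b; rewrite ?upart_inl ?upart_inr.
    by rewrite /lieE (homog_cst oU 0).2//= mul0r mulr0 subrr.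
  set IJ := (_, _); rewrite /lieE.
  rewrite (eulerDZ _ (smooth_umonomial IJ.1 oU) Ux).
  rewrite (homog_umonomial oU IJ.1).2// size_tuple /monoform.
  case: eqP => [<-|_]; last by rewrite !mul0r mulr0 subrr.
  rewrite card_set_seq ?size_tuple; last exact: sorted_adm (adm_pairP b).
  by rewrite !mul1r subrr.
Qed.

Lemma upart_gen_sum (a : adm_pair_pred m k + adm_pair m k -> R) S x :
  upart (\sum_b a b *: gen b) S x =
  polyform k (coef val (fun b => a (inr b))) S x.
Proof.
rewrite /upart mvsumE big_sumType/= big1 ?add0r => [|b _]; last first.
  have -> : (a (inl b) *: gen (inl b)) (liftS S) x = a (inl b) * upart (gen (inl b)) S x.
    by [].
  by rewrite upart_inl mulr0.
rewrite (polyform_coef (@adm_pairP m k)); apply: eq_bigr => b _.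
have -> : (a (inr b) *: gen (inr b)) (liftS S) x = a (inr b) * upart (gen (inr b)) S x.
  by [].
by rewrite upart_inr mulrA.
Qed.

Lemma tpart_gen_sum (a : adm_pair_pred m k + adm_pair m k -> R) S x :
  tpart (\sum_b a b *: gen b) S x =
  polyform k.-1 (coef val (fun b => a (inl b))) S x.
Proof.
rewrite /tpart mvsumE big_sumType/= [X in _ + X]big1 ?addr0 => [|b _]; last first.
  have -> : (a (inr b) *: gen (inr b)) (0t |: liftS S) x = a (inr b) * tpart (gen (inr b)) S x.
    by [].
  by rewrite tpart_inr mulr0.
rewrite (polyform_coef (@adm_pair_predP m k)); apply: eq_bigr => b _.
have -> : (a (inl b) *: gen (inl b)) (0t |: liftS S) x = a (inl b) * tpart (gen (inl b)) S x.
  by [].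
by rewrite tpart_inl mulrA.
Qed.

End Generators.
End Assembly.

(** * Cohomology *)

Lemma cyl_scal_into (R : realType) (m : nat) (U : set 'rV[R]_m.+1) :
  star_shaped_at 0 (uproj @` U) -> scal_into (@udir m) 0 (cyl U) (cyl U).
Proof.
move=> [_ star] x [y Uy yx] r r01.
have [|z Uz zE] := star (uproj y) r _ r01; first by exists y.
exists z => //; rewrite zE yx scaler0 add0r; apply/rowP => j.
rewrite !mxE /ucoord !mxE /udir eq_sym neq_lift.
by rewrite subr0 add0r.
Qed.

Section Cohomology.
Variables (R : realType) (m : nat) (U : set 'rV[R]_m.+1) (oU : open U) (k : nat).
Hypotheses (m0 : (0 < m)%N)
  (cU : forall u : 'rV[R]_m, connected (U `&` uproj @^-1` [set u]))
  (Ustar : star_shaped_at 0 (uproj @` U)).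
Local Notation index := (adm_pair_pred m k + adm_pair m k)%type.
Local Notation gen := (@book_generator R m k).
Local Notation cocycles := (cocycles oU book k).
Implicit Types a : index -> R.

Definition gen_cocycle (b : index) : cocycles := insubd 0 (gen b).

Lemma val_gen_cocycle b : val (gen_cocycle b) = gen b.
Proof. by rewrite insubdK//; apply/asboolP; exact: book_generator_cocycle. Qed.

Definition gen_sum a : cocycles := \sum_b a b *: gen_cocycle b.

Lemma val_gen_sum a : val (gen_sum a) = \sum_b a b *: gen b.
Proof.
rewrite /gen_sum raddf_sum; apply: eq_bigr => b _.
by rewrite -val_gen_cocycle; exact: linearZ.
Qed.

Lemma coh_gen_sum a : \sum_b a b *: coh_class oU book k (gen b) = coh_class_of (gen_sum a).
Proof.
have E c (P : cocycles) : c *: coh_class_of P = coh_class_of (c *: P).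
  exact: coh_scale_class.
rewrite /gen_sum; elim/big_ind2 : _ => [|x y x' y' -> ->|b _].
- apply/esym/(addrI (coh_class_of (0 : cocycles))).
  by rewrite -coh_class_ofD !addr0.
- by rewrite coh_class_ofD.
- exact: E.
Qed.

Lemma coh_gen_sum_eq a (P : cocycles) :
  coh_class_of P = coh_class_of (gen_sum a) <->
  coboundary U book k (val P - \sum_b a b *: gen b).
Proof.
have E : val (P - gen_sum a) = val P - \sum_b a b *: gen b.
  by rewrite raddfB/= val_gen_sum.
rewrite -E; split; last by move=> h; apply/eqP; rewrite coh_class_of_eq; exact/asboolP.
by move/eqP; rewrite coh_class_of_eq => /asboolP.
Qed.

Lemma cocycle_valP (P : cocycles) : cocycle U book k (val P).
Proof. by case: P => P /= /asboolP. Qed.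

Lemma smooth_gen_sum a : smooth_mvfield U k (\sum_b a b *: gen b).
Proof. by rewrite -val_gen_sum; exact: (cocycle_valP _).1. Qed.

Lemma origin_point : exists2 p0, U p0 & uproj p0 = 0.
Proof. by have [p0 Up0 E] := Ustar.1; exists p0. Qed.

Lemma book_basis : is_basis (fun b : index => coh_class oU book k (gen b)).
Proof.
have [p0 Up0 up0] := origin_point.
have WW := cyl_scal_into Ustar.
split=> [a a0|v].
  have z0 : coh_class_of (0 : cocycles) = 0.
    by apply: (addrI (coh_class_of (0 : cocycles))); rewrite -coh_class_ofD !addr0.
  have cb : coboundary U book k (\sum_b a b *: gen b).
    have : coh_class_of (gen_sum a) = coh_class_of (0 : cocycles).
      by rewrite -coh_gen_sum a0 z0.
    by move/eqP; rewrite coh_class_of_eq subr0 -val_gen_sum => /asboolP.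
  have [A [B [[sA dA] [sB dB] uP tP]]] := (coboundaryE oU (smooth_gen_sum a)).1 cb.
  have z : smooth_form U (fun _ => cst 0) by move=> S; exact: (smooth_cst 0 oU).
  case=> b.
    have k0 := adm_pair_pred_gt0 b.
    rewrite -(coef_idx val_inj (@adm_pair_predP m k) (fun b => a (inl b)) b).
    apply: (@book_form_indep R m U oU p0 Up0 up0 k.-1 _ (dtf B) A) => //.
    - exact: smooth_dtf.
    - exact: (coef_nadm (@adm_pair_predP m k)).
    - move=> S x Sk Ux; rewrite -tpart_gen_sum tP// addrC; congr (_ + _).
      by rewrite /lieE Sk.
    - by have := adm_pair_predP b; rewrite admissibleE => /and3P[].
    - by rewrite size_tuple.
    - rewrite card_set_seq ?size_tuple//; exact: sorted_adm (adm_pair_predP b).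
  rewrite -(coef_idx val_inj (@adm_pairP m k) (fun b => a (inr b)) b).
  apply: (@book_form_indep R m U oU p0 Up0 up0 k _ (fun S x => -1 * dtf A S x) (fun _ => cst 0)) => //.
  - move=> S; exact: (smoothZ _ oU (smooth_dtf sA S)).
  - exact: (coef_nadm (@adm_pairP m k)).
  - move=> S x Sk Ux; rewrite -upart_gen_sum uP// wedgeEZ mulN1r.
    by rewrite (homog_cst oU 0).2// mul0r /= mulr0 subrr addr0.
  - by have := adm_pairP b; rewrite admissibleE => /and3P[].
  - by rewrite size_tuple.
  - rewrite card_set_seq ?size_tuple//; exact: sorted_adm (adm_pairP b).
pose P : cocycles := repr (v : Quotient.quot (@coboundaries R m.+1 U oU book k)).
have [uP tP] := cocycle_components (cocycle_valP P).
have [sA sB dA dB] := smooth_mvfield_components (cocycle_valP P).1.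
have [c [c' [A0 [B0 [[sA0 dA0] [sB0 dB0] [c0 c'0] AE BE]]]]] :=
  book_form_span oU cU WW Up0 up0 m0 sA dA sB dB uP tP.
pose a (b : index) : R := match b with
  | inl b => c' (val b).1 [set j in (val b).2]%SET
  | inr b => c (val b).1 [set j in (val b).2]%SET
  end.
exists a; rewrite coh_gen_sum -[v](coh_class_of_repr) -/P; apply/coh_gen_sum_eq.
apply/(coboundaryE oU).
  have := smooth_mvfield_lin (-1) oU (smooth_gen_sum a) (cocycle_valP P).1.
  by rewrite scaleN1r addrC.
have z : smooth_form U (fun _ => cst 0) by move=> S; exact: (smooth_cst 0 oU).
exists A0, B0; split=> // S x Ux.
  have -> : upart (val P - \sum_b a b *: gen b) S x =
    upart (val P) S x - upart (\sum_b a b *: gen b) S x by [].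
  rewrite AE// upart_gen_sum.
  rewrite (polyform_coef_of val_inj (@adm_pairP m k) (@adm_pair_sur m k))//.
  by rewrite addrAC subrr add0r.
have -> : tpart (val P - \sum_b a b *: gen b) S x =
  tpart (val P) S x - tpart (\sum_b a b *: gen b) S x by [].
rewrite BE// tpart_gen_sum.
have -> : polyform k.-1 (coef val (fun b => a (inl b))) S x =
    if #|S|.+1 == k then polyform k.-1 c' S x else 0.
  (* For [k = 0] there are no generators with [d_t], although [k.-1] is again 0. *)
  have [k0|k0] : k = 0%N \/ (0 < k)%N by case: (k); [left|right].
    rewrite [in RHS]k0 (polyform_coef (@adm_pair_predP m k)) big1// => b _.
    by case/eqP: (lt0n_neq0 (adm_pair_pred_gt0 b)).
  rewrite (polyform_coef_of val_inj (@adm_pair_predP m k))//.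
    by rewrite -eqSS (prednK k0).
  by move=> IJ; exact: adm_pair_pred_sur.
by rewrite addrAC subrr add0r.
Qed.

End Cohomology.

Theorem theorem2p7 (R : realType) (n : nat) (hn : (2 <= n)%N)
    (U : set 'rV[R]_(n.-1).+1) (oU : open U)
    (Ufibers : forall u : 'rV[R]_(n.-1), connected (U `&` uproj @^-1` [set u]))
    (Ustar : star_shaped_at 0 (uproj @` U)) (k : nat) :
  (exists f : {linear cohomology oU book k ->
                 'rV[R]_('C(n.-1, k) * 'C(n + k - 2, k))}, bijective f) /\
  (forall b : adm_pair_pred n.-1 k + adm_pair n.-1 k,
     cocycle U book k (book_generator b)) /\
  is_basis (fun b : adm_pair_pred n.-1 k + adm_pair n.-1 k =>
     coh_class oU book k (book_generator b)).
Proof.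
have n0 : (0 < n.-1)%N by case: n hn {U oU Ufibers Ustar} => [|[]].
have gb := book_basis oU k n0 Ufibers Ustar.
split; first exact: (basis_iso gb (card_book_index k hn erefl)).
split=> // b; exact: book_generator_cocycle.
Qed.
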